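(* Let $(\mathcal P,\le)$ be a finite preordered set, let $\underline{\mathcal A}=(\mathcal A,I)$ be a $\mathcal P$-strict interlaced weak ditalgebra, and let $\Gamma$ be its right algebra. For $i\in\mathcal P$ put $P'_i:=\Gamma\otimes_{\underline A}Q_i$ and $\Delta'_i:=\Gamma\otimes_{\underline A}S_i$. Then $\{P'_i\}_{i\in\mathcal P}$ is a complete family of representatives of the (isoclasses of) indecomposable projective $\Gamma$-modules, and $\mathcal H':=(\mathcal P,\le,\{\Delta'_i\}_{i\in\mathcal P})$ is a strict homological system for $\Gamma$.
   Context: $k$ is algebraically closed and acts centrally on all algebras and bimodules. A preordered set has a reflexive transitive relation $\le$; $i\sim j$ means $i\le j$ and $j\le i$; $\overline i$ is the class of $i$; $\overline i<\overline j$ means $i\le j$ and $i\not\sim j$. Homological systems. A (finite) homological system $(\mathcal P,\le,\{\Delta_i\}_{i\in\mathcal P})$ for a finite-dimensional $k$-algebra $\Lambda$ consists of a finite preordered set and pairwise non-isomorphic indecomposable finite-dimensional $\Lambda$-modules with: $\operatorname{Hom}_\Lambda(\Delta_i,\Delta_j)\ne0$ implies $i\le j$; $\operatorname{Ext}^1_\Lambda(\Delta_i,\Delta_j)\ne0$ implies $\overline i<\overline j$. It is admissible if $\Lambda$ has a finite filtration by submodules with successive quotients isomorphic to modules in $\{\Delta_i\}$ and the number of isoclasses of indecomposable projective $\Lambda$-modules is $|\mathcal P|$. An admissible one is strict if for all $n\ge1$, $\operatorname{Ext}^n_\Lambda(\Delta_i,\Delta_j)\ne0$ implies $\overline i<\overline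 j$. $\mathcal P$-strict interlaced weak ditalgebras. $\underline{\mathcal A}=(\mathcal A,I)$ with $\mathcal A=(T,\delta)$, where: $S=\bigoplus_{i\in\mathcal P}ke_i$ is a finite product of $|\mathcal P|$ copies of $k$, with primitive orthogonal central idempotents $e_i$, $1=\sum e_i$; $W_0,W_1$ are finite-dimensional $S$-$S$-bimodules; $T=T_S(W_0\oplus W_1)$ is graded with $W_0$ in degree $0$, $W_1$ in degree $1$; $A=T_0=T_S(W_0)$, $V=T_1=A\otimes_SW_1\otimes_SA$; $\delta:T\to T$ is homogeneous linear of degree $1$, with $\delta(ab)=\delta(a)b+(-1)^{|a|}a\delta(b)$ and $\delta(S)=0$; $I$ is an ideal of $A$. It is required that: - (triangular layer) there are filtrations by $S$-$S$-subbimodules $0=W_0^0\subseteq\cdots\subseteq W_0^r=W_0$ with $\delta(W_0^{i+1})\subseteq A_iW_1A_i$ ($A_i$ the $S$-subalgebra generated by $W_0^i$) and $0=W_1^0\subseteq\cdots\subseteq W_1^s=W_1$ with $\delta(W_1^{i+1})\subseteq AW_1^iAW_1^iA$; - (interlaced) $\delta(I)\subseteq IV+VI$, $\delta^2(A)\subseteq IV^2+VIV+V^2I$, $\delta^2(V)\subseteq IV^3+VIV^2+V^2IV+V^3I$; - ($I$ triangular) there are subspaces $0=H_0\subseteq\cdots\subseteq H_t=I$ with $\delta(H_i)\subseteq AH_{i-1}V+VH_{i-1}A$ for $i\ge1$; - ($\mathcal P$-strict) $e_jW_1e_i\ne0$ implies $i\le j$; $e_jW_0e_i\ne0$ implies $\overline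 i<\overline j$; and $I\subseteq\operatorname{rad}(A)^2$. Modules. $\underline{\mathcal A}\text{-mod}$ has as objects the finite-dimensional left $A$-modules $M$ with $IM=0$ (i.e. finite-dimensional modules over $\underline A:=A/I$); a morphism $M\to N$ is a pair $(f^0,f^1)$ with $f^0\in\operatorname{Hom}_k(M,N)$, $f^1\in\operatorname{Hom}_{A\text{-}A}(V,\operatorname{Hom}_k(M,N))$ and $af^0[m]=f^0[am]+f^1(\delta(a))[m]$; composition is $gf=(g^0f^0,(gf)^1)$, $(gf)^1(v)=g^0f^1(v)+g^1(v)f^0+\sum_jg^1(u_j)f^1(v_j)$ if $\delta(v)=\sum_ju_jv_j$, $u_j,v_j\in V$. Right algebra. $\Gamma=\operatorname{End}_{\underline{\mathcal A}}(\underline A)^{op}$; it is an $\underline A$-algebra via $\underline A\cong\operatorname{End}_{\underline A}(\underline A)^{op}\to\Gamma$, $f^0\mapsto(f^0,0)$. The modules $S_i$, $Q_i$. $\underline P_i=\underline Ae_i$, $S_i=\underline P_i/\operatorname{rad}(\underline P_i)$. $\underline{\mathcal E}$ is the class of composable pairs in $\underline{\mathcal A}\text{-mod}$ isomorphic there to pairs $M'\xrightarrow{(\varphi^0,0)}E'\xrightarrow{(\psi^0,0)}N'$ with $0\to M'\xrightarrow{\varphi^0}E'\xrightarrow{\psi^0}N'\to0$ exact in $S\text{-mod}$; it is an exact structure, and $\underline{\mathcal E}$-projective means projective for it. For $i,j\in\mathcal P$, $i\prec j$ means that there is a non-trivial path from $i$ to $j$ in the quiver with vertex set $\mathcal P$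 and $\dim_ke_jW_0e_i$ arrows from $i$ to $j$. $\{Q_i\}_{i\in\mathcal P}$ denotes a complete family of representatives of the isoclasses of indecomposable $\underline{\mathcal E}$-projective objects of $\underline{\mathcal A}\text{-mod}$, pairwise non-isomorphic and indexed so that in $\underline{\mathcal A}\text{-mod}$ one has $\underline P_i\cong Q_i\oplus\bigoplus_{i\prec j}m_{i,j}Q_j$ for some integers $m_{i,j}\ge0$ (such a family exists). *)

(* Defs.v *)
From HB Require Import structures.
From mathcomp Require Import all_boot all_algebra.
From mathcomp Require Import boolp classical_sets.
From mathcomp Require Import freeg.

Set Implicit Arguments.
Unset Strict Implicit.
Unset Printing Implicit Defensive.

Import GRing.Theory.
Local Open Scope ring_scope.
Local Open Scope classical_set_scope.
Local Open Scope quotient_scope.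

(* A k-algebra is a ring with a central ring morphism from k.  Unlike algType, *)
(* it may be the zero ring, which is what an empty preordered set gives.       *)

Record kalgType (k : fieldType) := KAlg {
  kalg_ring :> pzRingType;
  kin : {rmorphism k -> kalg_ring};
  kin_central : forall (c : k) (x : kalg_ring), kin c * x = x * kin c
}.
Arguments kin {k} k0 : rename.

(* A left B-module is an [lmodType B]; k acts on it through B. *)
Definition kscale (k : fieldType) (B : kalgType k) (M : lmodType B)
  (c : k) (m : M) : M := kin B c *: m.
Notation "c *k: m" := (kscale c m) (at level 40, left associativity) : ring_scope.

Section KLinear.
Variables (k : fieldType) (B C : kalgType k).

Definition klinear (M : lmodType B) (N : lmodType C) (f : M -> N) : Prop :=
  forall (c : k) (x y : M), f (c *k: x + y) = c *k: f x + f y.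

Definition kalg_hom (f : B -> C) : Prop :=
  [/\ @klinear B^o C^o f, f 1 = 1 & forall x y, f (x * y) = f x * f y].

Definition fdim (M : lmodType B) : Prop :=
  exists (n : nat) (b : 'I_n -> M),
    forall x, exists c : 'I_n -> k, x = \sum_i c i *k: b i.

Definition subspace (M : lmodType B) (U : set M) : Prop :=
  U 0 /\ forall (c : k) x y, U x -> U y -> U (c *k: x + y).

Definition kspan (M : lmodType B) (X : set M) : set M :=
  [set x | forall U, subspace U -> X `<=` U -> U x].

(* The product XY of two subsets of an algebra: the span of the products xy. *)
Definition mulset (X Y : set B) : set B :=
  kspan (M := B^o) [set z | exists x y, [/\ X x, Y y & z = x * y]].

Definition addset (X Y : set B) : set B :=
  [set z | exists x y, [/\ X x, Y y & z = x + y]].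

Definition subalgebra (U : set B) : Prop :=
  [/\ subspace (M := B^o) U, U 1 & forall x y, U x -> U y -> U (x * y)].

Definition gen_subalgebra (X : set B) : set B :=
  [set x | forall U, subalgebra U -> X `<=` U -> U x].

End KLinear.

Record submod (B : pzRingType) (M : lmodType B) := Submod {
  smset :> M -> Prop;
  smP : smset 0 /\ forall (a : B) x y, smset x -> smset y -> smset (a *: x + y)
}.

Section Submodules.
Variables (B : pzRingType) (M : lmodType B) (U : submod M).

Definition smpred : {pred M} := fun x => `[< smset U x >].

Fact smpred_closed : submod_closed smpred.
Proof.
by case: (smP U) => U0 UL; split=> [|a x y /asboolP Ux /asboolP Uy];
  apply/asboolP; [|exact: UL].
Qed.
HB.instance Definition _ := GRing.isSubmodClosed.Build B M smpred smpred_closed.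

Definition sub_of := {x : M | x \in smpred}.
HB.instance Definition _ := [isSub for (@sval M _ : sub_of -> M)].
HB.instance Definition _ := [Choice of sub_of by <:].
HB.instance Definition _ := [SubChoice_isSubZmodule of sub_of by <:].
HB.instance Definition _ := [SubZmodule_isSubLmodule of sub_of by <:].

Definition quo_of := Quotient.quot smpred.
HB.instance Definition _ := GRing.Zmodule.on quo_of.
Definition quo_pi (x : M) : quo_of := \pi_(Quotient.quot smpred) x.
Definition quo_repr (x : quo_of) : M := @repr _ (Quotient.quot smpred) x.

Lemma quo_piK x : quo_pi (quo_repr x) = x.
Proof. exact: reprK. Qed.

Lemma quo_eq (x y : M) : quo_pi x = quo_pi y <-> U (x - y).
Proof.
split=> [/eqP|Uxy]; last (apply/eqP; rewrite -[_ == _]/(x == y %[mod Quotient.quot smpred])).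
  by rewrite -[_ == _]/(x == y %[mod Quotient.quot smpred]) -Quotient.idealrBE => /asboolP.
by rewrite -Quotient.idealrBE; apply/asboolP.
Qed.

Lemma quo_piD x y : quo_pi (x + y) = quo_pi x + quo_pi y.
Proof. exact: (raddfD (\pi_(Quotient.quot smpred))). Qed.

Definition quo_scale (a : B) (x : quo_of) : quo_of := quo_pi (a *: quo_repr x).

Lemma quo_piZ a x : quo_pi (a *: x) = quo_scale a (quo_pi x).
Proof.
apply/quo_eq; rewrite -scalerBr -[_ *: _]addr0.
apply: (smP U).2 (smP U).1; apply/quo_eq; by rewrite quo_piK.
Qed.

Fact quo_scaleA a b x : quo_scale a (quo_scale b x) = quo_scale (a * b) x.
Proof. by rewrite -[x]quo_piK -!quo_piZ scalerA. Qed.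
Fact quo_scale1 : left_id 1 quo_scale.
Proof. by move=> x; rewrite -[x]quo_piK -!quo_piZ scale1r. Qed.
Fact quo_scaleDr : right_distributive quo_scale +%R.
Proof.
move=> a x y; rewrite -[x]quo_piK -[y]quo_piK.
by rewrite -quo_piD -!quo_piZ scalerDr quo_piD.
Qed.
Fact quo_scaleDl x : {morph quo_scale^~ x : a b / a + b}.
Proof.
by move=> a b; rewrite -[x]quo_piK -!quo_piZ scalerDl quo_piD.
Qed.
HB.instance Definition _ := GRing.Zmodule_isLmodule.Build B quo_of
  quo_scaleA quo_scale1 quo_scaleDr quo_scaleDl.

End Submodules.

Section GenSubmod.
Variables (B : pzRingType) (M : lmodType B) (X : set M).
Fact gen_submod_subproof (G := fun x : M =>
    forall U : submod M, X `<=` U -> U x) :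
  G 0 /\ forall (a : B) x y, G x -> G y -> G (a *: x + y).
Proof.
split=> [U _|a x y Gx Gy U XU]; first exact: (smP U).1.
by apply: (smP U).2; [apply: Gx|apply: Gy].
Qed.
Definition gen_submod : submod M := Submod gen_submod_subproof.
End GenSubmod.

(* U / (U `&` W), the quotient U / W when W is contained in U *)
Section Subquotient.
Variables (B : pzRingType) (M : lmodType B) (U W : submod M).
Fact subquo_subproof : W (val (0 : sub_of U)) /\
  forall (a : B) (x y : sub_of U), W (val x) -> W (val y) -> W (val (a *: x + y)).
Proof.
split=> [|a x y Wx Wy]; first exact: (smP W).1.
rewrite linearP; exact: (smP W).2.
Qed.
Definition subquo : lmodType B := 
  quo_of (Submod (smset := fun x : sub_of U => W (val x)) subquo_subproof).
End Subquotient.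

Section Subalgebra.
Variables (k : fieldType) (B : kalgType k) (U : set B).
Hypothesis UP : subalgebra U.

Definition sapred : {pred B} := fun x => `[< U x >].

Fact sapred_closed : subring_closed sapred.
Proof.
case: UP => -[U0 UL] U1 UM; split=> [|x y|x y]; rewrite ?[_ \in sapred]/(sapred _).
- exact/asboolP.
- move=> /asboolP Ux /asboolP Uy; apply/asboolP; rewrite addrC.
  by have := UL (- 1) y x Uy Ux; rewrite /kscale rmorphN1 scaleN1r.
- by move=> /asboolP Ux /asboolP Uy; apply/asboolP; exact: UM.
Qed.

Fact sapred_kin c : kin B c \in sapred.
Proof.
case: UP => -[U0 UL] U1 _; apply/asboolP.
by have := UL c 1 0 U1 U0; rewrite addr0 /kscale [_ *: _]mulr1.
Qed.
End Subalgebra.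

Record ksubalg (k : fieldType) (B : kalgType k) := KSubalg {
  ksa_set :> B -> Prop; ksa_P : subalgebra ksa_set }.

Section SubalgebraType.
Variables (k : fieldType) (B : kalgType k) (U : ksubalg B).
Local Notation p := (sapred (ksa_set U)).

HB.instance Definition _ := GRing.isSubringClosed.Build B p
  (sapred_closed (ksa_P U)).
Definition suba := {x : B | x \in p}.
HB.instance Definition _ := [isSub for (@sval B _ : suba -> B)].
HB.instance Definition _ := [Choice of suba by <:].
HB.instance Definition _ :=
  GRing.SubChoice_isSubPzRing.Build B p suba (subringClosedP _).

Definition suba_kin (c : k) : suba := Sub (kin B c) (sapred_kin (ksa_P U) c).
Fact suba_kin_zmod : zmod_morphism suba_kin.
Proof. by move=> x y; apply: val_inj; rewrite /= rmorphB. Qed.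
Fact suba_kin_monoid : monoid_morphism suba_kin.
Proof. by split=> [|x y]; apply: val_inj; rewrite /= ?rmorph1 ?rmorphM. Qed.
HB.instance Definition _ := GRing.isZmodMorphism.Build k suba suba_kin suba_kin_zmod.
HB.instance Definition _ := GRing.isMonoidMorphism.Build k suba suba_kin suba_kin_monoid.
Fact suba_kin_central c (x : suba) : suba_kin c * x = x * suba_kin c.
Proof. by apply: val_inj; exact: kin_central. Qed.
Definition subalg_of : kalgType k := KAlg suba_kin_central.
End SubalgebraType.

Record ideal (B : pzRingType) := Ideal {
  ideal_submod :> submod B^o;
  idealMr : forall x y, ideal_submod x -> ideal_submod (x * y)
}.

Section QuotientAlgebra.
Variables (k : fieldType) (B : kalgType k) (I : ideal B).

Definition quoa := quo_of I.
HB.instance Definition _ := GRing.Zmodule.on quoa.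
Definition quoa_mul (x y : quoa) : quoa := quo_pi I (quo_repr x * quo_repr y : B).

Lemma quoa_piM (x y : B) :
  quo_pi I (x * y : B) = quoa_mul (quo_pi I x) (quo_pi I y).
Proof.
apply/quo_eq; set x' := quo_repr _; set y' := quo_repr _.
have hx : I (x - x') by apply/quo_eq; rewrite quo_piK.
have hy : I (y - y') by apply/quo_eq; rewrite quo_piK.
have -> : x * y - x' * y' = x *: (y - y' : B^o) + (x - x') * y'.
  by rewrite [_ *: _]mulrBr mulrBl addrA subrK.
apply: (smP I).2 => //; exact: idealMr.
Qed.

Let piK := quo_piK (U := I).
Fact quoa_mulA : associative quoa_mul.
Proof. by move=> x y z; rewrite -[x]piK -[y]piK -[z]piK -!quoa_piM mulrA. Qed.
Fact quoa_mul1l : left_id (quo_pi I 1) quoa_mul.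
Proof. by move=> x; rewrite -[x]piK -!quoa_piM mul1r. Qed.
Fact quoa_mul1r : right_id (quo_pi I 1) quoa_mul.
Proof. by move=> x; rewrite -[x]piK -!quoa_piM mulr1. Qed.
Fact quoa_mulDl : left_distributive quoa_mul +%R.
Proof.
move=> x y z; rewrite -[x]piK -[y]piK -[z]piK.
by rewrite -quo_piD -!quoa_piM mulrDl quo_piD.
Qed.
Fact quoa_mulDr : right_distributive quoa_mul +%R.
Proof.
move=> x y z; rewrite -[x]piK -[y]piK -[z]piK.
by rewrite -quo_piD -!quoa_piM mulrDr quo_piD.
Qed.
HB.instance Definition _ := GRing.Zmodule_isPzRing.Build quoa
  quoa_mulA quoa_mul1l quoa_mul1r quoa_mulDl quoa_mulDr.

Definition quoa_pi (x : B) : quoa := quo_pi I x.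
Fact quoa_pi_zmod : zmod_morphism quoa_pi.
Proof. exact: (raddfB (\pi_(Quotient.quot (smpred I)))). Qed.
Fact quoa_pi_monoid : monoid_morphism quoa_pi.
Proof. by split=> [|x y]; [|exact: quoa_piM]. Qed.
HB.instance Definition _ := GRing.isZmodMorphism.Build B quoa quoa_pi quoa_pi_zmod.
HB.instance Definition _ := GRing.isMonoidMorphism.Build B quoa quoa_pi quoa_pi_monoid.

Fact quoa_kin_central c (x : quoa) :
  (quoa_pi \o kin B) c * x = x * (quoa_pi \o kin B) c.
Proof.
rewrite -[x]piK -[quo_pi _ _]/(quoa_pi (quo_repr x)) /=.
by rewrite -[LHS]rmorphM -[RHS]rmorphM kin_central.
Qed.
Definition quoalg_of : kalgType k := KAlg quoa_kin_central.
End QuotientAlgebra.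

Section Modules.
Variable B : pzRingType.

Definition mod_iso (M N : lmodType B) : Prop :=
  exists f : {linear M -> N}, bijective f.

Definition nonzero_mod (M : lmodType B) : Prop := exists x : M, x != 0.

Definition indecomposable (M : lmodType B) : Prop :=
  nonzero_mod M /\
  forall X Y : lmodType B, mod_iso M (X * Y)%type ->
    ~ nonzero_mod X \/ ~ nonzero_mod Y.

Definition projective (X : lmodType B) : Prop :=
  forall (M N : lmodType B) (g : {linear M -> N}) (f : {linear X -> N}),
    (forall y, exists x, g x = y) ->
    exists h : {linear X -> M}, forall x, g (h x) = f x.

Definition complete_indec_projectives (I : finType) (X : I -> lmodType B) : Prop :=
  [/\ forall i, indecomposable (X i) /\ projective (X i),
      forall i j, mod_iso (X i) (X j) -> i = j
    & forall M : lmodType B, indecomposable M -> projective M ->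
        exists i, mod_iso M (X i)].

Record proj_resolution (M : lmodType B) := ProjResolution {
  res : nat -> lmodType B;
  res_d : forall n, {linear res n.+1 -> res n};
  res_aug : {linear res 0%N -> M};
  res_proj : forall n, projective (res n);
  res_aug_surj : forall y, exists x, res_aug x = y;
  res_exact0 : forall x, res_aug x = 0 <-> exists y, x = res_d 0 y;
  res_exactS : forall n x, res_d n x = 0 <-> exists y, x = res_d n.+1 y
}.

Definition cocycle (M N : lmodType B) (R : proj_resolution M) (n : nat)
  (f : {linear res R n -> N}) : Prop := forall x, f (res_d R n x) = 0.

Definition coboundary (M N : lmodType B) (R : proj_resolution M) (n : nat) :
    {linear res R n -> N} -> Prop :=
  match n with
  | 0 => fun f => forall x, f x = 0
  | m.+1 => fun f =>
      exists g : {linear res R m -> N}, forall x, f x = g (res_d R m x)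
  end.

(* Ext^n(M, N) <> 0.  The n-th cohomology of Hom(res, N) does not depend on   *)
(* the projective resolution, so it does not matter how R is quantified.      *)
Definition Ext_neq0 (n : nat) (M N : lmodType B) : Prop :=
  exists (R : proj_resolution M) (f : {linear res R n -> N}),
    cocycle f /\ ~ coboundary f.

Definition Hom_neq0 (M N : lmodType B) : Prop :=
  exists (f : {linear M -> N}) (x : M), f x <> 0.

Definition filtered_by (I : Type) (Delta : I -> lmodType B) (M : lmodType B) :=
  exists (t : nat) (F : nat -> submod M),
    [/\ smset (F 0%N) = [set 0], smset (F t) = setT
      & forall u, (u < t)%N ->
          F u `<=` F u.+1 /\ exists i, mod_iso (subquo (F u.+1) (F u)) (Delta i)].

Definition maximal_submod (M : lmodType B) (U : submod M) : Prop :=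
  smset U <> setT /\
  forall U' : submod M, U `<=` U' -> smset U' = smset U \/ smset U' = setT.

Fact rad_subproof (M : lmodType B) (R := fun x : M =>
    forall U : submod M, maximal_submod U -> U x) :
  R 0 /\ forall (a : B) x y, R x -> R y -> R (a *: x + y).
Proof.
split=> [U _|a x y Rx Ry U mU]; first exact: (smP U).1.
by apply: (smP U).2; [apply: Rx|apply: Ry].
Qed.
Definition rad (M : lmodType B) : submod M := Submod (@rad_subproof M).

Fixpoint dsum (s : seq (lmodType B)) : lmodType B :=
  if s is M :: s' then (M * dsum s')%type else {ffun void -> B^o}.

End Modules.

Section HomologicalSystems.
Variables (k : fieldType) (P : finType) (le : rel P) (L : kalgType k).
Variable Delta : P -> lmodType L.

Record homological_system : Prop := HomologicalSystem {
  hs_refl : reflexive le;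
  hs_trans : transitive le;
  hs_algebra_fdim : fdim (B := L) L^o;
  hs_fdim : forall i, fdim (Delta i);
  hs_indec : forall i, indecomposable (Delta i);
  hs_noniso : forall i j, mod_iso (Delta i) (Delta j) -> i = j;
  hs_hom : forall i j, Hom_neq0 (Delta i) (Delta j) -> le i j;
  hs_ext1 : forall i j, Ext_neq0 1 (Delta i) (Delta j) -> le i j && ~~ le j i
}.

Record admissible_system : Prop := AdmissibleSystem {
  as_system : homological_system;
  as_filtered : filtered_by Delta L^o;
  as_card : exists X : 'I_#|P| -> lmodType L, complete_indec_projectives X
}.

Record strict_system : Prop := StrictSystem {
  ss_admissible : admissible_system;
  ss_ext : forall n i j, (1 <= n)%N ->
    Ext_neq0 n (Delta i) (Delta j) -> le i j && ~~ le j i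
}.

End HomologicalSystems.

(* Extension of scalars: for a ring morphism phi : B -> C, the left C-module  *)
(* C (x)_B M is the free abelian group on C * M modulo the relations of a     *)
(* biadditive B-balanced map, C being a right B-module through phi.           *)

Section Tensor.
Variables (B C : pzRingType) (phi : {rmorphism B -> C}) (M : lmodType B).

Local Notation free := {freeg (C * M)%type / int}.
Definition fgen (x : C) (m : M) : free := << (x, m) >>.

Definition tensor_rel : set free :=
  [set z | [\/ exists x y m, z = fgen (x + y) m - fgen x m - fgen y m,
               exists x m n, z = fgen x (m + n) - fgen x m - fgen x n
             | exists x b m, z = fgen (x * phi b) m - fgen x (b *: m)]].

Definition tensor := quo_of (gen_submod tensor_rel).
HB.instance Definition _ := GRing.Zmodule.on tensor.
Local Notation pi := (quo_pi (gen_submod tensor_rel)).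

Definition tens (x : C) (m : M) : tensor := pi (fgen x m).

Definition free_act (g : C) : free -> free :=
  fglift (fun p : C * M => fgen (g * p.1) p.2).

Fact free_act_zmod g : zmod_morphism (free_act g).
Proof. exact: lift_is_additive. Qed.
HB.instance Definition _ g :=
  GRing.isZmodMorphism.Build free free (free_act g) (free_act_zmod g).

Lemma free_act_gen g x m : free_act g (fgen x m) = fgen (g * x) m.
Proof. by rewrite /free_act liftU scale1r. Qed.

Lemma free_act_rel g z : gen_submod tensor_rel z -> gen_submod tensor_rel (free_act g z).
Proof.
move=> gz.
have H : (fun z => gen_submod tensor_rel (free_act g z)) 0 /\ forall (a : int) x y,
    gen_submod tensor_rel (free_act g x) -> gen_submod tensor_rel (free_act g y) ->
    gen_submod tensor_rel (free_act g (a *: x + y)).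
  split=> [|a x y hx hy]; first by rewrite raddf0; exact: (smP _).1.
  by rewrite raddfD -[a]intz scaler_int raddfMz -scaler_int; exact: (smP _).2.
apply: (gz (Submod H)) => w hw /= U relU; apply: relU.
case: hw => [[x [y [m ->]]]|[x [m [n ->]]]|[x [b [m ->]]]];
  rewrite !raddfB /= !free_act_gen.
- by apply: Or31; exists (g * x), (g * y), m; rewrite mulrDr.
- by apply: Or32; exists (g * x), m, n.
- by apply: Or33; exists (g * x), b, m; rewrite mulrA.
Qed.

Definition tensor_scale (g : C) (z : tensor) : tensor := pi (free_act g (quo_repr z)).

Lemma tensor_scale_pi g z : tensor_scale g (pi z) = pi (free_act g z).
Proof.
apply/quo_eq; rewrite -raddfB; apply: free_act_rel; apply/quo_eq.
exact: quo_piK.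
Qed.

Lemma tensor_scaleE g x m : tensor_scale g (tens x m) = tens (g * x) m.
Proof. by rewrite tensor_scale_pi free_act_gen. Qed.

Lemma free_ext (Z : zmodType) (f g : {additive free -> Z}) :
  (forall x m, f (fgen x m) = g (fgen x m)) -> f =1 g.
Proof.
move=> fg; elim/freeg_ind_dom0 => [|c [x m] D _ _ IH]; first by rewrite !raddf0.
have -> : << c *g (x, m) >> = fgen x m *~ c :> free.
  rewrite -scaler_int intz; apply/eqP/freeg_eqP => y.
  by rewrite coeff_fgscale !coeffU mul1r.
by rewrite !raddfD /= !raddfMz fg IH.
Qed.

Lemma tensor_ind (Z : zmodType) (f g : {additive tensor -> Z}) :
  (forall x m, f (tens x m) = g (tens x m)) -> f =1 g.
Proof.
move=> fg z; rewrite -[z]quo_piK.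
have piB : zmod_morphism (quo_pi (gen_submod tensor_rel)).
  exact: (raddfB (\pi_(Quotient.quot (smpred _)))).
pose p : {additive free -> tensor} :=
  HB.pack pi (GRing.isZmodMorphism.Build free tensor pi piB).
exact: (free_ext (f := f \o p) (g := g \o p)).
Qed.

Fact tensor_scaleDr : right_distributive tensor_scale +%R.
Proof.
move=> a x y; rewrite -[x]quo_piK -[y]quo_piK.
by rewrite -quo_piD !tensor_scale_pi raddfD quo_piD.
Qed.
Fact tensor_scale_zmod g : zmod_morphism (tensor_scale g).
Proof.
move=> x y; apply: (@addIr _ (tensor_scale g y)).
by rewrite -tensor_scaleDr !subrK.
Qed.
HB.instance Definition _ g := GRing.isZmodMorphism.Build tensor tensor
  (tensor_scale g) (tensor_scale_zmod g).
Fact tensor_scaleA a b z : tensor_scale a (tensor_scale b z) = tensor_scale (a * b) z.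
Proof.
move: z; apply: (tensor_ind (f := tensor_scale a \o tensor_scale b)) => x m /=.
by rewrite !tensor_scaleE mulrA.
Qed.
Fact tensor_scale1 : left_id 1 tensor_scale.
Proof.
apply: (tensor_ind (g := idfun)) => x m /=.
by rewrite tensor_scaleE mul1r.
Qed.

Lemma tensDl x y m : tens (x + y) m = tens x m + tens y m.
Proof.
rewrite /tens -quo_piD; apply/quo_eq => U; apply; apply: Or31.
by exists x, y, m; rewrite opprD addrA.
Qed.
Lemma tensDr x m n : tens x (m + n) = tens x m + tens x n.
Proof.
rewrite /tens -quo_piD; apply/quo_eq => U; apply; apply: Or32.
by exists x, m, n; rewrite opprD addrA.
Qed.
Lemma tens_balanced x b m : tens (x * phi b) m = tens x (b *: m).
Proof. by apply/quo_eq => U; apply; apply: Or33; exists x, b, m. Qed.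

Fact tensor_scaleDl z : {morph tensor_scale^~ z : a b / a + b}.
Proof.
move=> a b; move: z.
apply: (tensor_ind (g := tensor_scale a \+ tensor_scale b)) => x m /=.
by rewrite !tensor_scaleE mulrDl tensDl.
Qed.
HB.instance Definition _ := GRing.Zmodule_isLmodule.Build C tensor
  tensor_scaleA tensor_scale1 tensor_scaleDr tensor_scaleDl.
End Tensor.

Section Bimodules.
Variables (k : fieldType) (P : finType).

(* S = (+)_i k e_i is {ffun P -> k} with pointwise operations. *)
Definition idem (i : P) : {ffun P -> k} := [ffun j => (j == i)%:R].
Definition scalarS (c : k) : {ffun P -> k} := [ffun => c].

Record sbimod := SBimod {
  sbm_car :> vectType k;
  lactS : {ffun P -> k} -> sbm_car -> sbm_car;
  ractS : sbm_car -> {ffun P -> k} -> sbm_car;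
  lactS1 : forall w, lactS 1 w = w;
  lactSM : forall a b w, lactS (a * b) w = lactS a (lactS b w);
  lactSDl : forall a b w, lactS (a + b) w = lactS a w + lactS b w;
  lactSDr : forall a v w, lactS a (v + w) = lactS a v + lactS a w;
  ractS1 : forall w, ractS w 1 = w;
  ractSM : forall w a b, ractS w (a * b) = ractS (ractS w a) b;
  ractSDr : forall w a b, ractS w (a + b) = ractS w a + ractS w b;
  ractSDl : forall v w a, ractS (v + w) a = ractS v a + ractS w a;
  lractS : forall a w b, lactS a (ractS w b) = ractS (lactS a w) b;
  lactSc : forall c w, lactS (scalarS c) w = c *: w;
  ractSc : forall c w, ractS w (scalarS c) = c *: w
}.

Definition sub_sbimod (W : sbimod) (U : {vspace W}) : Prop :=
  forall a w, w \in U -> lactS a w \in U /\ ractS w a \in U.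

(* e_j W e_i *)
Definition corner (W : sbimod) (j i : P) (w : W) : W :=
  lactS (idem j) (ractS w (idem i)).

Fact corner_linear (W : sbimod) j i : linear (@corner W j i).
Proof.
have hl a c (w : W) : lactS a (c *: w) = c *: lactS a w.
  rewrite -!lactSc -!lactSM; congr lactS.
  by apply/ffunP=> p; rewrite !ffunE mulrC.
have hr a c (w : W) : ractS (c *: w) a = c *: ractS w a.
  rewrite -!ractSc -!ractSM; congr ractS.
  by apply/ffunP=> p; rewrite !ffunE mulrC.
by move=> c v w; rewrite /corner ractSDl lactSDr hr hl.
Qed.
HB.instance Definition _ (W : sbimod) j i :=
  GRing.isLinear.Build k W W *:%R (@corner W j i) (@corner_linear W j i).

Definition peirce (W : sbimod) (j i : P) : {vspace W} := limg (linfun (@corner W j i)).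

Definition sbimod_map (W : sbimod) (R : kalgType k) (s : {ffun P -> k} -> R)
    (f : W -> R) : Prop :=
  [/\ forall c v w, f (c *: v + w) = kin R c * f v + f w,
      forall a w, f (lactS a w) = s a * f w
    & forall a w, f (ractS w a) = f w * s a].

Definition salg_map (R : kalgType k) (s : {ffun P -> k} -> R) : Prop :=
  [/\ forall c, s (scalarS c) = kin R c, s 1 = 1,
      forall a b, s (a + b) = s a + s b & forall a b, s (a * b) = s a * s b].

(* T_S(W0 (+) W1), by its universal property: an algebra map out of it is a   *)
(* map out of S together with a bimodule map out of W0 (+) W1, i.e. a pair of *)
(* bimodule maps out of W0 and W1.                                            *)
Record tensor_algebra (W0 W1 : sbimod) := TensorAlgebra {
  ta_alg :> kalgType k;
  taS : {ffun P -> k} -> ta_alg;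
  ta0 : W0 -> ta_alg;
  ta1 : W1 -> ta_alg;
  taS_hom : salg_map taS;
  ta0_map : sbimod_map taS ta0;
  ta1_map : sbimod_map taS ta1;
  ta_univ : forall (R : kalgType k) (s : {ffun P -> k} -> R)
      (f0 : W0 -> R) (f1 : W1 -> R),
    salg_map s -> sbimod_map s f0 -> sbimod_map s f1 ->
    exists! h : ta_alg -> R,
      [/\ kalg_hom h, forall a, h (taS a) = s a,
          forall w, h (ta0 w) = f0 w & forall w, h (ta1 w) = f1 w]
}.

End Bimodules.

Section Graded.
Variables (k : fieldType) (P : finType) (W0 W1 : sbimod k P).
Variable T : tensor_algebra W0 W1.

Definition subalg_of_W0 (F : {vspace W0}) : set T :=
  gen_subalgebra (range (taS T) `|` ta0 T @` [set w | w \in F]).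

Definition W1_set (F : {vspace W1}) : set T := ta1 T @` [set w | w \in F].

(* T_0 = A = T_S(W0) and T_n = A W1 A W1 ... W1 A with n factors W1.          *)
Fixpoint homog (n : nat) : set T :=
  if n is m.+1 then
    mulset (mulset (homog m) (W1_set fullv)) (subalg_of_W0 fullv)
  else subalg_of_W0 fullv.

End Graded.
Arguments subalg_of_W0 {k P W0 W1} T F.
Arguments W1_set {k P W0 W1} T F.
Arguments homog {k P W0 W1} T n.

Declare Scope mulset_scope.
Delimit Scope mulset_scope with mset.
Notation "X * Y" := (mulset X Y) : mulset_scope.
Notation "X + Y" := (addset X Y) : mulset_scope.

Section Ditalgebras.
Variables (k : fieldType) (P : finType).

(* wd_T is T, graded by homog; wd_d is the differential; the ideal wd_I of     *)
(* A = homog wd_T 0 is given as a subset of T.                                 *)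
Record weak_ditalgebra := WeakDitalgebra {
  wd_W0 : sbimod k P;
  wd_W1 : sbimod k P;
  wd_T : tensor_algebra wd_W0 wd_W1;
  wd_d : wd_T -> wd_T;
  wd_I : set wd_T;
  wd_d_linear : klinear (M := wd_T^o) (N := wd_T^o) wd_d;
  wd_d_homog : forall n x, homog wd_T n x -> homog wd_T n.+1 (wd_d x);
  wd_d_leibniz : forall n x y, homog wd_T n x ->
    wd_d (x * y) = wd_d x * y + (-1) ^+ n * (x * wd_d y);
  wd_d_S : forall a, wd_d (taS wd_T a) = 0;
  wd_I_sub : wd_I `<=` homog wd_T 0;
  wd_I_subspace : subspace (M := wd_T^o) wd_I;
  wd_I_mull : forall a x, homog wd_T 0 a -> wd_I x -> wd_I (a * x);
  wd_I_mulr : forall a x, homog wd_T 0 a -> wd_I x -> wd_I (x * a)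
}.

Section Conditions.
Variable D : weak_ditalgebra.
Local Notation T := (wd_T D).
Local Notation d := (@wd_d D).
Local Notation I := (@wd_I D).
Local Notation A := (homog T 0).
Local Notation V := (homog T 1).

Definition triangular_layer : Prop :=
  (exists (r : nat) (F : nat -> {vspace wd_W0 D}),
    [/\ F 0%N = 0%VS, F r = fullv, forall i, (i <= r)%N -> sub_sbimod (F i)
      & forall i, (i < r)%N -> (F i <= F i.+1)%VS /\
          forall w, w \in F i.+1 ->
            (subalg_of_W0 T (F i) * W1_set T fullv * subalg_of_W0 T (F i))%mset
              (d (ta0 T w))]) /\
  (exists (s : nat) (F : nat -> {vspace wd_W1 D}),
    [/\ F 0%N = 0%VS, F s = fullv, forall i, (i <= s)%N -> sub_sbimod (F i)
      & forall i, (i < s)%N -> (F i <= F i.+1)%VS /\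
          forall w, w \in F i.+1 ->
            (A * W1_set T (F i) * A * W1_set T (F i) * A)%mset (d (ta1 T w))]).

Definition interlaced : Prop :=
  [/\ forall x, I x -> (I * V + V * I)%mset (d x),
      forall x, A x -> (I * V * V + V * I * V + V * V * I)%mset (d (d x))
    & forall x, V x ->
        (I * V * V * V + V * I * V * V + V * V * I * V + V * V * V * I)%mset
          (d (d x))].

Definition I_triangular : Prop :=
  exists (t : nat) (H : nat -> set T),
    [/\ H 0%N = [set 0], H t = I,
        forall i, (i <= t)%N -> subspace (M := T^o) (H i)
      & forall i, (i < t)%N -> H i `<=` H i.+1 /\
          forall x, H i.+1 x -> (A * H i * V + V * H i * A)%mset (d x)].

End Conditions.

Record interlaced_weak_ditalgebra := InterlacedWeakDitalgebra {
  iwd :> weak_ditalgebra;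
  iwd_layer : triangular_layer iwd;
  iwd_interlaced : interlaced iwd;
  iwd_I_triangular : I_triangular iwd
}.

End Ditalgebras.

Lemma gen_subalgebraP (k : fieldType) (B : kalgType k) (X : set B) :
  subalgebra (gen_subalgebra X).
Proof.
split; first split.
- by move=> U [[]].
- by move=> c x y hx hy U UP XU; case: (UP) => -[_ UL] _ _; apply: UL; [apply: hx|apply: hy].
- by move=> U [].
- by move=> x y hx hy U UP XU; case: (UP) => _ _ UM; apply: UM; [apply: hx|apply: hy].
Qed.

Section KLinearTheory.
Variables (k : fieldType) (B : kalgType k).

Lemma kscaleA (M : lmodType B) c c' (m : M) : c *k: (c' *k: m) = (c * c') *k: m.
Proof. by rewrite /kscale scalerA rmorphM. Qed.
Lemma kscale1 (M : lmodType B) (m : M) : 1 *k: m = m.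
Proof. by rewrite /kscale rmorph1 scale1r. Qed.
Lemma kscaleDl (M : lmodType B) c c' (m : M) : (c + c') *k: m = c *k: m + c' *k: m.
Proof. by rewrite /kscale rmorphD scalerDl. Qed.
Lemma kscaleDr (M : lmodType B) c (m n : M) : c *k: (m + n) = c *k: m + c *k: n.
Proof. by rewrite /kscale scalerDr. Qed.
Lemma kscale_scale (M : lmodType B) c (b : B) (m : M) :
  c *k: (b *: m) = b *: (c *k: m).
Proof. by rewrite /kscale !scalerA kin_central. Qed.
Lemma kscaleN1 (M : lmodType B) (m : M) : (-1) *k: m = - m.
Proof. by rewrite /kscale rmorphN1 scaleN1r. Qed.

Lemma kspan_subspace (M : lmodType B) (X : set M) : subspace (kspan X).
Proof.
split=> [U [] //|c x y hx hy U UP XU].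
by case: (UP) => _; apply; [apply: hx|apply: hy].
Qed.
Lemma kspan_gen (M : lmodType B) (X : set M) : X `<=` kspan X.
Proof. by move=> x Xx U _; apply. Qed.

End KLinearTheory.

Section Klin.
Variables (k : fieldType) (B C : kalgType k) (M : lmodType B) (N : lmodType C) (f : M -> N).
Hypothesis fl : klinear f.
Lemma klinD x y : f (x + y) = f x + f y.
Proof. by have := fl 1 x y; rewrite !kscale1. Qed.
Lemma klin0 : f 0 = 0.
Proof. by apply: (@addIr _ (f 0)); rewrite -klinD !add0r. Qed.
Lemma klinZ c x : f (c *k: x) = c *k: f x.
Proof. by have := fl c x 0; rewrite klin0 !addr0. Qed.
Lemma klinN x : f (- x) = - f x.
Proof. by rewrite -!kscaleN1 klinZ. Qed.
Lemma klin_sum (J : Type) (s : seq J) (F : J -> M) :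
  f (\sum_(j <- s) F j) = \sum_(j <- s) f (F j).
Proof. by elim/big_rec2: _ => [|j x y _ <-]; rewrite ?klin0 ?klinD. Qed.
End Klin.

Section Kend.
Variables (k : fieldType) (B : kalgType k) (M : lmodType B).

Record kend := Kend { kend_fun : M -> M; kend_lin : klinear kend_fun }.
HB.instance Definition _ := gen_eqMixin kend.
HB.instance Definition _ := gen_choiceMixin kend.

Lemma kend_ext (f g : kend) : kend_fun f =1 kend_fun g -> f = g.
Proof.
case: f g => [f hf] [g hg] /= /funext e; case: _ / e in hg *.
by congr Kend; exact: Prop_irrelevance.
Qed.

Fact kend_add_lin (f g : kend) : klinear (fun x => kend_fun f x + kend_fun g x).
Proof. by move=> c x y; rewrite !kend_lin kscaleDr addrACA. Qed.
Definition kend_add f g := Kend (kend_add_lin f g).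
Fact kend_opp_lin (f : kend) : klinear (fun x => - kend_fun f x).
Proof. by move=> c x y; rewrite !kend_lin opprD /kscale scalerN. Qed.
Definition kend_opp f := Kend (kend_opp_lin f).
Fact kend_zero_lin : klinear (fun x : M => (0 : M)).
Proof. by move=> c x y; rewrite /kscale scaler0 addr0. Qed.
Definition kend_zero := Kend kend_zero_lin.
Fact kend_one_lin : klinear (fun x : M => x).
Proof. by []. Qed.
Definition kend_one := Kend kend_one_lin.
Fact kend_mul_lin (f g : kend) : klinear (fun x => kend_fun f (kend_fun g x)).
Proof. by move=> c x y; rewrite !kend_lin. Qed.
Definition kend_mul f g := Kend (kend_mul_lin f g).

Fact kend_addA : associative kend_add.
Proof. by move=> f g h; apply: kend_ext => x /=; rewrite addrA. Qed.
Fact kend_addC : commutative kend_add.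
Proof. by move=> f g; apply: kend_ext => x /=; rewrite addrC. Qed.
Fact kend_add0 : left_id kend_zero kend_add.
Proof. by move=> f; apply: kend_ext => x /=; rewrite add0r. Qed.
Fact kend_addN : left_inverse kend_zero kend_opp kend_add.
Proof. by move=> f; apply: kend_ext => x /=; rewrite addNr. Qed.
HB.instance Definition _ := GRing.isZmodule.Build kend
  kend_addA kend_addC kend_add0 kend_addN.
Fact kend_mulA : associative kend_mul.
Proof. by move=> f g h; apply: kend_ext. Qed.
Fact kend_mul1l : left_id kend_one kend_mul.
Proof. by move=> f; apply: kend_ext. Qed.
Fact kend_mul1r : right_id kend_one kend_mul.
Proof. by move=> f; apply: kend_ext. Qed.
Fact kend_mulDl : left_distributive kend_mul kend_add.
Proof. by move=> f g h; apply: kend_ext. Qed.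
Fact kend_mulDr : right_distributive kend_mul kend_add.
Proof. by move=> f g h; apply: kend_ext => x /=; rewrite klinD //; exact: kend_lin. Qed.
HB.instance Definition _ := GRing.Zmodule_isPzRing.Build kend
  kend_mulA kend_mul1l kend_mul1r kend_mulDl kend_mulDr.

Fact kend_kin_lin c : klinear (fun x : M => c *k: x).
Proof. by move=> c' x y; rewrite kscaleDr !kscaleA mulrC. Qed.
Definition kend_kin c : kend := Kend (kend_kin_lin c).
Fact kend_kin_zmod : zmod_morphism kend_kin.
Proof. by move=> c c'; apply: kend_ext => x /=; rewrite /kscale rmorphB scalerBl. Qed.
Fact kend_kin_monoid : monoid_morphism kend_kin.
Proof.
by split=> [|c c']; apply: kend_ext => x /=; rewrite ?kscale1 ?kscaleA.
Qed.
HB.instance Definition _ := GRing.isZmodMorphism.Build k kend kend_kin kend_kin_zmod.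
HB.instance Definition _ := GRing.isMonoidMorphism.Build k kend kend_kin kend_kin_monoid.
Fact kend_kin_central c (f : kend) : kend_kin c * f = f * kend_kin c.
Proof. by apply: kend_ext => x /=; rewrite klinZ //; exact: kend_lin. Qed.
Definition kend_alg : kalgType k := KAlg kend_kin_central.
End Kend.

Section RightAlgebra.
Variables (k : fieldType) (P : finType) (D : interlaced_weak_ditalgebra k P).
Local Notation T := (wd_T D).
Local Notation d := (@wd_d k P D).
Local Notation I := (@wd_I k P D).

Definition A_sub : ksubalg T :=
  KSubalg (gen_subalgebraP _ : subalgebra (homog T 0)).
Definition Aalg : kalgType k := subalg_of A_sub.
Definition Vspace : Type := {v : T | homog T 1 v}.

Definition aS (s : {ffun P -> k}) : Aalg.
Proof.
exists (taS T s); apply/asboolP => U _; apply; left; by exists s.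
Defined.

Fact I_submod_subproof : I (val (0 : Aalg)) /\
  forall a x y : Aalg, I (val x) -> I (val y) -> I (val (a * x + y)).
Proof.
split=> [|a x y Ix Iy]; first exact: (wd_I_subspace D).1.
have := (wd_I_subspace D).2 1 (val a * val x) (val y).
rewrite /kscale rmorph1 scale1r; apply=> //; apply: wd_I_mull => //.
exact/asboolP/(valP a).
Qed.

Fact I_mulr (x y : Aalg) : I (val x) -> I (val (x * y)).
Proof. by move=> Ix; apply: wd_I_mulr => //; exact/asboolP/(valP y). Qed.

Definition I_ideal : ideal Aalg :=
  @Ideal Aalg (@Submod Aalg Aalg^o (fun x : Aalg => I (val x)) I_submod_subproof)
    I_mulr.

Definition Abar : kalgType k := quoalg_of I_ideal.
Definition piA : {rmorphism Aalg -> Abar} := quoa_pi I_ideal.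

(* A-modules killed by I are modules over Abar = A/I, on which a in A acts as  *)
(* piA a.  A morphism f : M -> N is the pair (f^0, f^1) = (mor0 f, mor1 f).    *)
Record mor (M N : lmodType Abar) := Mor {
  mor0 : M -> N;
  mor1 : Vspace -> M -> N;
  mor0_lin : klinear mor0;
  mor1_lin : forall v, klinear (mor1 v);
  mor1_linV : forall c (u v w : Vspace) m,
    sval w = kin T c * sval u + sval v ->
    mor1 w m = c *k: mor1 u m + mor1 v m;
  mor1_bimod : forall (a b : Aalg) (v w : Vspace) m,
    sval w = val a * sval v * val b ->
    mor1 w m = piA a *: mor1 v (piA b *: m);
  mor_compat : forall (a : Aalg) (v : Vspace) m,
    sval v = d (val a) -> piA a *: mor0 m = mor0 (piA a *: m) + mor1 v m
}.

Lemma mor_ext M N (f g : mor M N) :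
  (forall m, mor0 f m = mor0 g m) -> (forall v m, mor1 f v m = mor1 g v m) -> f = g.
Proof.
case: f g => [f0 f1 a b c x y] [g0 g1 a' b' c' x' y'] /= /funext e0 e1.
have {}e1 : f1 = g1 by apply/funext => v; exact/funext.
case: _ / e0 in a' x' y' *; case: _ / e1 in b' c' x' y' *.
by congr Mor; exact: Prop_irrelevance.
Qed.

Lemma kT c (x : T) : c *k: (x : T^o) = kin T c * x. Proof. by []. Qed.

Lemma homog0M (x y : T) : homog T 0 x -> homog T 0 y -> homog T 0 (x * y).
Proof.
by have [_ _] := gen_subalgebraP (B := T)
  (range (taS T) `|` ta0 T @` [set w | w \in fullv]); apply.
Qed.
Lemma homog01 : homog T 0 1.
Proof. by move=> U []. Qed.

Lemma homogS_mulr n (x y : T) : homog T n.+1 x -> homog T 0 y -> homog T n.+1 (x * y).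
Proof.
move=> hx hy; have [S0 SL] : subspace (M := T^o) (homog T n.+1) by exact: kspan_subspace.
apply: (hx (fun z : T^o => homog T n.+1 ((z : T) * y))).
  split=> [|c u v hu hv]; first by rewrite mul0r; exact: S0.
  by rewrite kT mulrDl -mulrA; exact: SL.
move=> z [a [b [ha hb ->]]]; rewrite -mulrA; apply: kspan_gen.
by exists a, (b * y); split=> //; exact: homog0M.
Qed.

Lemma homogS_gen n (x : T) w : homog T n x -> homog T n.+1 (x * ta1 T w).
Proof.
move=> hx; rewrite -[x * _]mulr1; apply: kspan_gen.
exists (x * ta1 T w), 1; split=> //; last exact: homog01.
by apply: kspan_gen; exists x, (ta1 T w); split=> //; exists w => //=; rewrite memvf.
Qed.

Lemma homogS_ind n (U : set T) :
  subspace (M := T^o) U ->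
  (forall x w y, homog T n x -> homog T 0 y -> U (x * ta1 T w * y)) ->
  homog T n.+1 `<=` U.
Proof.
move=> [U0 UL] HU t ht; apply: (ht U) => // z [x [y [hx hy ->]]].
apply: (hx (fun x : T^o => U ((x : T) * y))).
  split=> [|c u v hu hv]; first by rewrite mul0r.
  by rewrite kT mulrDl -mulrA; exact: UL.
move=> z' [a [_ [ha [w _ <-]]]] ->; exact: HU.
Qed.

Lemma homog1_mull (a x : T) : homog T 0 a -> homog T 1 x -> homog T 1 (a * x).
Proof.
move=> ha; move: x; have [S0 SL] : subspace (M := T^o) (homog T 1) by exact: kspan_subspace.
apply: homogS_ind.
  split=> [|c u v hu hv]; first by rewrite mulr0.
  by rewrite kT mulrDr mulrA -kin_central -mulrA; exact: SL.
move=> x w y hx hy; rewrite !mulrA; apply: homogS_mulr => //.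
by apply: homogS_gen; exact: homog0M.
Qed.

Definition decomp (v : Vspace) (s : seq (Vspace * Vspace)) : Prop :=
  d (sval v) = \sum_(p <- s) sval p.1 * sval p.2.

Lemma decomp_ex (v : Vspace) : exists s, decomp v s.
Proof.
apply: (@homogS_ind 1 [set t | exists s : seq (Vspace * Vspace),
   t = \sum_(p <- s) sval p.1 * sval p.2]); last by apply: wd_d_homog; exact: (svalP v).
  split=> [|c _ _ [s ->] [s' ->]]; first by exists [::]; rewrite big_nil.
  have hc (u : Vspace) : homog T 1 (kin T c * sval u).
    have := (kspan_subspace (B := T) (M := T^o) _).2 c _ 0 (svalP u).
    by rewrite addr0; apply; exact: (kspan_subspace (B := T) (M := T^o) _).1.
  exists ([seq (exist _ _ (hc p.1), p.2) | p <- s] ++ s').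
  rewrite big_cat big_map kT mulr_sumr /=; congr (_ + _).
  by apply: eq_bigr => p _; rewrite mulrA.
move=> x w y hx hy.
have hwy : homog T 1 (ta1 T w * y).
  rewrite -[ta1 T w]mul1r; apply: homogS_mulr => //; apply: homogS_gen; exact: homog01.
by exists [:: (exist _ _ hx, exist _ _ hwy)]; rewrite big_seq1 /= mulrA.
Qed.

Definition dseq (v : Vspace) : seq (Vspace * Vspace) := projT1 (cid (decomp_ex v)).
Lemma dseqP v : decomp v (dseq v).
Proof. exact: projT2 (cid (decomp_ex v)). Qed.

(* T acts on an A/I-module Y through any bimodule map V -> End_k(Y); this     *)
(* makes composition in A-mod independent of the decomposition of d v.        *)
Section Action.
Variables (Y : lmodType Abar) (F : Vspace -> Y -> Y).
Hypothesis F_lin : forall v, klinear (F v).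
Hypothesis F_linV : forall c (u v w : Vspace) m,
  sval w = kin T c * sval u + sval v -> F w m = c *k: F u m + F v m.
Hypothesis F_bimod : forall (a b : Aalg) (v w : Vspace) m,
  sval w = val a * sval v * val b -> F w m = piA a *: F v (piA b *: m).

Lemma piA_aS_hom : salg_map (fun s => piA (aS s)).
Proof.
have [h1 h2 h3 h4] := taS_hom T.
have e (s : {ffun P -> k}) (a : Aalg) : taS T s = val a -> aS s = a by move=> h; exact: val_inj.
split=> [c||a b|a b].
- rewrite (e _ (suba_kin A_sub c)) //.
- by rewrite (e _ 1) //; exact: rmorph1.
- by rewrite (e _ (aS a + aS b)) ?h3 // rmorphD.
- by rewrite (e _ (aS a * aS b)) ?h4 // rmorphM.
Qed.

Fact act_lin (b : Abar) : klinear (fun y : Y => b *: y).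
Proof. by move=> c x y; rewrite scalerDr kscale_scale. Qed.

Lemma homog_ta0 w : homog T 0 (ta0 T w).
Proof. by move=> U _; apply; right; exists w => //=; rewrite memvf. Qed.
Definition a0 (w : wd_W0 D) : Aalg := exist _ (ta0 T w) (introT (asboolP _) (homog_ta0 w)).
Lemma homog_ta1 w : homog T 1 (ta1 T w).
Proof. rewrite -[ta1 T w]mul1r; apply: homogS_gen; exact: homog01. Qed.
Definition v1 (w : wd_W1 D) : Vspace := exist _ (ta1 T w) (homog_ta1 w).

Lemma T_action : exists rho : T -> kend Y,
  [/\ kalg_hom (B := T) (C := kend_alg Y) rho,
      forall (a : Aalg) y, kend_fun (rho (val a)) y = piA a *: y
    & forall v y, kend_fun (rho (sval v)) y = F v y].
Proof.
pose act (a : Aalg) : kend_alg Y := Kend (act_lin (piA a)).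
pose s (x : {ffun P -> k}) := act (aS x).
pose f0 (w : wd_W0 D) := act (a0 w).
pose f1 (w : wd_W1 D) : kend_alg Y := Kend (F_lin (v1 w)).
have [sc s1 sD sM] := piA_aS_hom.
have actD a b : act (a + b) = act a + act b.
  by apply: kend_ext => y /=; rewrite rmorphD scalerDl.
have actM a b : act (a * b) = act a * act b.
  by apply: kend_ext => y /=; rewrite rmorphM scalerA.
have act1 : act 1 = 1.
  by apply: kend_ext => y /=; rewrite rmorph1 scale1r.
have actk c : act (kin Aalg c) = kin (kend_alg Y) c by exact: kend_ext.
have hs : salg_map s.
  split=> [c||a b|a b]; apply: kend_ext => y /=.
  - by rewrite sc.
  - by rewrite s1 scale1r.
  - by rewrite sD scalerDl.
  - by rewrite sM scalerA.
have [m01 m02 m03] := ta0_map T.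
have h0 : sbimod_map s f0.
  split=> [c v w|a w|a w]; rewrite /f0 /s -?actk -?actM -?actD;
    by congr act; apply: val_inj; rewrite /= ?m01 ?m02 ?m03.
have [m11 m12 m13] := ta1_map T.
have h1 : sbimod_map s f1.
  split=> [c v w|a w|a w]; apply: kend_ext => y /=.
  - by apply: F_linV => /=; rewrite m11.
  - rewrite (@F_bimod (aS a) 1 (v1 w)) ?rmorph1 ?scale1r //=.
    by rewrite m12 mulr1.
  - rewrite (@F_bimod 1 (aS a) (v1 w)) ?rmorph1 ?scale1r //=.
    by rewrite m13 mul1r.
have [rho [[rho_hom rhoS rho0 rho1] _]] := ta_univ T hs h0 h1.
have [rhol rho_1 rhoM] := rho_hom.
have rhoA (a : Aalg) : rho (val a) = act a.
  have: homog T 0 (val a) by exact/asboolP/(valP a).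
  move=> ha; have [a' [aa' ->]] : exists a' : Aalg, val a' = val a /\ rho (val a) = act a'.
    apply: (ha (fun t => exists a' : Aalg, val a' = t /\ rho t = act a')).
      split; first split.
      - by exists 0; split=> //; rewrite (klin0 rhol); apply: kend_ext => y /=;
          rewrite rmorph0 scale0r.
      - move=> c _ _ [x [<- ex]] [y [<- ey]]; exists (kin Aalg c * x + y); split=> //.
        by rewrite rhol ex ey actD actM actk.
      - by exists 1; rewrite act1 rho_1; split.
      - by move=> _ _ [x [<- ex]] [y [<- ey]]; exists (x * y); rewrite rhoM ex ey actM.
    move=> _ [[x _ <-]|[w _ <-]].
      by exists (aS x); rewrite rhoS.
    by exists (a0 w); rewrite rho0.
  by congr act; exact: val_inj.
have rhoV (v : Vspace) : rho (sval v) = Kend (F_lin v).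
  have [v' [vv' ->]] : exists v' : Vspace, sval v' = sval v /\ rho (sval v) = Kend (F_lin v').
    apply: (@homogS_ind 0 (fun t => exists v' : Vspace, sval v' = t /\ rho t = Kend (F_lin v'))); last exact: svalP.
      have [S0 SL] : subspace (M := T^o) (homog T 1) by exact: kspan_subspace.
      split.
        exists (exist _ 0 S0); split=> //; rewrite (klin0 rhol); apply: kend_ext => y /=.
        rewrite (@F_linV (-1) (exist _ 0 S0) (exist _ 0 S0)) /= ?mulr0 ?addr0 //.
        by rewrite kscaleN1 addNr.
      move=> c _ _ [x [<- ex]] [y [<- ey]]; exists (exist _ _ (SL c _ _ (svalP x) (svalP y))).
      split=> //; rewrite rhol ex ey; apply: kend_ext => z /=.
      by rewrite -(F_linV (w := exist _ _ (SL c _ _ (svalP x) (svalP y)))).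
    move=> x w y hx hy.
    have hv : homog T 1 (x * ta1 T w * y) by apply: homogS_mulr => //; exact: homogS_gen.
    pose x' : Aalg := exist _ x (introT (asboolP _) hx).
    pose y' : Aalg := exist _ y (introT (asboolP _) hy).
    exists (exist _ _ hv); split=> //.
    rewrite !rhoM rho1 (rhoA x') (rhoA y'); apply: kend_ext => z /=.
    by rewrite -(F_bimod (w := exist _ _ hv)).
  apply: kend_ext => y /=.
  rewrite (@F_bimod 1 1 v v') ?rmorph1 ?scale1r //.
  by rewrite mul1r mulr1.
by exists rho; split=> // [a|v] y; rewrite ?rhoA ?rhoV.
Qed.

End Action.

Lemma val_mulset (X Y : set T) (Q : T -> Prop) :
  subspace (M := T^o) Q -> (forall x y, X x -> Y y -> Q (x * y)) ->
  forall t, mulset X Y t -> Q t.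
Proof. by move=> HQ H t; apply=> // z [x [y [Xx Yy ->]]]; exact: H. Qed.

Section Kill.
Variables (Y : lmodType Abar) (rho : T -> kend Y).
Hypothesis rho_hom : kalg_hom (B := T) (C := kend_alg Y) rho.
Hypothesis rhoA : forall (a : Aalg) y, kend_fun (rho (val a)) y = piA a *: y.

Lemma rho0_subspace : subspace (M := T^o) [set t | rho t = 0].
Proof.
have [rl _ _] := rho_hom.
split=> [|c x y hx hy]; first exact: (klin0 rl).
by rewrite /= rl hx hy addr0 /kscale [_ *: _]mulr0.
Qed.
Lemma rho0_I x : I x -> rho x = 0.
Proof.
move=> Ix; apply: kend_ext => y /=.
pose x' : Aalg := exist _ x (introT (asboolP _) (wd_I_sub Ix)).
rewrite (rhoA x'); suff -> : piA x' = 0 by rewrite scale0r.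
rewrite -(rmorph0 piA); apply/quo_eq; by rewrite subr0.
Qed.
Lemma rho0_mull (X Z : set T) : (forall x, X x -> rho x = 0) ->
  forall t, mulset X Z t -> rho t = 0.
Proof.
move=> hX; apply: val_mulset rho0_subspace _ => x z /hX hx _ /=.
by have [_ _ ->] := rho_hom; rewrite hx mul0r.
Qed.
Lemma rho0_mulr (X Z : set T) : (forall z, Z z -> rho z = 0) ->
  forall t, mulset X Z t -> rho t = 0.
Proof.
move=> hZ; apply: val_mulset rho0_subspace _ => x z _ /hZ hz /=.
by have [_ _ ->] := rho_hom; rewrite hz mulr0.
Qed.
Lemma rho0_add (X Z : set T) : (forall x, X x -> rho x = 0) ->
  (forall z, Z z -> rho z = 0) -> forall t, addset X Z t -> rho t = 0.
Proof.
move=> hX hZ _ [x [z [/hX hx /hZ hz ->]]].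
by have [rl _ _] := rho_hom; rewrite (klinD rl) hx hz addr0.
Qed.
Lemma rho_ddA a : homog T 0 a -> rho (d (d a)) = 0.
Proof.
have [_ h _] := iwd_interlaced D; move=> /h; move: (d _).
apply: rho0_add; [apply: rho0_add|].
- by apply: rho0_mull; apply: rho0_mull; exact: rho0_I.
- by apply: rho0_mull; apply: rho0_mulr; exact: rho0_I.
- by apply: rho0_mulr; exact: rho0_I.
Qed.
Lemma rho_ddV v : homog T 1 v -> rho (d (d v)) = 0.
Proof.
have [_ _ h] := iwd_interlaced D; move=> /h; move: (d _).
apply: rho0_add; [apply: rho0_add; [apply: rho0_add|]|].
- by do 3 (apply: rho0_mull); exact: rho0_I.
- by do 2 (apply: rho0_mull); apply: rho0_mulr; exact: rho0_I.
- by apply: rho0_mull; apply: rho0_mulr; exact: rho0_I.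
- by apply: rho0_mulr; exact: rho0_I.
Qed.
End Kill.

Section MorTheory.
Variables (M N : lmodType Abar) (f : mor M N).
Lemma mor0D x y : mor0 f (x + y) = mor0 f x + mor0 f y.
Proof. exact: klinD (mor0_lin f) _ _. Qed.
Lemma mor00 : mor0 f 0 = 0.
Proof. exact: klin0 (mor0_lin f). Qed.
Lemma mor0_sum J (s : seq J) F : mor0 f (\sum_(j <- s) F j) = \sum_(j <- s) mor0 f (F j).
Proof. by rewrite (klin_sum (mor0_lin f)). Qed.
Lemma mor1D v x y : mor1 f v (x + y) = mor1 f v x + mor1 f v y.
Proof. exact: klinD (mor1_lin f v) _ _. Qed.
Lemma mor10 v : mor1 f v 0 = 0.
Proof. exact: klin0 (mor1_lin f v). Qed.
Lemma mor1_sum v J (s : seq J) F :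
  mor1 f v (\sum_(j <- s) F j) = \sum_(j <- s) mor1 f v (F j).
Proof. by rewrite (klin_sum (mor1_lin f v)). Qed.
End MorTheory.

Lemma kscale_pair (M N : lmodType Abar) c (x : M * N) :
  c *k: x = (c *k: x.1, c *k: x.2).
Proof. by []. Qed.

(* For composable f and g, the bilinear expression g^1(u) f^1(v) is induced   *)
(* by a map beta on T, u v |-> g^1(u) f^1(v).                                 *)
Lemma pairing (M N L : lmodType Abar) (g : mor N L) (f : mor M N) :
  exists beta : T -> M -> L,
    [/\ [/\ forall x y m, beta (x + y) m = beta x m + beta y m,
        forall c x m, beta (kin T c * x) m = c *k: beta x m
        & forall x m n, beta x (m + n) = beta x m + beta x n],
        forall x c m, beta x (c *k: m) = c *k: beta x m,
        forall u v m, beta (sval u * sval v) m = mor1 g u (mor1 f v m),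
        forall (a b : Aalg) x m, beta (val a * x * val b) m = piA a *: beta x (piA b *: m)
      & forall a m, homog T 0 a -> beta (d (d a)) m = 0].
Proof.
pose Y : lmodType Abar := (M * N * L)%type.
pose F (v : Vspace) (y : Y) : Y := (0, mor1 f v y.1.1, mor1 g v y.1.2).
have F_lin v : klinear (F v).
  move=> c x y; rewrite /F !kscale_pair /= !mor1_lin.
  by congr (_, _, _); rewrite /kscale scaler0 addr0.
have F_linV c (u v w : Vspace) m :
    sval w = kin T c * sval u + sval v -> F w m = c *k: F u m + F v m.
  move=> e; rewrite /F !kscale_pair /= !(mor1_linV _ _ e).
  by congr (_, _, _); rewrite /kscale scaler0 addr0.
have F_bimod (a b : Aalg) (v w : Vspace) m :
    sval w = val a * sval v * val b -> F w m = piA a *: F v (piA b *: m).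
  move=> e; rewrite /F !(mor1_bimod _ _ e) /=.
  by congr (_, _, _); rewrite /= scaler0.
have [rho [rho_hom rhoA rhoV]] := T_action F_lin F_linV F_bimod.
have [rl r1 rM] := rho_hom.
exists (fun t m => (kend_fun (rho t) (m, 0, 0)).2); split; first split.
- by move=> x y m; rewrite (klinD rl).
- by move=> c x m; rewrite -[_ * x]/(c *k: (x : T^o)) (klinZ rl).
- move=> x m n; rewrite (_ : (m + n, 0, 0) = (m, 0, 0) + (n, 0, 0) :> Y).
    by rewrite (klinD (kend_lin _)).
  by congr (_, _, _); rewrite /= addr0.
- move=> x c m; rewrite (_ : (c *k: m, 0, 0) = c *k: ((m, 0, 0) : Y)).
    by rewrite (klinZ (kend_lin _)).
  by rewrite kscale_pair /= /kscale; congr (_, _, _); rewrite scaler0.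
- by move=> u v m; rewrite rM /= !rhoV.
- move=> a b x m; rewrite !rM /= !rhoA.
  have -> : piA b *: ((m, 0, 0) : Y) = (piA b *: m, 0, 0); last by [].
  by congr (_, _, _); rewrite /= scaler0.
- by move=> a m ha; rewrite (rho_ddA rho_hom rhoA ha).
Qed.

Definition comp0 (M N L : lmodType Abar) (g : mor N L) (f : mor M N) (m : M) : L :=
  mor0 g (mor0 f m).
Definition comp1 (M N L : lmodType Abar) (g : mor N L) (f : mor M N)
    (v : Vspace) (m : M) : L :=
  mor0 g (mor1 f v m) + mor1 g v (mor0 f m) +
  \sum_(p <- dseq v) mor1 g p.1 (mor1 f p.2 m).

(* (gf)^1(v) does not depend on the chosen decomposition [dseq v] of d v.     *)
Lemma comp1E (M N L : lmodType Abar) (g : mor N L) (f : mor M N) v s m :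
  decomp v s ->
  comp1 g f v m = mor0 g (mor1 f v m) + mor1 g v (mor0 f m) +
                  \sum_(p <- s) mor1 g p.1 (mor1 f p.2 m).
Proof.
move=> es; congr (_ + _).
have [beta [[bD _ _] _ bV _ _]] := pairing g f.
have b0 x : beta 0 x = 0 by apply: (@addIr _ (beta 0 x)); rewrite -bD !add0r.
have bs s' : beta (\sum_(p <- s') sval p.1 * sval p.2) m =
    \sum_(p <- s') mor1 g p.1 (mor1 f p.2 m).
  by elim/big_rec2: _ => [|p x y _ <-]; rewrite ?b0 // bD bV.
by rewrite -!bs -es -dseqP.
Qed.

Section Comp.
Variables (M N L : lmodType Abar) (g : mor N L) (f : mor M N).

Lemma comp1_beta : exists2 beta : T -> M -> L,
    [/\ [/\ forall x y m, beta (x + y) m = beta x m + beta y m,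
        forall c x m, beta (kin T c * x) m = c *k: beta x m
        & forall x m n, beta x (m + n) = beta x m + beta x n],
        forall x c m, beta x (c *k: m) = c *k: beta x m,
        forall u v m, beta (sval u * sval v) m = mor1 g u (mor1 f v m),
        forall (a b : Aalg) x m, beta (val a * x * val b) m = piA a *: beta x (piA b *: m)
      & forall a m, homog T 0 a -> beta (d (d a)) m = 0]
  & forall v m, comp1 g f v m =
     mor0 g (mor1 f v m) + mor1 g v (mor0 f m) + beta (d (sval v)) m.
Proof.
have [beta hb] := pairing g f; exists beta => // v m.
have [[bD _ _] _ bV _ _] := hb; congr (_ + _).
have b0 x : beta 0 x = 0 by apply: (@addIr _ (beta 0 x)); rewrite -bD !add0r.
rewrite dseqP.
have bs s' : beta (\sum_(p <- s') sval p.1 * sval p.2) m =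
    \sum_(p <- s') mor1 g p.1 (mor1 f p.2 m).
  by elim/big_rec2: _ => [|p x y _ <-]; rewrite ?b0 // bD bV.
by rewrite bs.
Qed.

Fact comp0_lin : klinear (comp0 g f).
Proof. by move=> c x y; rewrite /comp0 !mor0_lin. Qed.

Fact comp1_lin v : klinear (comp1 g f v).
Proof.
have [beta [[_ _ bD] bZ _ _ _] e] := comp1_beta.
move=> c x y; rewrite !e !mor1_lin !mor0_lin !mor1_lin bD bZ.
by rewrite !kscaleDr [RHS]addrACA; congr (_ + _); rewrite addrACA.
Qed.

Fact comp1_linV c (u v w : Vspace) m :
  sval w = kin T c * sval u + sval v ->
  comp1 g f w m = c *k: comp1 g f u m + comp1 g f v m.
Proof.
have [beta [[bD bZ _] _ _ _ _] e] := comp1_beta.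
move=> ew; rewrite !e !(mor1_linV _ _ ew) mor0_lin ew.
rewrite -[kin T c * _]/(c *k: (sval u : T^o)) wd_d_linear bD bZ.
by rewrite !kscaleDr [RHS]addrACA; congr (_ + _); rewrite addrACA.
Qed.

Lemma dA_V (a : Aalg) : homog T 1 (d (val a)).
Proof. by apply: wd_d_homog; exact/asboolP/(valP a). Qed.
Definition dA (a : Aalg) : Vspace := exist _ _ (dA_V a).

Fact comp1_bimod (a b : Aalg) (u w : Vspace) m :
  sval w = val a * sval u * val b ->
  comp1 g f w m = piA a *: comp1 g f u (piA b *: m).
Proof.
have [beta [[bD bZ _] _ bV bM _] e] := comp1_beta.
move=> ew; rewrite !e !(mor1_bimod _ _ ew) ew.
have hA (c : Aalg) : homog T 0 (val c) by exact/asboolP/(valP c).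
rewrite -mulrA (wd_d_leibniz _ (hA a)) (wd_d_leibniz _ (svalP u)) expr0 mul1r expr1.
have hub : homog T 1 (sval u * val b) by apply: homogS_mulr => //; exact: svalP.
have hau : homog T 1 (val a * sval u) by apply: homog1_mull => //; exact: svalP.
have -> : d (val a) * (sval u * val b) +
    val a * (d (sval u) * val b + -1 * (sval u * d (val b))) =
    sval (dA a) * sval (exist _ _ hub) + (val a * d (sval u) * val b +
      kin T (-1) * (sval (exist _ _ hau) * sval (dA b))).
  by rewrite /= rmorphN1 !mulN1r mulrDr mulrN !mulrA.
rewrite !bD bZ !bV bM kscaleN1.
rewrite (@mor1_bimod _ _ f 1 b u (exist _ _ hub)) ?mul1r // rmorph1 scale1r.
rewrite (@mor1_bimod _ _ g a 1 u (exist _ _ hau)) ?mulr1 // rmorph1 scale1r.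
set x := mor1 f u _.
have -> n : mor1 g (dA a) n = piA a *: mor0 g n - mor0 g (piA a *: n).
  by rewrite (@mor_compat _ _ g a (dA a)) // addrC addKr.
have -> n : mor1 f (dA b) n = piA b *: mor0 f n - mor0 f (piA b *: n).
  by rewrite (@mor_compat _ _ f b (dA b)) // addrC addKr.
rewrite mor1D (klinN (mor1_lin _ _)) !scalerDr !scalerN opprD opprK.
set p := mor0 g (_ *: _); set q := _ *: mor1 g u (piA b *: _).
set r := _ *: mor0 g x; set t := _ *: beta _ _; set z := _ *: mor1 g u _.
clearbody p q r t z.
rewrite [p + q]addrC -!addrA [r + (- p + _)]addrCA addNKr.
rewrite [t + (- q + _)]addrCA [r + (- q + _)]addrCA addNKr.
by rewrite [t + z]addrC.
Qed.

Fact comp_compat (a : Aalg) (v : Vspace) m :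
  sval v = d (val a) ->
  piA a *: comp0 g f m = comp0 g f (piA a *: m) + comp1 g f v m.
Proof.
have [beta [[bD bZ _] _ bV bM bdd] e] := comp1_beta.
move=> ev; rewrite e ev bdd ?addr0; last exact/asboolP/(valP a).
rewrite /comp0 (@mor_compat _ _ g a v _ ev) addrA; congr (_ + _).
by rewrite (@mor_compat _ _ f a v _ ev) mor0D.
Qed.

Definition comp : mor M L :=
  Mor comp0_lin comp1_lin comp1_linV comp1_bimod comp_compat.
End Comp.

Section Identity.
Variable M : lmodType Abar.
Fact id_lin : klinear (fun m : M => m). Proof. by []. Qed.
Fact zero_lin (N : lmodType Abar) : klinear (fun m : M => (0 : N)).
Proof. by move=> c x y; rewrite /kscale scaler0 addr0. Qed.
Fact zero_linV (N : lmodType Abar) c (u v w : Vspace) (m : M) :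
  sval w = kin T c * sval u + sval v -> 0 = c *k: (0 : N) + 0.
Proof. by rewrite /kscale scaler0 addr0. Qed.
Fact zero_bimod (N : lmodType Abar) (a b : Aalg) (v w : Vspace) (m : M) :
  sval w = val a * sval v * val b -> 0 = piA a *: (0 : N).
Proof. by rewrite scaler0. Qed.

(* (f, 0), for an A/I-linear map f *)
Fact strict_compat (N : lmodType Abar) (f : {linear M -> N}) (a : Aalg)
  (v : Vspace) (m : M) : sval v = d (val a) -> piA a *: f m = f (piA a *: m) + 0.
Proof. by rewrite linearZ addr0. Qed.
Fact strict_lin (N : lmodType Abar) (f : {linear M -> N}) : klinear f.
Proof. by move=> c x y; rewrite /kscale linearP. Qed.
Definition strict_mor (N : lmodType Abar) (f : {linear M -> N}) : mor M N :=
  @Mor M N f (fun _ _ => 0) (strict_lin f) (fun _ => zero_lin N)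
    (@zero_linV N) (@zero_bimod N) (@strict_compat N f).

Definition id_mor : mor M M := strict_mor (idfun : {linear M -> M}).
End Identity.

Lemma comp_idl (M N : lmodType Abar) (f : mor M N) : comp (id_mor N) f = f.
Proof.
apply: mor_ext => [m|v m] //=.
by rewrite /comp1 /= addr0 big1 ?addr0.
Qed.
Lemma comp_idr (M N : lmodType Abar) (f : mor M N) : comp f (id_mor M) = f.
Proof.
apply: mor_ext => [m|v m] //=.
by rewrite /comp1 /= mor00 add0r big1 ?addr0 // => p _; rewrite mor10.
Qed.

Lemma comp_assoc (M N L K : lmodType Abar) (h : mor L K) (g : mor N L) (f : mor M N) :
  comp (comp h g) f = comp h (comp g f).
Proof.
apply: mor_ext => [//|v m] /=.
pose Y : lmodType Abar := (M * N * L * K)%type.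
pose F (v : Vspace) (y : Y) : Y :=
  (0, mor1 f v y.1.1.1, mor1 g v y.1.1.2, mor1 h v y.1.2).
have F_lin u : klinear (F u).
  move=> c x y; rewrite /F !kscale_pair /= !mor1_lin.
  by congr (_, _, _, _); rewrite /kscale scaler0 addr0.
have F_linV c (u u' w : Vspace) y :
    sval w = kin T c * sval u + sval u' -> F w y = c *k: F u y + F u' y.
  move=> e; rewrite /F !kscale_pair /= !(mor1_linV _ _ e).
  by congr (_, _, _, _); rewrite /kscale scaler0 addr0.
have F_bimod (a b : Aalg) (u w : Vspace) y :
    sval w = val a * sval u * val b -> F w y = piA a *: F u (piA b *: y).
  move=> e; rewrite /F !(mor1_bimod _ _ e) /=.
  by congr (_, _, _, _); rewrite /= scaler0.
have [rho [rho_hom rhoA rhoV]] := T_action F_lin F_linV F_bimod.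
have [rl r1 rM] := rho_hom.
pose gamma t := (kend_fun (rho t) ((m, 0, 0, 0) : Y)).2.
have gD x y : gamma (x + y) = gamma x + gamma y by rewrite /gamma (klinD rl).
have gN x : gamma (- x) = - gamma x by rewrite /gamma (klinN rl).
have g0 : gamma 0 = 0 by rewrite /gamma (klin0 rl).
have gS J (s : seq J) E : gamma (\sum_(j <- s) E j) = \sum_(j <- s) gamma (E j).
  by elim/big_rec2: _ => [|j x y _ <-]; rewrite ?g0 ?gD.
have gV (u u' u'' : Vspace) : gamma (sval u * sval u' * sval u'') =
    mor1 h u (mor1 g u' (mor1 f u'' m)).
  by rewrite /gamma !rM /= !rhoV.
have gdd : gamma (d (d (sval v))) = 0.
  by rewrite /gamma (rho_ddV rho_hom rhoA (svalP v)).
have key : \sum_(p <- dseq v) \sum_(q <- dseq p.1) mor1 h q.1 (mor1 g q.2 (mor1 f p.2 m)) =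
           \sum_(p <- dseq v) \sum_(q <- dseq p.2) mor1 h p.1 (mor1 g q.1 (mor1 f q.2 m)).
  apply/eqP; rewrite -subr_eq0 -sumrB -[X in _ == X]gdd dseqP.
  rewrite (klin_sum (@wd_d_linear _ _ D)) gS; apply/eqP/eq_bigr => p _.
  rewrite (wd_d_leibniz _ (svalP p.1)) expr1 mulN1r gD gN !dseqP.
  rewrite mulr_suml mulr_sumr !gS; congr (_ - _); apply: eq_bigr => q _.
    by rewrite gV.
  by rewrite mulrA gV.
rewrite /comp1 /=.
transitivity (mor0 h (mor0 g (mor1 f v m)) +
  (mor0 h (mor1 g v (mor0 f m)) + mor1 h v (mor0 g (mor0 f m)) +
   \sum_(p <- dseq v) mor1 h p.1 (mor1 g p.2 (mor0 f m))) +
  (\sum_(p <- dseq v) mor0 h (mor1 g p.1 (mor1 f p.2 m)) +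
   \sum_(p <- dseq v) mor1 h p.1 (mor0 g (mor1 f p.2 m)) +
   \sum_(p <- dseq v) \sum_(q <- dseq p.1) mor1 h q.1 (mor1 g q.2 (mor1 f p.2 m)))).
  by rewrite -!big_split.
rewrite key; symmetry.
transitivity (mor0 h (mor0 g (mor1 f v m)) + mor0 h (mor1 g v (mor0 f m)) +
   \sum_(p <- dseq v) mor0 h (mor1 g p.1 (mor1 f p.2 m)) +
  mor1 h v (mor0 g (mor0 f m)) +
  (\sum_(p <- dseq v) mor1 h p.1 (mor0 g (mor1 f p.2 m)) +
   \sum_(p <- dseq v) mor1 h p.1 (mor1 g p.2 (mor0 f m)) +
   \sum_(p <- dseq v) \sum_(q <- dseq p.2) mor1 h p.1 (mor1 g q.1 (mor1 f q.2 m)))).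
  rewrite /comp1 !mor0D mor0_sum -!big_split /=; congr (_ + _).
  by apply: eq_bigr => p _; rewrite /comp1 !mor1D mor1_sum.
set a1 := mor0 h (mor0 g _); set a2 := mor0 h (mor1 g _ _).
set a3 := mor1 h v _; set s1 := \sum_(p <- _) mor0 h _.
set s2 := \sum_(p <- _) mor1 h _ (mor0 g _).
set s3 := \sum_(p <- _) mor1 h _ (mor1 g _ (mor0 f _)).
set s4 := \sum_(p <- _) \sum_(q <- _) _.
clearbody a1 a2 a3 s1 s2 s3 s4; rewrite -!addrA; congr (_ + (_ + _)).
rewrite [s1 + _]addrCA; congr (_ + _); rewrite [RHS]addrCA; congr (_ + _).
by rewrite [RHS]addrCA.
Qed.

Section MorZmod.
Variables M N : lmodType Abar.
HB.instance Definition _ := gen_eqMixin (mor M N).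
HB.instance Definition _ := gen_choiceMixin (mor M N).

Fact mor_add_proof (f g : mor M N) :
  [/\ klinear (fun m => mor0 f m + mor0 g m),
      forall v, klinear (fun m => mor1 f v m + mor1 g v m),
      forall c (u v w : Vspace) m, sval w = kin T c * sval u + sval v ->
        mor1 f w m + mor1 g w m =
        c *k: (mor1 f u m + mor1 g u m) + (mor1 f v m + mor1 g v m),
      forall (a b : Aalg) (v w : Vspace) m, sval w = val a * sval v * val b ->
        mor1 f w m + mor1 g w m =
        piA a *: (mor1 f v (piA b *: m) + mor1 g v (piA b *: m))
    & forall (a : Aalg) (v : Vspace) m, sval v = d (val a) ->
        piA a *: (mor0 f m + mor0 g m) =
        mor0 f (piA a *: m) + mor0 g (piA a *: m) + (mor1 f v m + mor1 g v m)].
Proof.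
split=> [c x y|v c x y|c u v w m e|a b v w m e|a v m e].
- by rewrite !mor0_lin kscaleDr addrACA.
- by rewrite !mor1_lin kscaleDr addrACA.
- by rewrite !(mor1_linV _ _ e) kscaleDr addrACA.
- by rewrite !(mor1_bimod _ _ e) scalerDr.
- by rewrite scalerDr !(mor_compat _ _ e) addrACA.
Qed.
Definition mor_add (f g : mor M N) : mor M N :=
  let: And5 a b c x y := mor_add_proof f g in Mor a b c x y.

Fact mor_opp_proof (f : mor M N) :
  [/\ klinear (fun m => - mor0 f m),
      forall v, klinear (fun m => - mor1 f v m),
      forall c (u v w : Vspace) m, sval w = kin T c * sval u + sval v ->
        - mor1 f w m = c *k: (- mor1 f u m) + - mor1 f v m,
      forall (a b : Aalg) (v w : Vspace) m, sval w = val a * sval v * val b ->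
        - mor1 f w m = piA a *: - mor1 f v (piA b *: m)
    & forall (a : Aalg) (v : Vspace) m, sval v = d (val a) ->
        piA a *: (- mor0 f m) = - mor0 f (piA a *: m) + - mor1 f v m].
Proof.
split=> [c x y|v c x y|c u v w m e|a b v w m e|a v m e].
- by rewrite mor0_lin opprD /kscale scalerN.
- by rewrite mor1_lin opprD /kscale scalerN.
- by rewrite (mor1_linV _ _ e) opprD /kscale scalerN.
- by rewrite (mor1_bimod _ _ e) scalerN.
- by rewrite scalerN (mor_compat _ _ e) opprD.
Qed.
Definition mor_opp (f : mor M N) : mor M N :=
  let: And5 a b c x y := mor_opp_proof f in Mor a b c x y.
Definition mor_zero : mor M N := strict_mor (\0 : {linear M -> N}).

Lemma mor_addE f g : (forall m, mor0 (mor_add f g) m = mor0 f m + mor0 g m) /\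
  (forall v m, mor1 (mor_add f g) v m = mor1 f v m + mor1 g v m).
Proof. by rewrite /mor_add; case: mor_add_proof. Qed.
Lemma mor_oppE f : (forall m, mor0 (mor_opp f) m = - mor0 f m) /\
  (forall v m, mor1 (mor_opp f) v m = - mor1 f v m).
Proof. by rewrite /mor_opp; case: mor_opp_proof. Qed.
Let aE := mor_addE. Let oE := mor_oppE.

Fact mor_addA : associative mor_add.
Proof.
by move=> f g h; apply: mor_ext => [m|v m];
  rewrite ?((aE _ _).1) ?((aE _ _).2) addrA.
Qed.
Fact mor_addC : commutative mor_add.
Proof.
by move=> f g; apply: mor_ext => [m|v m];
  rewrite ?((aE _ _).1) ?((aE _ _).2) addrC.
Qed.
Fact mor_add0 : left_id mor_zero mor_add.
Proof.
by move=> f; apply: mor_ext => [m|v m];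
  rewrite ?((aE _ _).1) ?((aE _ _).2) add0r.
Qed.
Fact mor_addN : left_inverse mor_zero mor_opp mor_add.
Proof.
by move=> f; apply: mor_ext => [m|v m];
  rewrite ?((aE _ _).1) ?((aE _ _).2) ?((oE _).1) ?((oE _).2) addNr.
Qed.
HB.instance Definition _ := GRing.isZmodule.Build (mor M N)
  mor_addA mor_addC mor_add0 mor_addN.
Lemma mor0_add (f g : mor M N) m : mor0 (f + g) m = mor0 f m + mor0 g m.
Proof. exact: (aE f g).1. Qed.
Lemma mor1_add (f g : mor M N) v m : mor1 (f + g) v m = mor1 f v m + mor1 g v m.
Proof. exact: (aE f g).2. Qed.
End MorZmod.

Lemma compDl (M N L : lmodType Abar) (g g' : mor N L) (f : mor M N) :
  comp (g + g') f = comp g f + comp g' f.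
Proof.
apply: mor_ext => [m|v m]; first by rewrite mor0_add /= /comp0 mor0_add.
rewrite mor1_add /= /comp1 mor0_add mor1_add.
rewrite (eq_bigr (fun p => mor1 g p.1 (mor1 f p.2 m) + mor1 g' p.1 (mor1 f p.2 m))).
  by rewrite big_split [RHS]addrACA; congr (_ + _); rewrite addrACA.
by move=> p _; rewrite mor1_add.
Qed.
Lemma compDr (M N L : lmodType Abar) (g : mor N L) (f f' : mor M N) :
  comp g (f + f') = comp g f + comp g f'.
Proof.
apply: mor_ext => [m|v m]; first by rewrite mor0_add /= /comp0 mor0_add mor0D.
rewrite mor1_add /= /comp1 mor0_add mor1_add mor0D mor1D.
rewrite (eq_bigr (fun p => mor1 g p.1 (mor1 f p.2 m) + mor1 g p.1 (mor1 f' p.2 m))).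
  by rewrite big_split [RHS]addrACA; congr (_ + _); rewrite addrACA.
by move=> p _; rewrite mor1_add mor1D.
Qed.

(* Gamma = End(A/I)^op: the product xy is the composite of x followed by y.   *)
Definition Gring : Type := mor Abar^o Abar^o.
HB.instance Definition _ := GRing.Zmodule.on Gring.
Definition Gmul (x y : Gring) : Gring := comp y x.
Definition Gone : Gring := id_mor Abar^o.

Fact GmulA : associative Gmul.
Proof. by move=> x y z; rewrite /Gmul comp_assoc. Qed.
Fact Gmul1l : left_id Gone Gmul.
Proof. by move=> x; exact: comp_idr. Qed.
Fact Gmul1r : right_id Gone Gmul.
Proof. by move=> x; exact: comp_idl. Qed.
Fact GmulDl : left_distributive Gmul +%R.
Proof. by move=> x y z; exact: compDr. Qed.
Fact GmulDr : right_distributive Gmul +%R.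
Proof. by move=> x y z; exact: compDl. Qed.
HB.instance Definition _ := GRing.Zmodule_isPzRing.Build Gring
  GmulA Gmul1l Gmul1r GmulDl GmulDr.

(* A/I -> Gamma, a |-> (x |-> xa, 0)                                          *)
Definition rmul (a : Abar) (x : Abar^o) : Abar^o := (x : Abar) * a.
Fact rmul_linear a : linear (rmul a).
Proof. by move=> b x y; rewrite /rmul mulrDl; congr (_ + _); exact/esym/mulrA. Qed.
HB.instance Definition _ a :=
  GRing.isLinear.Build Abar Abar^o Abar^o *:%R (rmul a) (rmul_linear a).
Definition iotaG (a : Abar) : Gring := strict_mor (rmul a : {linear Abar^o -> Abar^o}).

Fact iotaG_zmod : zmod_morphism iotaG.
Proof.
move=> a b; apply: (@addIr _ (iotaG b)); rewrite subrK.
apply: mor_ext => [m|v m]; rewrite ?mor0_add ?mor1_add /= ?addr0 //.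
by rewrite /rmul -mulrDr subrK.
Qed.
Fact iotaG_monoid : monoid_morphism iotaG.
Proof.
split=> [|a b]; apply: mor_ext => [m|v m] //=; first exact: mulr1.
- by rewrite /comp0 /= /rmul mulrA.
- by rewrite /comp1 /= big1 // /rmul mul0r !addr0.
Qed.
HB.instance Definition _ := GRing.isZmodMorphism.Build Abar Gring iotaG iotaG_zmod.
HB.instance Definition _ := GRing.isMonoidMorphism.Build Abar Gring iotaG iotaG_monoid.

Fact Gkin_central c (x : Gring) : (iotaG \o kin Abar) c * x = x * (iotaG \o kin Abar) c.
Proof.
have e (y : Abar^o) : rmul (kin Abar c) y = c *k: y by rewrite /rmul -kin_central.
apply: mor_ext => [m|v m] /=.
  by rewrite /comp0 /= !e (klinZ (mor0_lin x)).
rewrite /comp1 /= !e [X in _ + X]big1 => [|p _]; last by rewrite mor10.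
by rewrite [in RHS]big1 // mor00 add0r !addr0 (klinZ (mor1_lin x v)) /kscale.
Qed.
Definition Gamma : kalgType k := KAlg Gkin_central.

Definition Gamma_tensor (M : lmodType Abar) : lmodType Gamma :=
  tensor (iotaG : {rmorphism Abar -> Gring}) M.

Definition isoA (M N : lmodType Abar) : Prop :=
  exists (f : mor M N) (g : mor N M), comp g f = id_mor M /\ comp f g = id_mor N.

Definition is_isoA (M N : lmodType Abar) (f : mor M N) : Prop :=
  exists g : mor N M, comp g f = id_mor M /\ comp f g = id_mor N.

(* The direct sum in A-mod is that of the underlying modules, with structure  *)
(* maps (f, 0), and the zero objects are the zero modules.                    *)
Definition indecomposableA (M : lmodType Abar) : Prop :=
  nonzero_mod M /\
  forall X Y : lmodType Abar, fdim X -> fdim Y -> isoA M (X * Y)%type ->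
    ~ nonzero_mod X \/ ~ nonzero_mod Y.

(* phi and psi are A-linear, a fortiori S-linear, by mor_compat: f^1 = 0.      *)
Definition conflation (M E N : lmodType Abar) (f : mor M E) (g : mor E N) : Prop :=
  exists (M' E' N' : lmodType Abar) (phi : mor M' E') (psi : mor E' N')
         (a : mor M M') (b : mor E E') (c : mor N N'),
    [/\ [/\ fdim M', fdim E' & fdim N'],
        [/\ is_isoA a, is_isoA b & is_isoA c],
        comp b f = comp phi a /\ comp c g = comp psi b,
        (forall v m, mor1 phi v m = 0) /\ (forall v m, mor1 psi v m = 0)
      & [/\ injective (mor0 phi), forall y, exists x, mor0 psi x = y
          & forall x, mor0 psi x = 0 <-> exists m, x = mor0 phi m]].

Definition E_projective (X : lmodType Abar) : Prop :=
  forall (M E N : lmodType Abar) (f : mor M E) (g : mor E N),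
    fdim M -> fdim E -> fdim N -> conflation f g ->
    forall h : mor X N, exists h' : mor X E, comp g h' = h.

Fact Pbar_subproof (i : P) (U := fun x : Abar^o => exists a : Abar, x = a * piA (aS (idem k i))) :
  U 0 /\ forall (a : Abar) x y, U x -> U y -> U (a *: x + y).
Proof.
split=> [|a _ _ [x ->] [y ->]]; first by exists 0; rewrite mul0r.
by exists (a * x + y); rewrite mulrDl -mulrA.
Qed.
Definition Pbar (i : P) : lmodType Abar := sub_of (Submod (Pbar_subproof i)).
Definition Sbar (i : P) : lmodType Abar := quo_of (rad (Pbar i)).

(* The quiver with \dim (e_j W0 e_i) arrows from i to j. *)
Definition arrow (i j : P) : bool := (0 < \dim (peirce (wd_W0 D) j i))%N.
Definition prec (i j : P) : bool := [exists l, arrow i l && connect arrow l j].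

Definition Q_family (Q : P -> lmodType Abar) : Prop :=
  [/\ forall i, [/\ fdim (Q i), indecomposableA (Q i) & E_projective (Q i)],
      forall i j, isoA (Q i) (Q j) -> i = j,
      forall X : lmodType Abar, fdim X -> indecomposableA X -> E_projective X ->
        exists i, isoA X (Q i)
    & exists m : P -> P -> nat, forall i,
        isoA (Pbar i) (Q i * dsum (flatten [seq nseq (m i j) (Q j) | j <- enum P & prec i j]))%type].

Definition P_strict (le : rel P) : Prop :=
  [/\ forall i j, peirce (wd_W1 D) j i != 0%VS -> le i j,
      forall i j, peirce (wd_W0 D) j i != 0%VS -> le i j && ~~ le j i
    & forall a : Aalg, I (val a) ->
        mulset (B := Aalg) (smset (rad Aalg^o)) (smset (rad Aalg^o)) a].

End RightAlgebra.

(* Main.v *)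
Require Import Defs.
From HB Require Import structures.
From mathcomp Require Import all_boot all_algebra.
From mathcomp Require functions.
From mathcomp Require Import boolp classical_sets.
From mathcomp Require Import freeg.

Set Implicit Arguments.
Unset Strict Implicit.
Unset Printing Implicit Defensive.

Import GRing.Theory.
Local Open Scope ring_scope.

(* Let F N = Hom(A/I, N) in A-mod.  A morphism f : A/I -> N is determined by   *)
(* f^0(1) in N and by the S-bimodule map f^1 : W1 -> Hom(A/I, N), which are    *)
(* arbitrary, so F is isomorphic to Gamma (x) -, exact on strict sequences and *)
(* fully faithful.  Since V is freely generated by W1 and the layer is         *)
(* triangular, the module structure of N can be deformed along any f^1; this   *)
(* makes a morphism with bijective f^0 invertible and splits idempotents in    *)
(* A-mod, so F preserves indecomposability.  The P'_i = F Q_i are therefore    *)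
(* indecomposable, and the summands of Gamma are among them; Fitting's lemma   *)
(* shows that there are no other indecomposable projectives.  Strictness of W0 *)
(* and W1 makes A/I finite-dimensional and Hom(K, S_j) vanish in A-mod when K  *)
(* has no composition factor S_l with l <= j.  Unless i < j strictly, the      *)
(* radical of P_i is such a K, and so are all further syzygies of S_i if they  *)
(* are covered by sums of P_l with l <= j false; F maps this resolution to a   *)
(* projective resolution of Delta'_i with no Ext into Delta'_j.  It also maps  *)
(* a composition series of A/I to a filtration of Gamma.                       *)

(** * Modules over a ring *)

(** Everything is transported along the functor [FG] = Hom(A/I, -) on A-mod. A morphism out of A/I
    amounts to a vector and an S-bimodule map on W1 ([mor_regular_eq], [mor_regular_ex]), which
    yields a finite dual basis of Gamma over A/I ([dual_basis]). It identifies [FG N] with the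
    tensor product of Gamma and N ([tensor_FG]) and makes [FG] full ([Fmap_full]), faithful and
    exact on strict sequences ([FG_presents]).

    Projectives: the triangular layer allows the action on a module to be changed along any bimodule
    map on W1 ([deformation]). Hence idempotents of A-mod become strict up to isomorphism
    ([idempotent_strict]) and split, so [FG] preserves indecomposability ([FG_indecomposable]). Each
    [FG (Q i)] is a summand of [FG (Pbar D i)], itself a summand of Gamma, hence projective.
    Conversely, an indecomposable projective has a simple quotient that is also a quotient of some
    [FG (Q j)]; lifting in both directions and Fitting's lemma identify the two ([FQ_complete]).

    Standard modules: W0 leads from i only to vertices strictly above i, and W1 only to vertices j
    with i <= j. The first fact makes A/I finite-dimensional with e_i (A/I) e_i = k e_i
    ([Abar_corner], [Abar_fdim]), so S_i is one-dimensional and rad P_i involves only S_l with l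
    strictly above i. By the second, Hom(K, S_j) vanishes in A-mod when K has no composition factor
    S_l with l <= j ([avoids_mor0]), and such K have syzygies of the same kind ([avoiding_cover]).
    Unless i lies strictly below j, rad P_i is such a K, and dimension shifting ([ext_vanish]) kills
    all Ext^n from Delta'_i to Delta'_j with n >= 1 ([Ext_Delta]). Finally [FG] turns a composition
    series of A/I into the filtration of Gamma ([Gamma_filtered]). *)

Section ModuleMaps.
Variable B : pzRingType.
Implicit Types M N L X Y : lmodType B.

Definition linear_of M N (f : M -> N) (fl : linear f) : {linear M -> N} :=
  HB.pack f (GRing.isLinear.Build B M N *:%R f fl).

Lemma submod0 M (U : submod M) : U 0.
Proof. exact: (smP U).1. Qed.

Lemma submodD M (U : submod M) x y : U x -> U y -> U (x + y).
Proof. by move=> Ux Uy; have := (smP U).2 1 x y Ux Uy; rewrite scale1r. Qed.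

Lemma submodZ M (U : submod M) a x : U x -> U (a *: x).
Proof. by move=> Ux; have := (smP U).2 a x 0 Ux (submod0 U); rewrite addr0. Qed.

Lemma submodN M (U : submod M) x : U x -> U (- x).
Proof. by rewrite -scaleN1r; exact: submodZ. Qed.

Lemma submod_sum M (U : submod M) (J : Type) (s : seq J) (F : J -> M) :
  (forall j, U (F j)) -> U (\sum_(j <- s) F j).
Proof.
by move=> UF; elim/big_rec: _ => [|j x _ Ux]; [exact: submod0|exact: submodD].
Qed.

Lemma submod_val M (U : submod M) (x : sub_of U) : U (val x).
Proof. exact/asboolP/(valP x). Qed.

Definition in_submod M (U : submod M) x (Ux : U x) : sub_of U :=
  exist _ x (introT (asboolP _) Ux).

Definition submod_incl M (U : submod M) : {linear sub_of U -> M} :=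
  linear_of (f := fun x : sub_of U => val x) (fun _ _ _ => erefl).

Fact corestrict_linear M N (U : submod N) (f : {linear M -> N}) (fU : forall x, U (f x)) :
  linear (fun x => in_submod (fU x)).
Proof. by move=> a x y; apply: val_inj; rewrite /= linearP. Qed.
Definition corestrict M N (U : submod N) (f : {linear M -> N})
    (fU : forall x, U (f x)) : {linear M -> sub_of U} :=
  linear_of (corestrict_linear fU).

Fact submod_ker_proof M N (f : {linear M -> N}) (K := fun x => f x = 0) :
  K 0 /\ forall a x y, K x -> K y -> K (a *: x + y).
Proof.
split=> [|a x y Kx Ky]; first exact: linear0.
by rewrite /K linearP Kx Ky scaler0 addr0.
Qed.
Definition submod_ker M N (f : {linear M -> N}) : submod M := Submod (submod_ker_proof f).

Fact submod_im_proof M N (f : {linear M -> N}) (I := fun y => exists x, y = f x) :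
  I 0 /\ forall a x y, I x -> I y -> I (a *: x + y).
Proof.
split=> [|a _ _ [x ->] [y ->]]; first by exists 0; rewrite linear0.
by exists (a *: x + y); rewrite linearP.
Qed.
Definition submod_im M N (f : {linear M -> N}) : submod N := Submod (submod_im_proof f).

Definition quo_linear M (U : submod M) : {linear M -> quo_of U}.
Proof.
apply: (linear_of (f := quo_pi U)) => a x y.
by rewrite quo_piD quo_piZ.
Defined.

Lemma quo_linear_eq0 M (U : submod M) x : quo_linear U x = 0 <-> U x.
Proof. by rewrite -[0](linear0 (quo_linear U)) -[X in _ <-> U X]subr0; exact: quo_eq. Qed.

Lemma factor_inj M N L (i : {linear M -> N}) (f : {linear L -> N}) :
  injective i -> (forall x, exists y, f x = i y) ->
  exists g : {linear L -> M}, forall x, f x = i (g x).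
Proof.
move=> inji fi; pose g x := sval (cid (fi x)).
have gE x : f x = i (g x) by exact: svalP (cid (fi x)).
have gl : linear g by move=> a x y; apply: inji; rewrite -gE !linearP -!gE.
by exists (linear_of gl).
Qed.

Lemma factor_surj M N L (p : {linear M -> N}) (f : {linear M -> L}) :
  (forall y, exists x, p x = y) -> (forall x, p x = 0 -> f x = 0) ->
  exists g : {linear N -> L}, forall x, g (p x) = f x.
Proof.
move=> surjp pf; pose s y := sval (cid (surjp y)).
have sE y : p (s y) = y by exact: svalP (cid (surjp y)).
have ff x x' : p x = p x' -> f x = f x'.
  by move=> e; apply/subr0_eq; rewrite -linearB pf // linearB e subrr.
have gl : linear (fun y => f (s y)).
  by move=> a x y; rewrite -linearP; apply: ff; rewrite linearP !sE.
by exists (linear_of gl) => x; apply: ff; rewrite sE.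
Qed.

Lemma bij_inv_linear M N (f : {linear M -> N}) : bijective f ->
  exists g : {linear N -> M}, cancel f g /\ cancel g f.
Proof.
case=> g fK gK.
have gl : linear g by move=> a x y; apply: (can_inj fK); rewrite gK linearP !gK.
by exists (linear_of gl).
Qed.

Lemma inj_surj_bij (T T' : Type) (f : T -> T') :
  injective f -> (forall y, exists x, f x = y) -> bijective f.
Proof.
move=> injf surjf; exists (fun y => sval (cid (surjf y))) => x.
  by apply: injf; exact: svalP (cid (surjf (f x))).
exact: svalP (cid (surjf x)).
Qed.

Lemma linear_injP M N (f : {linear M -> N}) :
  (forall x, f x = 0 -> x = 0) -> injective f.
Proof. by move=> f0 x y /eqP; rewrite -subr_eq0 -linearB => /eqP/f0/subr0_eq. Qed.

Lemma mod_iso_refl M : mod_iso M M.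
Proof. by exists idfun; exists idfun. Qed.

Lemma mod_iso_sym M N : mod_iso M N -> mod_iso N M.
Proof.
by case=> f /bij_inv_linear[g [fK gK]]; exists g; exists f.
Qed.

Lemma mod_iso_trans M N L : mod_iso M N -> mod_iso N L -> mod_iso M L.
Proof.
move=> [f fb] [g gb]; exists (g \o f); exact: bij_comp.
Qed.

Lemma mod_iso_factor M N L (p : {linear M -> N}) (f : {linear M -> L}) :
  (forall y, exists x, p x = y) -> (forall y, exists x, f x = y) ->
  (forall x, p x = 0 <-> f x = 0) -> mod_iso N L.
Proof.
move=> sp sf pf; have [g gE] := factor_surj sp (fun x => (pf x).1).
exists g; apply: inj_surj_bij.
  by apply: linear_injP => y; have [x <-] := sp y; rewrite gE => /(pf x).2.
by move=> z; have [x <-] := sf z; exists (p x).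
Qed.

Lemma nonzero_iso M N : mod_iso M N -> nonzero_mod M -> nonzero_mod N.
Proof.
case=> f /bij_inj injf [x x0]; exists (f x).
by apply: contraNneq x0 => fx0; apply/eqP/injf; rewrite fx0 linear0.
Qed.

Lemma indecomposable_iso M N : mod_iso M N -> indecomposable M -> indecomposable N.
Proof.
move=> MN [M0 Mi]; split=> [|X Y NXY]; first exact: nonzero_iso M0.
exact/Mi/(mod_iso_trans MN).
Qed.

Lemma projective_retract M N (f : {linear M -> N}) (g : {linear N -> M}) :
  cancel f g -> projective N -> projective M.
Proof.
move=> fK pN X Y p h surjp; have [l lE] := pN X Y p (h \o g) surjp.
by exists (l \o f) => x /=; rewrite lE /= fK.
Qed.

Lemma projective_iso M N : mod_iso M N -> projective M -> projective N.
Proof.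
case=> f /bij_inv_linear[g [fK gK]]; exact: (projective_retract gK).
Qed.

Definition lin_fst M N : {linear (M * N)%type -> M} :=
  linear_of (f := fun x : M * N => x.1) (fun _ _ _ => erefl).
Definition lin_snd M N : {linear (M * N)%type -> N} :=
  linear_of (f := fun x : M * N => x.2) (fun _ _ _ => erefl).
Definition lin_inl M N : {linear M -> (M * N)%type}.
Proof.
apply: (linear_of (f := fun x : M => (x, 0 : N))) => a x y.
by congr pair; rewrite /= scaler0 addr0.
Defined.
Definition lin_inr M N : {linear N -> (M * N)%type}.
Proof.
apply: (linear_of (f := fun x : N => (0 : M, x))) => a x y.
by congr pair; rewrite /= scaler0 addr0.
Defined.

Definition lin_pair M N L (f : {linear L -> M}) (g : {linear L -> N}) :
  {linear L -> (M * N)%type}.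
Proof.
apply: (linear_of (f := fun x => (f x, g x))) => a x y.
by rewrite !linearP.
Defined.

Definition lin_copair M N L (f : {linear M -> L}) (g : {linear N -> L}) :
  {linear (M * N)%type -> L}.
Proof.
apply: (linear_of (f := fun x : M * N => f x.1 + g x.2)) => a x y.
by rewrite /= !linearP /= scalerDr addrACA.
Defined.

Lemma projective_prod M N : projective M -> projective N -> projective (M * N)%type.
Proof.
move=> pM pN X Y p h surjp.
have [f fE] := pM X Y p (h \o lin_inl M N) surjp.
have [g gE] := pN X Y p (h \o lin_inr M N) surjp.
exists (lin_copair f g) => -[x y] /=.
by rewrite linearD fE gE /= -linearD; congr (h (_, _)); rewrite /= ?addr0 ?add0r.
Qed.

Lemma projective_regular : projective B^o.
Proof.
move=> X Y p h surjp; have [x px] := surjp (h 1).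
have sl : linear (fun a : B^o => (a : B) *: x).
  by move=> a b c; rewrite scalerDl scalerA.
by exists (linear_of sl) => a /=; rewrite linearZ px -linearZ; congr (h _); exact: mulr1.
Qed.

Lemma idempotent_decomp N (p : {linear N -> N}) :
  (forall x, p (p x) = p x) ->
  mod_iso N (sub_of (submod_ker p) * sub_of (submod_ker (idfun \- p)))%type.
Proof.
move=> pp; apply: mod_iso_sym; exists (lin_copair (submod_incl _) (submod_incl _)).
apply: inj_surj_bij.
  apply: linear_injP => -[x y] /= e; have px : p (val x) = 0 := submod_val x.
  have py : val y - p (val y) = 0 := submod_val y.
  have y0 : val y = 0.
    by move/subr0_eq: py => ->; rewrite -[p _]add0r -px -linearD e linear0.
  by move: e; rewrite y0 addr0 => x0; congr pair; apply: val_inj.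
move=> x; have kx : p (x - p x) = 0 by rewrite linearB pp subrr.
have iy : (idfun \- p) (p x) = 0 by rewrite /= pp subrr.
by exists (in_submod (U := submod_ker p) kx, in_submod (U := submod_ker (idfun \- p)) iy) => /=;
  rewrite subrK.
Qed.

Definition subquo_linear M (U' U : submod M) : {linear sub_of U' -> subquo U' U} :=
  quo_linear (@Submod _ (sub_of U') (fun x => U (val x)) (subquo_subproof U' U)).

Lemma subquo_linear_eq0 M (U' U : submod M) (x : sub_of U') :
  subquo_linear U' U x = 0 <-> U (val x).
Proof. exact: quo_linear_eq0. Qed.

Lemma subquo_linear_surj M (U' U : submod M) y : exists x, subquo_linear U' U x = y.
Proof. by exists (quo_repr y); exact: quo_piK. Qed.

End ModuleMaps.

Section ActionModule.
Variables (B : pzRingType) (X : zmodType) (act : B -> X -> X).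
Hypotheses (actA : forall a b x, act a (act b x) = act (a * b) x)
  (act1 : left_id 1 act) (actDr : right_distributive act +%R)
  (actDl : forall x, {morph act^~ x : a b / a + b}).
(** An alias of [X] that takes the module axioms as arguments, so that an action constructed in the
    middle of a proof can still be declared as a module instance. *)
Definition act_mod of (forall a b x, act a (act b x) = act (a * b) x) &
  left_id 1 act & right_distributive act +%R &
  (forall x, {morph act^~ x : a b / a + b}) : Type := X.
Local Notation N := (act_mod actA act1 actDr actDl).
HB.instance Definition _ := GRing.Zmodule.on N.
HB.instance Definition _ := GRing.Zmodule_isLmodule.Build B N actA act1 actDr actDl.

Lemma mod_of_action : exists (N : lmodType B) (j : X -> N), [/\ bijective j,
    forall x y, j (x + y) = j x + j y & forall a x, j (act a x) = a *: j x].
Proof. by exists N, (fun x : X => x : N); split=> //; exists (fun x : N => x : X). Qed.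
End ActionModule.

(** * Vanishing of Ext by dimension shifting *)

Section ExtVanishing.
Variable B : pzRingType.

(* Two presentations p : R1 -> Z and q : Pr -> X by projectives, and maps     *)
(* a : Z -> X, b : X -> Z with 1 - b a factoring through p, induce such maps  *)
(* between the syzygies K = ker p and X' = ker q.                             *)
Lemma syzygy_comparison (Z R1 R2 K Pr X X' : lmodType B)
    (p : {linear R1 -> Z}) (i : {linear K -> R1}) (p' : {linear R2 -> K})
    (q : {linear Pr -> X}) (i' : {linear X' -> Pr})
    (a : {linear Z -> X}) (b : {linear X -> Z}) (s : {linear Z -> R1}) :
  projective R1 -> projective Pr ->
  (forall z, exists x, p x = z) -> (forall y, exists x, p' x = y) ->
  (forall y, exists x, q x = y) -> injective i -> injective i' ->
  (forall x, p x = 0 <-> exists y, x = i y) ->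
  (forall x, q x = 0 <-> exists y, x = i' y) ->
  (forall z, z - b (a z) = p (s z)) ->
  exists (a' : {linear K -> X'}) (b' : {linear X' -> K}) (s' : {linear R1 -> R2}),
    forall z, z - b' (a' z) = p' (s' (i z)).
Proof.
move=> pR1 pPr sp sp' sq inji inji' ep eq_ abs.
have [f fE] := pR1 _ _ q (a \o p) sq.
have [g gE] := pPr _ _ p (b \o q) sp.
pose y : {linear R1 -> R1} := idfun \- (g \o f) \- (s \o p).
have yK x : exists z, y x = i z.
  by apply/ep; rewrite /= !linearB /= gE /= fE /= -abs subrr.
have [y' y'E] := factor_inj inji yK.
have [s' s'E] := pR1 _ _ p' y' sp'.
have fi z : exists x, (f \o i) z = i' x.
  by apply/eq_; rewrite /= fE /=; (have -> : p (i z) = 0 by apply/ep; exists z); rewrite linear0.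
have [a' a'E] := factor_inj inji' fi.
have gi x : exists z, (g \o i') x = i z.
  by apply/ep; rewrite /= gE /=; (have -> : q (i' x) = 0 by apply/eq_; exists x); rewrite linear0.
have [b' b'E] := factor_inj inji gi.
exists a', b', s' => z; apply: inji; rewrite s'E -y'E /= linearB -b'E /= -a'E /=.
by (have -> : p (i z) = 0 by apply/ep; exists z); rewrite linear0 subr0.
Qed.

Definition presents (M Pr X : lmodType B) : Prop :=
  projective Pr /\ exists (q : {linear Pr -> M}) (i : {linear X -> Pr}),
    [/\ forall y, exists x, q x = y, injective i & forall x, q x = 0 <-> exists y, x = i y].

Lemma presents_iso (M M' Pr X : lmodType B) :
  mod_iso M M' -> presents M Pr X -> presents M' Pr X.
Proof.
case=> f /[dup] fb /bij_inv_linear[g [fK gK]] [pPr [q [i [sq inji ex]]]]; split=> //.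
exists (f \o q), i; split=> // [y|x]; first by have [x xE] := sq (g y); exists x; rewrite /= xE.
split=> [/= e|/ex /= ->]; last exact: linear0.
by apply/ex; apply: (can_inj fK); rewrite e linear0.
Qed.

Section Boundaries.
Variables (M : lmodType B) (R : proj_resolution M).

(** The augmentation counts as the differential leaving degree 0, so the induction on degrees is
    uniform. *)
Definition bd_target n : lmodType B := if n is m.+1 then res R m else M.
Definition bd n : {linear res R n -> bd_target n} :=
  match n return {linear res R n -> bd_target n} with
  | 0%N => res_aug R | m.+1 => res_d R m end.

Lemma bd_exact n x : bd n x = 0 <-> exists y, x = res_d R n y.
Proof. by case: n x => [|n] x; [exact: res_exact0|exact: res_exactS]. Qed.

Lemma bd_d n x : submod_ker (bd n) (res_d R n x).
Proof. by apply/bd_exact; exists x. Qed.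
Definition bd_cor n : {linear res R n.+1 -> sub_of (submod_ker (bd n))} :=
  corestrict (@bd_d n).
Lemma bd_cor_surj n y : exists x, bd_cor n x = y.
Proof.
have [x xE] := (bd_exact _).1 (submod_val y).
by exists x; apply: val_inj.
Qed.
Lemma bd_cor_ker n x : bd_cor n x = 0 <-> exists y, x = submod_incl (submod_ker (bd n.+1)) y.
Proof.
split=> [x0|[y ->]]; last by apply: val_inj; exact: (submod_val y).
have bx : submod_ker (bd n.+1) x by exact: (congr1 val x0).
by exists (in_submod bx).
Qed.
End Boundaries.

(** [Cl] is closed under suitable syzygies and has no nonzero map to [N]. As [Ext_neq0] may use any
    resolution, its syzygies are compared with those in [Cl]: the identity of a syzygy agrees, up to
    a map through its projective cover, with a map through an object of [Cl], and the latter
    contributes nothing to maps into [N]. *)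
Lemma ext_vanish (M N : lmodType B) (Cl : lmodType B -> Prop) :
  (forall X : lmodType B, Cl X -> exists Pr X', Cl X' /\ presents X Pr X') ->
  (exists Pr X', Cl X' /\ presents M Pr X') ->
  (forall (X : lmodType B) (f : {linear X -> N}), Cl X -> forall x, f x = 0) ->
  forall n, ~ Ext_neq0 n.+1 M N.
Proof.
move=> ClS ClM ClN n [R [f [fd fnb]]]; apply: fnb.
have [X [ClX [a [b [s abs]]]]] : exists X, Cl X /\
    exists (a : {linear sub_of (submod_ker (bd R n)) -> X}) (b : {linear X -> _})
           (s : {linear res R n -> res R n.+1}),
      forall z, z - b (a z) = bd_cor R n (s (val z)).
  elim: n {f fd} => [|n [X [ClX [a [b [s abs]]]]]].
    have [Pr [X' [ClX' [pPr [q [i [sq inji eq_]]]]]]] := ClM.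
    exists X'; split=> //.
    (* Both presentations are of [M] itself, so the comparison starts with a = b = id and s = 0. *)
    apply: (syzygy_comparison (p := bd R 0) (i := submod_incl _) (p' := bd_cor R 0)
      (q := q) (i' := i) (a := idfun) (b := idfun) (s := \0)) => //.
    - exact: res_proj.
    - exact: res_aug_surj.
    - exact: bd_cor_surj.
    - exact: val_inj.
    - move=> x; split=> [bx|[y ->]]; last exact: (submod_val y).
      by exists (in_submod (U := submod_ker (bd R 0)) bx).
    - by move=> z /=; rewrite subrr linear0.
  have [Pr [X' [ClX' [pPr [q [i [sq inji eq_]]]]]]] := ClS X ClX.
  exists X'; split=> //.
  apply: (syzygy_comparison (p := bd_cor R n) (i := submod_incl _) (p' := bd_cor R n.+1)
    (q := q) (i' := i) (a := a) (b := b) (s := s \o submod_incl _)) => //.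
  - exact: res_proj.
  - exact: bd_cor_surj.
  - exact: bd_cor_surj.
  - exact: val_inj.
  - exact: bd_cor_ker.
(* The cocycle [f] factors through the syzygy as h, and h b = 0 because the source of [b] is in
   [Cl]. Hence h = h (1 - b a), which makes [f \o s] the required primitive. *)
have fb x : forall y, bd_cor R n y = b x -> f y = 0.
  move: x; have [h hE] : exists h : {linear sub_of (submod_ker (bd R n)) -> N},
      forall y, h (bd_cor R n y) = f y.
    apply: factor_surj => [|y]; first exact: bd_cor_surj.
    move/bd_cor_ker => [z ->]; have [t tE] := (bd_exact _).1 (submod_val z).
    by rewrite [submod_incl _ z]tE; exact: fd.
  by move=> x y yE; rewrite -hE yE; exact: (ClN _ (h \o b)).
exists (f \o s) => x /=; apply/subr0_eq; rewrite -linearB.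
apply: (fb (a (bd_cor R n x))).
by rewrite linearB -[bd_cor R n (s _)](abs (bd_cor R n x)) opprB addrC subrK.
Qed.
End ExtVanishing.

(** * Functionals on projective modules *)

Section NonzeroFunctional.
Import functions.
Variables (B : pzRingType) (M : lmodType B).
Local Notation fin_supp f := (exists s : seq M, forall x, x \notin s -> f x = 0).

Fact free_module_proof (F := fun f : M -> B^o => fin_supp f) :
  F 0 /\ forall a x y, F x -> F y -> F (a *: x + y).
Proof.
split=> [|a f g [s sf] [t tg]]; first by exists [::].
exists (s ++ t) => x; rewrite mem_cat negb_or => /andP[xs xt].
rewrite [LHS]/(a *: f x + g x) sf // tg //; exact: etrans (addr0 _) (mulr0 a).
Qed.
Definition free_module : submod (M -> B^o : lmodType B) := Submod free_module_proof.
Local Notation X := (sub_of free_module).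

Lemma free_moduleP a (f g : X) x : val (a *: f + g) x = a * (val f x : B) + val g x :> B.
Proof. by rewrite [val _](linearP (submod_incl free_module)). Qed.

Definition supp_seq (f : X) : seq M := undup (sval (cid (submod_val f))).
Definition free_sum (f : X) : M := \sum_(x <- supp_seq f) (val f x : B) *: x.

(** Frees [free_sum] from its chosen support, so that two functions can be summed over a common
    one. *)
Lemma free_sumE (f : X) s : uniq s -> (forall x, x \notin s -> val f x = 0) ->
  free_sum f = \sum_(x <- s) (val f x : B) *: x.
Proof.
move=> us sf.
have E (t : seq M) : \sum_(x <- t) (val f x : B) *: x =
    \sum_(x <- [seq x <- t | val f x != 0]) (val f x : B) *: x.
  rewrite big_filter [RHS]big_mkcond; apply: eq_bigr => x _.
  by case: eqP => [->|//]; rewrite scale0r.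
rewrite /free_sum E [RHS]E; apply/perm_big/uniq_perm; rewrite ?filter_uniq ?undup_uniq //.
move=> x; rewrite !mem_filter; case: eqP => //= fx.
rewrite mem_undup; apply/idP/idP => _; apply/negPn/negP => xs; apply: fx.
  exact: sf.
exact: (svalP (cid (submod_val f))).
Qed.

Fact free_sum_linear : linear free_sum.
Proof.
move=> a f g; pose s := undup (supp_seq f ++ supp_seq g).
have us : uniq s by exact: undup_uniq.
have sf x : x \notin s -> val f x = 0.
  rewrite mem_undup mem_cat negb_or mem_undup => /andP[xs _].
  exact: (svalP (cid (submod_val f))).
have sg x : x \notin s -> val g x = 0.
  rewrite mem_undup mem_cat negb_or => /andP[_]; rewrite mem_undup => xs.
  exact: (svalP (cid (submod_val g))).
rewrite !(@free_sumE _ s) // => [|x xs]; last first.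
  exact: etrans (free_moduleP _ _ _ _) (etrans (congr2 (fun p q : B => a * p + q) (sf x xs) (sg x xs)) (etrans (addr0 _) (mulr0 a))).
rewrite scaler_sumr -big_split; apply: eq_bigr => x _ /=.
by apply: etrans (congr1 (fun p : B => p *: x) (free_moduleP _ _ _ _)) _; rewrite scalerDl scalerA.
Qed.

(** [M] is a direct summand of the free module on its underlying set; were all coordinates of the
    section zero, [M] would be zero. This gives a map to the regular module without any finiteness
    assumption on [M]. *)
Lemma projective_functional : projective M -> nonzero_mod M ->
  exists (f : {linear M -> B^o}) (x : M), f x <> 0.
Proof.
move=> pM [m m0]; have surj y : exists x, linear_of free_sum_linear x = y.
  have dP : fin_supp (fun x => (x == y)%:R : B^o).
    by exists [:: y] => x; rewrite inE => /negPf ->.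
  exists (in_submod (U := free_module) dP) => /=.
  rewrite (@free_sumE _ [:: y]) //= => [|x]; first by rewrite big_seq1 eqxx scale1r.
  by rewrite inE => /negPf ->.
have [h hE] := pM _ _ _ (idfun : {linear M -> M}) surj.
apply: contrapT => none; case/eqP: m0; rewrite -[m]hE /= /free_sum big1 // => x _.
have evl : linear (fun f : X => val f x) by move=> a f g; exact: free_moduleP.
suff -> : val (h m) x = 0 by rewrite scale0r.
by apply: contrapT => hx; apply: none; exists (linear_of evl \o h), m.
Qed.
End NonzeroFunctional.

(** * The universal property of the tensor product *)

Section TensorUniversal.
Variables (B C : pzRingType) (phi : {rmorphism B -> C}) (M : lmodType B) (L : lmodType C).
Variable g : C -> M -> L.
Hypotheses (gDl : forall x y m, g (x + y) m = g x m + g y m)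
  (gDr : forall x m n, g x (m + n) = g x m + g x n)
  (gB : forall x b m, g (x * phi b) m = g x (b *: m))
  (gZ : forall c x m, g (c * x) m = c *: g x m).

Lemma tensor_lift : exists G : {linear tensor phi M -> L}, forall x m, G (tens phi x m) = g x m.
Proof.
pose h : {freeg (C * M)%type / int} -> zmodule L :=
  fglift (M := zmodule L) (fun p : C * M => g p.1 p.2).
have hB : zmod_morphism h by exact: lift_is_additive.
have hU x m : h (fgen x m) = g x m by rewrite /h liftU scale1r.
pose hA : {additive {freeg (C * M)%type / int} -> zmodule L} :=
  HB.pack h (GRing.isZmodMorphism.Build _ _ h hB).
have h0 : h 0 = 0 by exact: (raddf0 hA).
have hD x y : h (x + y) = h x + h y by exact: (raddfD hA).
have hZ (a : int) x : h (a *: x) = h x *~ a.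
  by rewrite -[a in LHS]intz scaler_int; exact: (raddfMz hA).
have KP : h 0 = 0 /\ forall (a : int) x y, h x = 0 -> h y = 0 -> h (a *: x + y) = 0.
  by split=> // a x y hx hy; rewrite hD hZ hx hy mul0rz addr0.
have hrel z z' : quo_pi (gen_submod (tensor_rel phi (M := M))) z = quo_pi _ z' -> h z = h z'.
  move/quo_eq => rz; apply/subr0_eq; rewrite -hB.
  apply: (rz (Submod KP)) => _ [] [x [y [m ->]]] /=; rewrite !hB !hU; apply/eqP.
  - by rewrite gDl -addrA -opprD subrr.
  - by rewrite gDr -addrA -opprD subrr.
  - by rewrite gB subrr.
pose G (z : tensor phi M) : L := h (quo_repr z).
have GE z : G (quo_pi _ z) = h z by apply: hrel; rewrite quo_piK.
have GB : zmod_morphism G.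
  move=> x y; rewrite -[x]quo_piK -[y]quo_piK !GE -hB -GE; congr G.
  exact/esym/(linearB (quo_linear (gen_submod (tensor_rel phi (M := M))))).
pose GA : {additive tensor phi M -> L} := HB.pack G (GRing.isZmodMorphism.Build _ _ G GB).
have GT x m : G (tens phi x m) = g x m by rewrite [G _]GE.
have GZ c : GA \o tensor_scale c =1 ( *:%R c) \o GA.
  by apply: tensor_ind => x m /=; rewrite tensor_scaleE !GT gZ.
have Gl : linear G.
  move=> c x y; rewrite -[G (_ + _)]/(GA (c *: x + y)) raddfD; congr (_ + _).
  exact: (GZ c x).
by exists (linear_of Gl).
Qed.
End TensorUniversal.

(** * Finite-dimensional modules *)

(** Take a subspace of maximal dimension contained in [U]: the line through any further vector of
    [U] would enlarge it. *)
Lemma vspace_of (k : fieldType) (vT : vectType k) (U : vT -> Prop) :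
  U 0 -> (forall c x y, U x -> U y -> U (c *: x + y)) ->
  exists V : {vspace vT}, forall x, x \in V <-> U x.
Proof.
move=> U0 UL; pose Q d := `[< exists V : {vspace vT}, \dim V = d /\ forall x, x \in V -> U x >].
have Q0 : exists d, Q d.
  by exists 0%N; apply/asboolP; exists 0%VS; rewrite dimv0; split=> // x; rewrite memv0 => /eqP->.
have Qb d : Q d -> (d <= \dim {:vT})%N.
  by move/asboolP => [V [<- _]]; exact/dimvS/subvf.
case: (ex_maxnP Q0 Qb) => d /asboolP[V [dV VU]] dmax; exists V => x; split=> [|Ux]; first exact: VU.
apply: contrapT => xV.
have: Q (\dim (V + <[x]>)%VS).
  apply/asboolP; eexists; split=> // y /memv_addP[v vV [_ /vlineP[c ->] ->]].
  by rewrite addrC; apply: UL => //; exact: VU.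
move/dmax; rewrite -dV => h.
have /eqP VE : V == (V + <[x]>)%VS by rewrite eqEdim addvSl h.
by apply: xV; rewrite VE (subvP (addvSr _ _)) // memv_line.
Qed.

Section FiniteDimension.
Variables (k : fieldType) (B : kalgType k).
Implicit Types M N : lmodType B.

Lemma klinear_linear M N (f : {linear M -> N}) : klinear f.
Proof. by move=> c x y; rewrite /kscale linearP. Qed.

Lemma kscale0 M (m : M) : 0 *k: m = 0.
Proof. by rewrite /kscale rmorph0 scale0r. Qed.

Lemma kscaler0 M c : c *k: (0 : M) = 0.
Proof. exact: scaler0. Qed.

Lemma kscaleBr M c (x y : M) : c *k: (x - y) = c *k: x - c *k: y.
Proof. exact: scalerBr. Qed.

Lemma kscaler_sumr M c (J : Type) (s : seq J) (F : J -> M) :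
  c *k: (\sum_(j <- s) F j) = \sum_(j <- s) c *k: F j.
Proof. exact: scaler_sumr. Qed.

(** [fdim] only provides a spanning family. Arbitrarily chosen coefficients become linear after
    projecting along the space of relations, since their defect of linearity is a relation. *)
Lemma fdim_coord M : fdim M -> exists (n : nat) (b : 'I_n -> M) (c : M -> 'I_n -> k),
  (forall t x y i, c (t *k: x + y) i = t * c x i + c y i) /\
  forall x, x = \sum_i c x i *k: b i.
Proof.
case=> n [b /choice[c0 c0E]].
pose R (r : 'rV[k]_n) := \sum_i r 0 i *k: b i = 0.
have RL (t : k) (u v : 'rV[k]_n) : \sum_i (t *: u + v) 0 i *k: b i =
    t *k: (\sum_i u 0 i *k: b i) + \sum_i v 0 i *k: b i.
  rewrite kscaler_sumr -big_split; apply: eq_bigr => i _ /=.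
  by rewrite !mxE kscaleDl kscaleA.
have [V VR] : exists V : {vspace 'rV[k]_n}, forall r, r \in V <-> R r.
  apply: vspace_of => [|t u v]; first by rewrite /R big1 // => i _; rewrite mxE kscale0.
  by rewrite /R RL => -> ->; rewrite kscaler0 addr0.
pose w x : 'rV[k]_n := \row_i c0 x i; pose pr v := v - projv V v.
have prL : linear pr.
  by move=> a x y; rewrite /pr linearP scalerBr opprD addrACA.
have pr0 r : R r -> pr r = 0 by move/VR => rV; rewrite /pr projv_id // subrr.
have wE x : \sum_i w x 0 i *k: b i = x.
  by rewrite [RHS]c0E; apply: eq_bigr => i _; rewrite mxE.
have prE v : \sum_i pr v 0 i *k: b i = \sum_i v 0 i *k: b i.
  have e : pr v = (-1) *: projv V v + v by rewrite /pr scaleN1r addrC.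
  by rewrite e RL ((VR _).1 (memv_proj _ _)) kscaler0 add0r.
exists n, b, (fun x i => pr (w x) 0 i); split=> [t x y i|x]; last by rewrite prE wE.
have -> : pr (w (t *k: x + y)) = t *: pr (w x) + pr (w y).
  rewrite -prL; apply/subr0_eq.
  have -> : pr (w (t *k: x + y)) - pr (t *: w x + w y) =
            pr (w (t *k: x + y) - (t *: w x + w y)).
    by rewrite -[X in X = _]addrC -scaleN1r -prL scaleN1r addrC.
  apply: pr0; rewrite /R.
  have e : w (t *k: x + y) - (t *: w x + w y) = (-1) *: (t *: w x + w y) + w (t *k: x + y).
    by rewrite scaleN1r addrC.
  by rewrite e RL wE RL !wE kscaleN1 addNr.
by rewrite !mxE.
Qed.

Lemma fdim_surj M N (f : M -> N) : klinear f -> (forall y, exists x, f x = y) ->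
  fdim M -> fdim N.
Proof.
move=> fl sf [n [b bE]]; exists n, (fun i => f (b i)) => y.
have [x <-] := sf y; have [c ->] := bE x; exists c.
by rewrite (klin_sum fl); apply: eq_bigr => i _; rewrite (klinZ fl).
Qed.

Lemma fdim_iso M N : mod_iso M N -> fdim M -> fdim N.
Proof.
case=> f [g fK gK]; apply: (@fdim_surj _ _ f); first exact: klinear_linear.
by move=> y; exists (g y).
Qed.

Lemma fdim_prod M N : fdim M -> fdim N -> fdim (M * N)%type.
Proof.
move=> [m [b bE]] [n [d dE]].
exists (m + n)%N, (fun i => match split i with inl j => (b j, 0) | inr j => (0, d j) end).
move=> [x y]; have [c ->] := bE x; have [e ->] := dE y.
exists (fun i => match split i with inl j => c j | inr j => e j end).
rewrite big_split_ord /=.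
have -> : \sum_i c i *k: b i = (\sum_i c i *k: (b i, 0 : N)).1.
  by rewrite (raddf_sum (lin_fst M N)).
have -> : \sum_i e i *k: d i = (\sum_i e i *k: (0 : M, d i)).2.
  by rewrite (raddf_sum (lin_snd M N)).
set X := \sum_i _; set Y := \sum_i _.
have X2 : X.2 = 0.
  rewrite -[X.2]/(lin_snd M N X) raddf_sum big1 // => i _; exact: kscaler0.
have Y1 : Y.1 = 0.
  rewrite -[Y.1]/(lin_fst M N Y) raddf_sum big1 // => i _; exact: kscaler0.
transitivity (X + Y).
  by rewrite [X]surjective_pairing [Y]surjective_pairing X2 Y1; congr pair; rewrite /= ?addr0 ?add0r.
congr (_ + _); apply: eq_bigr => i _.
  by rewrite -[lshift n i]/(unsplit (inl i)) unsplitK.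
by rewrite -[rshift m i]/(unsplit (inr i)) unsplitK.
Qed.

Lemma submod_kscale M (U : submod M) c x : U x -> U (c *k: x).
Proof. exact: submodZ. Qed.

(** A substitute for the dimension of submodules: bounded, monotone, and strictly so on proper
    inclusions. *)
Lemma submod_rank M : fdim M -> exists (n : nat) (r : submod M -> nat),
  forall U, (r U <= n)%N /\ forall U' : submod M, (forall x, U x -> U' x) ->
    (r U <= r U')%N /\ (r U = r U' -> forall x, U' x -> U x).
Proof.
move=> /fdim_coord[n [b [c [cl cE]]]]; exists (\dim {:'rV[k]_n}).
pose w x : 'rV[k]_n := \row_i c x i.
have wl t x y : w (t *k: x + y) = t *: w x + w y by apply/rowP => i; rewrite !mxE cl.
have w_inj x y : w x = w y -> x = y.
  move=> e; rewrite [x]cE [y]cE; apply: eq_bigr => i _; congr (_ *k: _).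
  by have := congr1 (fun v : 'rV[k]_n => v 0 i) e; rewrite !mxE.
have VU (U : submod M) : exists V : {vspace 'rV[k]_n}, forall v, v \in V <-> exists2 x, U x & v = w x.
  apply: vspace_of => [|t _ _ [x Ux ->] [y Uy ->]].
    exists 0; first exact: submod0.
    by have := wl (-1) 0 0; rewrite scaleN1r addNr kscaler0 addr0.
  by exists (t *k: x + y); rewrite ?wl //; apply: submodD => //; exact: submod_kscale.
have [V VE] := choice VU; exists (fun U => \dim (V U)) => U.
split=> [|U' UU']; first exact/dimvS/subvf.
have sV : (V U <= V U')%VS.
  by apply/subvP => v /VE[x Ux ->]; apply/VE; exists x => //; exact: UU'.
split=> [|e x U'x]; first exact: dimvS.
have /eqP eV : V U == V U' by rewrite eqEdim sV e leqnn.
by have /VE[y Uy /w_inj ->] : w x \in V U by rewrite eV; apply/VE; exists x.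
Qed.

Lemma sub_fdim M (U : submod M) : fdim M -> fdim (sub_of U).
Proof.
move=> /fdim_coord[n [b [c [cl cE]]]].
pose w x : 'rV[k]_n := \row_i c x i.
have wl t x y : w (t *k: x + y) = t *: w x + w y by apply/rowP => i; rewrite !mxE cl.
have w_inj x y : w x = w y -> x = y.
  move=> e; rewrite [x]cE [y]cE; apply: eq_bigr => i _; congr (_ *k: _).
  by have := congr1 (fun v : 'rV[k]_n => v 0 i) e; rewrite !mxE.
have w0 : w 0 = 0 by have := wl (-1) 0 0; rewrite scaleN1r addNr kscaler0 addr0.
have [V VE] : exists V : {vspace 'rV[k]_n}, forall v, v \in V <-> exists y : sub_of U, v = w (val y).
  apply: vspace_of => [|t _ _ [x ->] [y ->]]; first by exists 0; rewrite w0.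
  by exists (t *k: x + y); rewrite -wl.
have /choice[e eE] (i : 'I_(\dim V)) : exists y : sub_of U, (vbasis V)`_i = w (val y).
  by apply/VE/vbasis_mem/mem_nth; rewrite size_tuple.
exists (\dim V), e => x; exists (fun i => coord (vbasis V) i (w (val x))).
apply/val_inj/w_inj; rewrite [LHS](@coord_vbasis _ _ _ V); last by apply/VE; exists x.
have wD u v : w (u + v) = w u + w v by have := wl 1 u v; rewrite kscale1 scale1r.
rewrite [val (\sum_i _)](raddf_sum (submod_incl U)) (big_morph w wD w0).
apply: eq_bigr => i _; rewrite eE.
by have := wl (coord (vbasis V) i (w (val x))) (val (e i)) 0; rewrite w0 !addr0 => <-.
Qed.

(** Divide by a proper submodule of maximal rank. Simplicity is stated in the form needed later:
    every nonzero map to the quotient is onto. *)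
Lemma simple_quotient M : fdim M -> nonzero_mod M ->
  exists (T : lmodType B) (p : {linear M -> T}),
    [/\ nonzero_mod T, forall y, exists x, p x = y
      & forall (X : lmodType B) (f : {linear X -> T}) x, f x <> 0 -> forall y, exists x, f x = y].
Proof.
move=> fM [m m0]; have [n [r rP]] := submod_rank fM.
pose Q d := `[< exists U : submod M, r U = d /\ exists x, ~ U x >].
have Q0 : exists d, Q d.
  exists (r (submod_ker (idfun : {linear M -> M}))); apply/asboolP; eexists; split=> //.
  by exists m; apply/eqP.
have Qb d : Q d -> (d <= n)%N by move/asboolP => [U [<- _]]; exact: (rP U).1.
case: (ex_maxnP Q0 Qb) => d /asboolP[U [rU [z Uz]]] dmax.
exists (quo_of U), (quo_linear U); split.
- by exists (quo_pi U z); apply/eqP; rewrite -[0](linear0 (quo_linear U)) => /quo_eq; rewrite subr0.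
- by move=> y; exists (quo_repr y); exact: quo_piK.
move=> X f x fx; pose W : submod M := submod_ker (quo_linear (submod_im f) \o quo_linear U).
have WE y : W y <-> exists x, f x = quo_pi U y.
  split=> [|[x' e]]; last first.
    rewrite -[W y]/(quo_pi (submod_im f) (quo_pi U y) = 0) -(linear0 (quo_linear (submod_im f))).
    by apply/quo_eq; rewrite subr0; exists x'.
  rewrite -[W y]/(quo_pi (submod_im f) (quo_pi U y) = 0) -(linear0 (quo_linear (submod_im f))).
  by move/quo_eq; rewrite subr0 => -[x' ->]; exists x'.
have UW y : U y -> W y.
  move=> Uy; apply/WE; exists 0; rewrite linear0 -(linear0 (quo_linear U)).
  by apply/quo_eq; rewrite sub0r; exact: submodN.
suff Wall y : W y by move=> y; have [x' x'E] := (WE (quo_repr y)).1 (Wall _); exists x'; rewrite x'E quo_piK.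
apply: contrapT => Wy.
have: Q (r W) by apply/asboolP; exists W; split=> //; exists y.
move/dmax; rewrite -rU => le1; have [le2 eqr] := (rP U).2 W UW.
have WU := eqr (anti_leq (introT andP (conj le2 le1))).
apply: fx; rewrite -[f x]quo_piK -(linear0 (quo_linear U)); apply/quo_eq; rewrite subr0.
by apply/WU/WE; exists x; rewrite quo_piK.
Qed.

Fixpoint lin_iter M (f : {linear M -> M}) n : {linear M -> M} :=
  if n is m.+1 then f \o lin_iter f m else idfun.

Lemma lin_iterD M (f : {linear M -> M}) m n x :
  lin_iter f (m + n) x = lin_iter f m (lin_iter f n x).
Proof. by elim: m => //= m ->. Qed.

(** For large m the kernel and the image of f^m are stable and [M] is their direct sum, so one of
    them is zero. *)
Lemma fitting M (f : {linear M -> M}) : fdim M -> indecomposable M ->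
  (exists n, forall x, lin_iter f n x = 0) \/ bijective f.
Proof.
move=> fM [_ Mi]; have [n [r rP]] := submod_rank fM.
pose K m := submod_ker (lin_iter f m); pose J m := submod_im (lin_iter f m).
have KS m l x : K m x -> K (l + m)%N x by rewrite /K /= lin_iterD => ->; rewrite linear0.
have JS m l x : J (m + l)%N x -> J m x.
  by case=> y ->; exists (lin_iter f l y); rewrite -lin_iterD.
(* One bounded nondecreasing quantity controls both chains: where it is stationary, the growing
   kernels and the shrinking images are stationary too. *)
pose g m := (r (K m) + (n - r (J m)))%N.
have gmono m l : (g m <= g (m + l))%N.
  rewrite /g leq_add ?leq_sub2l //; first by rewrite addnC ((rP _).2 _ (KS m l)).1.
  exact: ((rP _).2 _ (JS m l)).1.
pose Q d := `[< exists m, g m = d >].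
have Q0 : exists d, Q d by exists (g 0); apply/asboolP; exists 0%N.
have Qb d : Q d -> (d <= n + n)%N.
  by move/asboolP => [m <-]; rewrite leq_add ?leq_subr // (rP _).1.
case: (ex_maxnP Q0 Qb) => d /asboolP[m0 gm0] dmax.
have gE l : g (m0 + l)%N = g m0.
  by apply/anti_leq; rewrite gmono andbT gm0 dmax //; apply/asboolP; exists (m0 + l)%N.
(* A positive exponent, so that [f] itself is a factor of f^m on either side. *)
pose m := (m0 + 1)%N; have gmm : g (m + m)%N = g m by rewrite -addnA !gE.
have leK := (rP (K m)).2 _ (KS m m); have leJ := (rP (J (m + m)%N)).2 _ (JS m m).
have [eK eJ] : r (K m) = r (K (m + m)%N) /\ r (J (m + m)%N) = r (J m).
  have := (rP (J m)).1; have := leK.1; have := leJ.1; move: gmm; rewrite /g; clear.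
  move: (r (K m)) (r (K _)) (r (J m)) (r (J _)) => a b c e h1 h2 h3 h4.
  have h : (n - c <= n - e)%N by exact: leq_sub2l.
  have h5 : b = a.
    apply/anti_leq; rewrite h3 andbT -(leq_add2r (n - e)) h1 leq_add2l //.
  split=> //; move: h1; rewrite h5 => /addnI h6.
  by rewrite -[LHS](subKn (leq_trans h2 h4)) h6 subKn.
have {leK eK}KK := leK.2 eK; have {leJ eJ}JJ := leJ.2 eJ.
set h := lin_iter f m in KK JJ.
have hh x : lin_iter f (m + m) x = h (h x) by rewrite lin_iterD.
have iso : mod_iso M (sub_of (K m) * sub_of (J m))%type.
  apply: mod_iso_sym; exists (lin_copair (submod_incl _) (submod_incl _)).
  apply: inj_surj_bij.
    apply: linear_injP => -[x y] /= e.
    have [z zE] := submod_val y; have xE : h (val x) = 0 := submod_val x.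
    have hy : h (val y) = 0 by rewrite -[val y](addKr (val x)) e addr0 linearN xE oppr0.
    have y0 : val y = 0 by rewrite zE; apply: KK; rewrite /= hh -[h z]zE.
    by move: e; rewrite y0 addr0 => x0; congr pair; apply: val_inj.
  move=> x; have [z zE] : J (m + m)%N (h x) by apply: JJ; exists x.
  have Kx : K m (x - h z) by rewrite /K /= linearB -/h zE hh subrr.
  have Jz : J m (h z) by exists z.
  by exists (in_submod Kx, in_submod Jz) => /=; rewrite subrK.
have [K0|J0] := Mi _ _ iso; last first.
  left; exists m => x; apply: contrapT => hx; apply: J0.
  have Jx : J m (h x) by exists x.
  by exists (in_submod Jx); apply/eqP => /(congr1 val).
right; have {}K0 x : h x = 0 -> x = 0.
  move=> hx; apply: contrapT => x0; apply: K0.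
  by exists (in_submod (U := K m) hx); apply/eqP => /(congr1 val).
have hf x : h x = lin_iter f m0 (f x) by rewrite /h lin_iterD.
have hf' x : h x = f (lin_iter f m0 x) by rewrite /h /m addnC lin_iterD.
apply: inj_surj_bij.
  by apply: linear_injP => x fx; apply: K0; rewrite hf fx linear0.
move=> x; have [z zE] : J (m + m)%N (h x) by apply: JJ; exists x.
exists (lin_iter f m0 z); rewrite -hf'; apply/subr0_eq/K0.
by rewrite linearB zE hh subrr.
Qed.
End FiniteDimension.

(** Span of a list by recursion rather than by coefficient families, which makes spanning lists easy
    to concatenate and to map. *)
Fixpoint lspan (k : fieldType) (B : kalgType k) (M : lmodType B) (s : seq M) (x : M) : Prop :=
  if s is b :: s' then exists c : k, lspan s' (x - c *k: b) else x = 0.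

Section Spans.
Variables (k : fieldType) (B : kalgType k) (M : lmodType B).

Lemma lspan_cat (s t : seq M) x y : lspan s x -> lspan t y -> lspan (s ++ t) (x + y).
Proof.
elim: s x => /= [x -> |b s IH x [c /IH h]]; first by rewrite add0r.
by move=> /h; rewrite addrAC => h'; exists c.
Qed.

Lemma lspan_head (b : M) c : lspan [:: b] (c *k: b).
Proof. by exists c; rewrite /= subrr. Qed.

Lemma lspan_flatten (J : Type) (r : seq J) (S : J -> seq M) (F : J -> M) :
  (forall j, lspan (S j) (F j)) -> lspan (flatten (map S r)) (\sum_(j <- r) F j).
Proof.
move=> h; elim: r => [|j r IH] /=; first by rewrite big_nil.
by rewrite big_cons; apply: lspan_cat.
Qed.

Lemma lspan_map (C : kalgType k) (N : lmodType C) (f : M -> N) : klinear f ->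
  forall s x, lspan s x -> lspan (map f s) (f x).
Proof.
move=> fl; elim=> [|b s IH] x /=; first by move=> ->; rewrite (klin0 fl).
by case=> c /IH; rewrite (klinD fl) (klinN fl) (klinZ fl) => h; exists c.
Qed.

Lemma fdim_lspan (s : seq M) : (forall x, lspan s x) -> fdim M.
Proof.
move=> h; exists (size s), (fun i => tnth (in_tuple s) i) => x; move: {h}x (h x).
elim: s => [|b s IH] x /=; first by move=> ->; exists (fun=> 0); rewrite big_ord0.
case=> c /IH[d dE]; exists (fun i => if unlift ord0 i is Some j then d j else c).
rewrite big_ord_recl unlift_none (tnth_nth 0) /= -[LHS](subrK (c *k: b)) dE addrC.
by congr (_ + _); apply: eq_bigr => i _; rewrite liftK !(tnth_nth 0).
Qed.
End Spans.

Section RightAlgebra.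
Variables (k : fieldType) (P : finType) (D : interlaced_weak_ditalgebra k P).
Local Notation T := (wd_T D).
Local Notation A := (Aalg D).
Local Notation Abar := (Abar D).
Local Notation V := (Vspace D).
Local Notation W0 := (wd_W0 D).
Local Notation W1 := (wd_W1 D).
Local Notation piA := (piA D).
Local Notation sA s := (piA (aS D s)).
Local Notation eb i := (sA (idem k i)).
Local Notation wb w := (piA (@a0 k P D w)).

Local Notation Gam := (Gamma D).
Local Notation "g ** f" := (Defs.comp g f) (at level 40, left associativity).
Implicit Types M N L K X Y : lmodType Abar.

(** * The ditalgebra and its modules *)

Lemma V_inj (u v : V) : sval u = sval v -> u = v.
Proof.
by case: u v => [x hx] [y hy] /= e; case: _ / e in hy *; congr exist; exact: Prop_irrelevance.
Qed.

Lemma A_homog (a : A) : homog T 0 (val a).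
Proof. exact/asboolP/(valP a). Qed.

Definition mkA x (hx : homog T 0 x) : A := exist _ x (introT (asboolP _) hx).

Lemma piA_surj (x : Abar) : exists a, x = piA a.
Proof. by exists (quo_repr x); rewrite -[LHS]quo_piK. Qed.

Lemma sAD s t : sA (s + t) = sA s + sA t.
Proof. by case: (piA_aS_hom D). Qed.
Lemma sAM s t : sA (s * t) = sA s * sA t.
Proof. by case: (piA_aS_hom D). Qed.
Lemma sA1 : sA 1 = 1.
Proof. by case: (piA_aS_hom D). Qed.
Lemma sAc c : sA (scalarS P c) = kin Abar c.
Proof. by case: (piA_aS_hom D). Qed.
Lemma sA0 : sA 0 = 0.
Proof.
rewrite -(rmorph0 (kin Abar)) -sAc; congr (piA (aS D _)).
Qed.

Lemma idemM i s : idem k i * s = scalarS P (s i) * idem k i.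
Proof.
apply/ffunP => j; rewrite !ffunE; case: eqP => [->|_]; first by rewrite mul1r mulr1.
by rewrite mul0r mulr0.
Qed.

Lemma idem_sum : \sum_i idem k i = 1 :> {ffun P -> k}.
Proof.
apply/ffunP => j; rewrite sum_ffunE (bigD1 j) //= ffunE eqxx big1 ?addr0 ?ffunE // => i ij.
by rewrite ffunE eq_sym (negPf ij).
Qed.

Lemma sA_eb s i : sA s * eb i = kin Abar (s i) * eb i.
Proof.
rewrite -sAM -sAc -sAM -idemM; congr (piA (aS D _)).
by apply/ffunP => j; rewrite !ffunE mulrC.
Qed.

Lemma eb_sA s i : eb i * sA s = kin Abar (s i) * eb i.
Proof. by rewrite -sAM idemM sAM sAc. Qed.

Lemma ebM i j : eb i * eb j = if i == j then eb i else 0.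
Proof.
rewrite sA_eb ffunE eq_sym; case: eqP => [->|_]; first by rewrite rmorph1 mul1r.
by rewrite rmorph0 mul0r.
Qed.

Lemma eb_sum : \sum_i eb i = 1.
Proof. by rewrite -sA1 -idem_sum (big_morph (fun s => sA s) sAD sA0). Qed.

Lemma a0_lactS s (w : W0) : a0 (lactS s w) = aS D s * a0 w.
Proof. by apply: val_inj => /=; case: (ta0_map T) => _ -> _. Qed.
Lemma a0_ractS s (w : W0) : a0 (ractS w s) = a0 w * aS D s.
Proof. by apply: val_inj => /=; case: (ta0_map T) => _ _ ->. Qed.
Lemma a0_lin c (v w : W0) : wb (c *: v + w) = kin Abar c * wb v + wb w.
Proof.
have -> : a0 (c *: v + w) = kin A c * a0 v + a0 w.
  by apply: val_inj => /=; case: (ta0_map T) => -> _ _.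
by rewrite rmorphD rmorphM.
Qed.
Lemma a00 : wb 0 = 0.
Proof. by have := a0_lin (-1) 0 0; rewrite scaleN1r addNr rmorphN1 mulN1r addNr. Qed.
Lemma a0_sum (J : Type) (r : seq J) (c : J -> k) (F : J -> W0) :
  wb (\sum_(j <- r) c j *: F j) = \sum_(j <- r) kin Abar (c j) * wb (F j).
Proof. by elim/big_rec2: _ => [|j x y _ e]; rewrite ?a00 ?a0_lin ?e. Qed.

Lemma wb_corner j i (w : W0) : wb (corner j i w) = eb j * wb w * eb i.
Proof. by rewrite a0_lactS a0_ractS !rmorphM mulrA. Qed.

Lemma corner_sum (W : sbimod k P) (w : W) : w = \sum_j \sum_i corner j i w.
Proof.
have lD (v : W) s t := lactSDl s t v; have rD := @ractSDr _ _ W.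
have l0 v : lactS 0 v = 0 :> W by apply: (@addIr _ (lactS 0 v)); rewrite -lD !add0r.
have r0 v : ractS v 0 = 0 :> W by apply: (@addIr _ (ractS v 0)); rewrite -rD !add0r.
have l00 s : lactS s 0 = 0 :> W.
  by apply: (@addIr _ (lactS s 0)); rewrite -lactSDr !add0r.
rewrite -{1}[w]lactS1 -idem_sum (big_morph (fun s => lactS s w) (lD w) (l0 w)).
apply: eq_bigr => j _; rewrite -{1}[w]ractS1 -idem_sum.
rewrite (big_morph (fun s => ractS w s) (rD w) (r0 w)).
by rewrite (big_morph (lactS (idem k j)) (fun v v' => lactSDr _ v v') (l00 _)).
Qed.

Lemma corner_peirce (W : sbimod k P) j i (w : W) : peirce W j i = 0%VS -> corner j i w = 0.
Proof.
by move=> p0; apply/eqP; rewrite -memv0 -p0 -[corner _ _ _](lfunE (@corner _ _ W j i)) memv_img ?memvf.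
Qed.

(** The elements whose left multiplication preserves [Q] form a subalgebra containing S and W0,
    hence are everything; apply them to 1. *)
Lemma Abar_ind (Q : Abar -> Prop) : Q 1 -> (forall x y, Q x -> Q y -> Q (x + y)) ->
  (forall s x, Q x -> Q (sA s * x)) -> (forall w x, Q x -> Q (wb w * x)) ->
  forall x, Q x.
Proof.
move=> Q1 QD QS QW x; have [a ->] := piA_surj x.
pose U (t : T) := exists a' : A, val a' = t /\ forall y, Q y -> Q (piA a' * y).
have [a' [aa' Qa']] : U (val a).
  apply: (@A_homog a U).
    split; first split.
    - exists 0; split=> // y Qy; rewrite rmorph0 -sA0; exact: QS.
    - move=> c _ _ [b [<- Qb]] [b' [<- Qb']]; exists (kin A c * b + b'); split=> // y Qy.
      rewrite rmorphD rmorphM mulrDl -mulrA; apply: QD; last exact: Qb'.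
      by rewrite [piA (kin A c)](_ : _ = kin Abar c) // -sAc; apply/QS/Qb.
    - by exists 1; split=> // y; rewrite rmorph1 mul1r.
    - move=> _ _ [b [<- Qb]] [b' [<- Qb']]; exists (b * b'); split=> // y Qy.
      by rewrite rmorphM -mulrA; apply/Qb/Qb'.
  move=> _ [[s _ <-]|[w _ <-]]; first by exists (aS D s); split=> //; exact: QS.
  by exists (a0 w); split=> //; exact: QW.
by rewrite -(val_inj aa') -[piA a']mulr1; exact: Qa'.
Qed.

Lemma V_ind (Q : V -> Prop) :
  (forall c (u v w : V), sval w = kin T c * sval u + sval v -> Q u -> Q v -> Q w) ->
  (forall (a b : A) w v, sval v = val a * ta1 T w * val b -> Q v) ->
  forall v, Q v.
Proof.
move=> QL QW v; pose U (t : T) := exists v' : V, sval v' = t /\ Q v'.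
have [v' [/V_inj <-]] : U (sval v); last by [].
apply: (homogS_ind (n := 0) (U := U) _ _ (svalP v)).
  have [S0 SL] : subspace (M := T^o) (homog T 1) by exact: kspan_subspace.
  split=> [|c _ _ [x [<- Qx]] [y [<- Qy]]].
    exists (exist _ _ S0); split=> //; apply: (QW 0 0 0); by rewrite !mul0r.
  exists (exist _ _ (SL c _ _ (svalP x) (svalP y))); split=> //.
  exact: (QL c x y).
move=> x w y hx hy.
have h : homog T 1 (x * ta1 T w * y) by apply: homogS_mulr => //; exact: homogS_gen.
by exists (exist _ _ h); split=> //; exact: (QW (mkA hx) (mkA hy) w).
Qed.

(** An S-bimodule map from [W] to Hom_k(M, N), uncurried. *)
Definition bimod_map (W : sbimod k P) (M N : lmodType Abar) (phi : W -> M -> N) : Prop :=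
  [/\ forall w, klinear (phi w),
      forall c v w m, phi (c *: v + w) m = c *k: phi v m + phi w m,
      forall s w m, phi (lactS s w) m = sA s *: phi w m
    & forall s w m, phi (ractS w s) m = phi w (sA s *: m)].

Lemma T_hom_ex (Y : lmodType Abar) (f0 : W0 -> Y -> Y) (f1 : W1 -> Y -> Y) :
  bimod_map f0 -> bimod_map f1 -> exists rho : T -> kend Y,
  [/\ kalg_hom (B := T) (C := kend_alg Y) rho,
      forall s y, kend_fun (rho (taS T s)) y = sA s *: y,
      forall w y, kend_fun (rho (ta0 T w)) y = f0 w y
    & forall w y, kend_fun (rho (ta1 T w)) y = f1 w y].
Proof.
move=> [l0 c0 s0 r0] [l1 c1 s1 r1].
pose s (x : {ffun P -> k}) : kend_alg Y := Kend (act_lin (Y := Y) (sA x)).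
pose g0 (w : W0) : kend_alg Y := Kend (l0 w); pose g1 (w : W1) : kend_alg Y := Kend (l1 w).
have hs : salg_map s.
  split=> [c||a b|a b]; apply: kend_ext => y /=.
  - by rewrite sAc.
  - by rewrite sA1 scale1r.
  - by rewrite sAD scalerDl.
  - by rewrite sAM scalerA.
have h0 : sbimod_map s g0 by split=> [c v w|a w|a w]; apply: kend_ext => y /=.
have h1 : sbimod_map s g1 by split=> [c v w|a w|a w]; apply: kend_ext => y /=.
have [rho [[rho_hom rhoS rho0 rho1] _]] := ta_univ T hs h0 h1.
by exists rho; split=> // [x|w|w] y; rewrite ?rhoS ?rho0 ?rho1.
Qed.

Lemma wb_bimod (M : lmodType Abar) : bimod_map (fun w (m : M) => wb w *: m).
Proof.
split=> [w|c v w m|s w m|s w m]; first exact: act_lin.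
- by rewrite a0_lin scalerDl -scalerA.
- by rewrite a0_lactS rmorphM scalerA.
- by rewrite a0_ractS rmorphM scalerA.
Qed.

Lemma rho_A (Y : lmodType Abar) (rho : T -> kend Y) :
  kalg_hom (B := T) (C := kend_alg Y) rho ->
  (forall s y, kend_fun (rho (taS T s)) y = sA s *: y) ->
  (forall w y, kend_fun (rho (ta0 T w)) y = wb w *: y) ->
  forall (a : A) y, kend_fun (rho (val a)) y = piA a *: y.
Proof.
move=> [rl r1 rM] rS r0 a.
pose U (t : T) := exists a' : A, val a' = t /\
  forall y, kend_fun (rho (val a')) y = piA a' *: y.
have [a' [/val_inj <-]] // : U (val a).
apply: (@A_homog a U).
  split; first split.
  - by exists 0; split=> // y; rewrite (klin0 rl) rmorph0 scale0r.
  - move=> c _ _ [b [<- bE]] [b' [<- bE']]; exists (kin A c * b + b'); split=> // y.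
    have -> : rho (val (kin A c * b + b')) = rho (c *k: (val b : T^o) + (val b' : T^o)) by [].
    by rewrite rl /= bE bE' rmorphD rmorphM scalerDl -scalerA.
  - by exists 1; split=> // y; rewrite r1 rmorph1 scale1r.
  - move=> _ _ [b [<- bE]] [b' [<- bE']]; exists (b * b'); split=> // y.
    by rewrite rM /= bE' bE rmorphM scalerA.
move=> _ [[s _ <-]|[w _ <-]]; first by exists (aS D s); split=> // y; exact: rS.
by exists (a0 w); split=> // y; exact: r0.
Qed.

Section Morphisms.
Variables M N : lmodType Abar.
Implicit Types f g : mor M N.

Lemma mor1_bimod_map f : bimod_map (fun w => mor1 f (v1 w)).
Proof.
split=> [w|c v w m|s w m|s w m]; first exact: mor1_lin.
- by apply: mor1_linV => /=; case: (ta1_map T) => -> _ _.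
- rewrite (@mor1_bimod _ _ _ _ _ f (aS D s) 1 (v1 w)) ?rmorph1 ?scale1r //=.
  by case: (ta1_map T) => _ -> _; rewrite mulr1.
- rewrite (@mor1_bimod _ _ _ _ _ f 1 (aS D s) (v1 w)) ?rmorph1 ?scale1r //=.
  by case: (ta1_map T) => _ _ ->; rewrite mul1r.
Qed.

Lemma mor1_eq f g : (forall w m, mor1 f (v1 w) m = mor1 g (v1 w) m) ->
  forall v m, mor1 f v m = mor1 g v m.
Proof.
move=> fg; apply: V_ind => [c u v w e uE vE m|a b w v e m].
  by rewrite !(mor1_linV _ _ e) uE vE.
by rewrite !(@mor1_bimod _ _ _ _ _ _ a b (v1 w) v) // fg.
Qed.

Lemma mor_eq f g : (forall m, mor0 f m = mor0 g m) ->
  (forall w m, mor1 f (v1 w) m = mor1 g (v1 w) m) -> f = g.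
Proof. by move=> e0 e1; apply: mor_ext => //; exact: mor1_eq. Qed.

Lemma mor1_eq0 f : (forall w m, mor1 f (v1 w) m = 0) -> forall v m, mor1 f v m = 0.
Proof. exact: (mor1_eq (g := mor_zero M N)). Qed.

(** The differential vanishes on S, so the compatibility of f^0 with f^1 reduces to S-linearity. *)
Lemma mor0_S f s m : mor0 f (sA s *: m) = sA s *: mor0 f m.
Proof.
have v0 : homog T 1 0 by exact: (kspan_subspace (M := T^o) _).1.
rewrite (@mor_compat _ _ _ _ _ f (aS D s) (exist _ 0 v0)) /= ?wd_d_S //.
have -> : mor1 f (exist _ 0 v0) m = 0; last by rewrite addr0.
rewrite (@mor1_bimod _ _ _ _ _ f 0 0 (exist _ 0 v0)) /= ?mul0r //.
by rewrite rmorph0 scale0r.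
Qed.

Lemma mor0_compat f (a : A) m : piA a *: mor0 f m = mor0 f (piA a *: m) + mor1 f (dA a) m.
Proof. exact: mor_compat. Qed.

Definition linear_mor0 f (f1 : forall v m, mor1 f v m = 0) : {linear M -> N}.
Proof.
apply: (linear_of (f := mor0 f)) => a x y; have [b ->] := piA_surj a.
by rewrite mor0D mor0_compat f1 addr0.
Defined.

Lemma strict_linear_mor0 f (f1 : forall v m, mor1 f v m = 0) :
  f = strict_mor (linear_mor0 f1).
Proof. exact: mor_ext. Qed.
End Morphisms.

Lemma lower_bimod_map (W : sbimod k P) (M N : lmodType Abar) (phi : W -> M -> N) : bimod_map phi ->
  bimod_map (fun w (y : (M * N)%type) => (0, phi w y.1) : (M * N)%type).
Proof.
move=> [pl pc ps pr].
by split=> [w c x y|c v w m|s w m|s w m]; rewrite ?kscale_pair /= ?pl ?pc ?ps ?pr;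
  congr pair; rewrite /kscale /= ?scaler0 ?addr0.
Qed.

(* The extension of phi to V kills d(I), which lies in I V + V I.             *)
Lemma extend_W1 (M N : lmodType Abar) (phi : W1 -> M -> N) : bimod_map phi ->
  exists F : T -> M -> N,
  [/\ [/\ forall t, klinear (F t), forall c x y m, F (kin T c * x + y) m = c *k: F x m + F y m
        & forall (a b : A) x m, F (val a * x * val b) m = piA a *: F x (piA b *: m)],
      forall w m, F (ta1 T w) m = phi w m
    & forall x m, wd_I (w := D) x -> F (wd_d (w := D) x) m = 0].
Proof.
move=> phib; pose Y : lmodType Abar := (M * N)%type; have b1 := lower_bimod_map phib.
(* W0 acts diagonally on M * N and W1 by the off-diagonal block [phi]; the extension sought is the
   off-diagonal block of [rho]. *)
have [rho [rh rS r0 r1]] := T_hom_ex (wb_bimod Y) b1.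
have rA := rho_A rh rS r0; have [rl r_1 rM] := rh.
exists (fun t m => (kend_fun (rho t) (m, 0)).2); split; first split.
- move=> t c x y; rewrite (_ : (c *k: x + y, 0) = c *k: (x, 0) + (y, 0) :> Y).
    by rewrite (kend_lin (rho t)) kscale_pair.
  by congr pair; rewrite /= scaler0 addr0.
- by move=> c x y m; rewrite -[kin T c * x]/(c *k: (x : T^o)) rl.
- move=> a b x m; rewrite !rM /= !rA.
  by have -> : piA b *: ((m, 0) : Y) = (piA b *: m, 0) by congr pair; rewrite /= scaler0.
- by move=> w m; rewrite r1.
move=> x m; have [h _ _] := iwd_interlaced D; move/h => dx.
suff -> : rho (wd_d (w := D) x) = 0 by [].
move: dx; apply: (rho0_add rh); first by apply: (rho0_mull rh); exact: rho0_I rA.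
by apply: (rho0_mulr rh); exact: rho0_I rA.
Qed.

Lemma bimod_map0 (W : sbimod k P) M N (phi : W -> M -> N) m : bimod_map phi -> phi 0 m = 0.
Proof. by case=> _ h _ _; have := h (-1) 0 0 m; rewrite scaleN1r addNr kscaleN1 addNr. Qed.

Lemma bimod_map_sum (W : sbimod k P) M N (phi : W -> M -> N) (J : Type) (r : seq J)
    (c : J -> k) (w : J -> W) m : bimod_map phi ->
  phi (\sum_(j <- r) c j *: w j) m = \sum_(j <- r) c j *k: phi (w j) m.
Proof.
move=> h; elim/big_rec2: _ => [|j x y _ <-]; first exact: bimod_map0.
by case: h => _ -> _ _.
Qed.

Lemma bimod_map_corner M N (W : sbimod k P) (phi : W -> M -> N) w m j i : bimod_map phi ->
  phi (corner j i w) m = eb j *: phi w (eb i *: m).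
Proof. by case=> _ _ hs hr; rewrite /corner hs hr. Qed.

Lemma corner_lactS (W : sbimod k P) j i s (w : W) : corner j i (lactS s w) = s j *: corner j i w.
Proof. by rewrite /corner -lractS -lactSM idemM lactSM lactSc. Qed.

Lemma corner_ractS (W : sbimod k P) j i s (w : W) : corner j i (ractS w s) = s i *: corner j i w.
Proof.
rewrite /corner -ractSM (_ : s * idem k i = idem k i * scalarS P (s i)); last first.
  by apply/ffunP => l; rewrite !ffunE; case: eqP => [->|_]; rewrite ?mulr1 ?mul1r ?mulr0 ?mul0r.
by rewrite ractSM ractSc -[in LHS]lactSc -lactSM -lactSc -lactSM; congr lactS;
  apply/ffunP => l; rewrite !ffunE mulrC.
Qed.

Lemma comp_strictl M N L (p : {linear N -> L}) (f : mor M N) v m :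
  mor1 (strict_mor p ** f) v m = p (mor1 f v m).
Proof. by rewrite /= /comp1 /= big1 // !addr0. Qed.

Lemma comp_strictr M N L (g : mor N L) (p : {linear M -> N}) v m :
  mor1 (g ** strict_mor p) v m = mor1 g v (p m).
Proof. by rewrite /= /comp1 /= mor00 add0r big1 ?addr0 // => q _; rewrite mor10. Qed.

Lemma mor0_comp M N L (g : mor N L) (f : mor M N) m : mor0 (g ** f) m = mor0 g (mor0 f m).
Proof. by []. Qed.

Lemma mor0_zero M N m : mor0 (0 : mor M N) m = 0. Proof. by []. Qed.
Lemma mor1_zero M N v m : mor1 (0 : mor M N) v m = 0. Proof. by []. Qed.

Lemma comp0f M N L (f : mor M N) : (0 : mor N L) ** f = 0.
Proof. by apply: (@addIr _ ((0 : mor N L) ** f)); rewrite -compDl !add0r. Qed.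

Lemma mor0_sumf M N (J : Type) (r : seq J) (F : J -> mor M N) m :
  mor0 (\sum_(j <- r) F j) m = \sum_(j <- r) mor0 (F j) m.
Proof. by rewrite (big_morph (fun f => mor0 f m) (fun f g => mor0_add f g m) (mor0_zero _ m)). Qed.
Lemma mor1_sumf M N (J : Type) (r : seq J) (F : J -> mor M N) v m :
  mor1 (\sum_(j <- r) F j) v m = \sum_(j <- r) mor1 (F j) v m.
Proof. by rewrite (big_morph (fun f => mor1 f v m) (fun f g => mor1_add f g v m) (mor1_zero _ v m)). Qed.

(* Fmod N, and FG N as a Gamma-module, is Hom(A/I, N) in A-mod; tensor_FG     *)
(* identifies it with Gamma (x) N.                                            *)
Definition Fmod N : Type := mor Abar^o N.
HB.instance Definition _ N := GRing.Zmodule.on (Fmod N).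
Definition Fscale N (g : Gam) (f : Fmod N) : Fmod N := f ** (g : mor Abar^o Abar^o).
Fact FscaleA N (a b : Gam) (f : Fmod N) : Fscale a (Fscale b f) = Fscale (a * b) f.
Proof. by rewrite /Fscale comp_assoc. Qed.
Fact Fscale1 N : left_id (1 : Gam) (@Fscale N).
Proof. by move=> f; exact: comp_idr. Qed.
Fact FscaleDr N : right_distributive (@Fscale N) +%R.
Proof. by move=> a f g; exact: compDl. Qed.
Fact FscaleDl N (f : Fmod N) : {morph (@Fscale N)^~ f : a b / a + b}.
Proof. by move=> a b; exact: compDr. Qed.
HB.instance Definition _ N := GRing.Zmodule_isLmodule.Build Gam (Fmod N)
  (@FscaleA N) (@Fscale1 N) (@FscaleDr N) (@FscaleDl N).
Definition FG N : lmodType Gam := Fmod N.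

Fact Fmap_linear M N (f : mor M N) : linear (fun x : FG M => f ** x : FG N).
Proof. by move=> a x y; rewrite compDr; congr (_ + _); exact/esym/comp_assoc. Qed.
Definition Fmap M N (f : mor M N) : {linear FG M -> FG N} := linear_of (Fmap_linear f).

Lemma mor1_Fmap_strict M N (p : {linear M -> N}) (x : FG M) v m :
  mor1 (Fmap (strict_mor p) x : mor _ _) v m = p (mor1 (x : mor _ _) v m).
Proof. exact: comp_strictl. Qed.

Fact orbit_linear N (n : N) : linear (fun a : Abar^o => (a : Abar) *: n).
Proof. by move=> a x y; rewrite scalerDl scalerA. Qed.
Definition orbit_mor N (n : N) : mor Abar^o N := strict_mor (linear_of (orbit_linear n)).

Lemma comp_orbitl M N (n : N) (f : mor M Abar^o) v m :
  mor1 (orbit_mor n ** f) v m = (mor1 f v m : Abar) *: n.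
Proof. exact: comp_strictl. Qed.

Lemma comp_orbit M N (p : {linear M -> N}) m : strict_mor p ** orbit_mor m = orbit_mor (p m).
Proof.
apply: mor_ext => [a|v a]; first by rewrite mor0_comp /= linearZ.
by rewrite comp_strictl /= linear0.
Qed.

Lemma orbit_morZ M (a : Abar) (m : M) : orbit_mor (a *: m) = orbit_mor m ** iotaG a.
Proof.
apply: mor_ext => [b|v b]; first by rewrite mor0_comp /= scalerA.
by rewrite comp_strictr.
Qed.

Lemma orbit_morD M (m n : M) : orbit_mor (m + n) = orbit_mor m + orbit_mor n.
Proof. by apply: mor_ext => [b|v b]; rewrite ?mor0_add ?mor1_add /= ?scalerDr ?addr0. Qed.

(** Compatibility forces f^0(a) = a f^0(1) - f^1(d a)(1), and f^1 is determined by its restriction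
    to W1. *)
Lemma mor_regular_eq N (f g : mor Abar^o N) : mor0 f 1 = mor0 g 1 ->
  (forall w x, mor1 f (v1 w) x = mor1 g (v1 w) x) -> f = g.
Proof.
move=> e0 /mor1_eq e1; apply: mor_ext => // m; have [a ->] := piA_surj m.
have E (h : mor Abar^o N) : mor0 h (piA a) = piA a *: mor0 h 1 - mor1 h (dA a) 1.
  by rewrite mor0_compat addrK; congr (mor0 h _); rewrite /GRing.scale /= mulr1.
by rewrite !E e0 e1.
Qed.

(** Define f^0 by the formula that compatibility forces. It is well defined on A/I because the
    extension of [phi] kills d(I), and the Leibniz rule gives the compatibility. *)
Lemma mor_regular_ex N (n : N) (phi : W1 -> Abar^o -> N) : bimod_map phi ->
  exists f : mor Abar^o N, mor0 f 1 = n /\ forall w x, mor1 f (v1 w) x = phi w x.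
Proof.
move=> /extend_W1[G [[Gl GT Gb] GW GI]].
have G0 x : G 0 x = 0.
  by have := Gb 0 0 0 x; rewrite !mul0r rmorph0 scale0r.
have GD x y m : G (x + y) m = G x m + G y m.
  by have := GT 1 x y m; rewrite rmorph1 mul1r kscale1.
have GN x m : G (- x) m = - G x m.
  by have := GT (-1) x 0 m; rewrite rmorphN1 mulN1r addr0 G0 addr0 kscaleN1.
pose dd (a : A) : T := wd_d (w := D) (val a).
have ddL c (a b : A) : dd (kin A c * a + b) = kin T c * dd a + dd b.
  exact: (@wd_d_linear _ _ D c (val a) (val b)).
pose f0 (x : Abar^o) : N := (x : Abar) *: n - G (dd (quo_repr (x : Abar))) 1.
have f0E a : f0 (piA a) = piA a *: n - G (dd a) 1.
  rewrite /f0; congr (_ - _); set a' := quo_repr _.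
  have Ia : wd_I (w := D) (val (a' - a)) by apply/(quo_eq (I_ideal D)); rewrite quo_piK.
  apply/subr0_eq; rewrite -GN -GD; have := GI _ 1 Ia.
  have -> // : wd_d (w := D) (val (a' - a)) = dd a' - dd a.
  have e := ddL (-1) a a'; rewrite !rmorphN1 !mulN1r in e.
  rewrite [RHS]addrC -e /dd; congr (wd_d (val _)); exact: addrC.
have f0l : klinear f0.
  move=> c x y; have [a ->] := piA_surj x; have [b ->] := piA_surj y.
  have -> : c *k: (piA a : Abar^o) + piA b = piA (kin A c * a + b) by rewrite rmorphD rmorphM.
  rewrite !f0E ddL GD -[kin T c * dd a]addr0 GT G0 addr0 rmorphD rmorphM scalerDl -scalerA.
  by rewrite kscaleDr /kscale scalerN opprD addrACA.
have f1L c (u v w : V) m : sval w = kin T c * sval u + sval v ->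
    G (sval w) m = c *k: G (sval u) m + G (sval v) m by move=> ->.
have f1B (a b : A) (v w : V) m : sval w = val a * sval v * val b ->
    G (sval w) m = piA a *: G (sval v) (piA b *: m) by move=> ->.
have cpt (a : A) (v : V) m : sval v = wd_d (w := D) (val a) ->
    piA a *: f0 m = f0 (piA a *: m) + G (sval v) m.
  move=> ->; have [b ->] := piA_surj m.
  have -> : piA a *: (piA b : Abar^o) = piA (a * b) by rewrite rmorphM.
  rewrite !f0E /dd (wd_d_leibniz _ (A_homog a)) expr0 mul1r GD.
  have -> : G (wd_d (w := D) (val a) * val b) 1 = G (wd_d (w := D) (val a)) (piA b).
    have := Gb 1 b (wd_d (w := D) (val a)) 1; rewrite mul1r rmorph1 scale1r => ->.
    by congr (G _ _); exact: mulr1.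
  have -> : G (val a * wd_d (w := D) (val b)) 1 = piA a *: G (wd_d (w := D) (val b)) 1.
    by have := Gb a 1 (wd_d (w := D) (val b)) 1; rewrite mulr1 rmorph1 scale1r.
  by rewrite rmorphM scalerBr scalerA opprD addrA addrAC subrK.
exists (Mor f0l (fun v : V => Gl (sval v)) f1L f1B cpt); split=> [|w x]; last exact: GW.
have := f0E 1; rewrite rmorph1 scale1r => h; rewrite [LHS]h /dd.
have -> : wd_d (w := D) (val (1 : A)) = 0; last by rewrite G0 subr0.
by rewrite -[val (1 : A)](_ : taS T 1 = _) ?wd_d_S //; case: (taS_hom T).
Qed.

(** * Deformation of module structures and splitting of idempotents *)

Lemma fst_klin M N c (p q : (M * N)%type) : (c *k: p + q).1 = c *k: p.1 + q.1.
Proof. by []. Qed.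
Lemma snd_klin M N c (p q : (M * N)%type) : (c *k: p + q).2 = c *k: p.2 + q.2.
Proof. by []. Qed.
Lemma kpairD0 M N c (x y : M) : (c *k: x + y, 0) = c *k: (x, 0) + (y, 0) :> (M * N)%type.
Proof. by congr pair; rewrite /= scaler0 addr0. Qed.
Lemma pairD0 M N (x y : M) : (x + y, 0) = (x, 0) + (y, 0) :> (M * N)%type.
Proof. by congr pair; rewrite /= addr0. Qed.

(* The A-module structure of N = M is built on W0 by fixed point iteration:   *)
(* a acts as a + f1(d a), where the extension f1 of phi to V involves the new *)
(* action.  rho packs both actions and f1 as block triangular matrices, and   *)
(* the iteration is stationary along the filtration of W0.                    *)
Lemma deformation_hom M (phi : W1 -> M -> M) : bimod_map phi ->
  exists rho : T -> kend (M * M)%type,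
  [/\ kalg_hom (B := T) (C := kend_alg (M * M)%type) rho,
      forall s y, kend_fun (rho (taS T s)) y = sA s *: y,
      forall w y, kend_fun (rho (ta1 T w)) y = (0, phi w y.1)
    & forall w y, kend_fun (rho (ta0 T w)) y = (wb w *: y.1,
        wb w *: y.2 + (kend_fun (rho (wd_d (w := D) (ta0 T w))) (y.2, 0)).2)].
Proof.
move=> phib; set Y : lmodType Abar := (M * M)%type.
have b1 := lower_bimod_map phib.
pose good (rho : T -> kend Y) := [/\ kalg_hom (B := T) (C := kend_alg Y) rho,
  forall s y, kend_fun (rho (taS T s)) y = sA s *: y
  & forall w y, kend_fun (rho (ta1 T w)) y = (0, phi w y.1)].
pose dd w : T := wd_d (w := D) (ta0 T w).
have [t0l t0s t0r] := ta0_map T.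
have hS s : homog T 0 (taS T s) by exact: (A_homog (aS D s)).
have ddl c v w : dd (c *: v + w) = kin T c * dd v + dd w.
  by rewrite /dd t0l; exact: (@wd_d_linear _ _ D).
have dds s w : dd (lactS s w) = taS T s * dd w.
  by rewrite /dd t0s (wd_d_leibniz _ (hS s)) wd_d_S mul0r add0r mul1r.
have ddr s w : dd (ractS w s) = dd w * taS T s.
  by rewrite /dd t0r (wd_d_leibniz _ (homog_ta0 w)) wd_d_S !mulr0 addr0.
(* One iteration: the second copy of [M] receives the old action of w corrected by the off-diagonal
   block of d(w), computed with the previous [rho]. *)
have step (r : {rho | good rho}) : exists r' : {rho | good rho}, forall w y,
    kend_fun (sval r' (ta0 T w)) y = (wb w *: y.1, wb w *: y.2 + (kend_fun (sval r (dd w)) (y.2, 0)).2).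
  case: r => rho [[rl r_1 rM] rS r1] /=.
  have [|r' [h1 h2 h3 h4]] := @T_hom_ex Y (fun w y =>
      (wb w *: y.1, wb w *: y.2 + (kend_fun (rho (dd w)) (y.2, 0)).2)) _ _ b1.
  - split=> [w c x y|c v w y|s w y|s w y].
    + change ((wb w *: (c *k: x.1 + y.1),
        wb w *: (c *k: x.2 + y.2) + (kend_fun (rho (dd w)) (c *k: x.2 + y.2, 0)).2) =
        (c *k: (wb w *: x.1) + wb w *: y.1, c *k: (wb w *: x.2 + (kend_fun (rho (dd w)) (x.2, 0)).2) +
          (wb w *: y.2 + (kend_fun (rho (dd w)) (y.2, 0)).2))).
      rewrite kpairD0 kend_lin !scalerDr -!kscale_scale; congr pair.
      by rewrite kscaleDr addrACA.
    + change ((wb (c *: v + w) *: y.1, wb (c *: v + w) *: y.2 + (kend_fun (rho (dd (c *: v + w))) (y.2, 0)).2) =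
        (c *k: (wb v *: y.1) + wb w *: y.1, c *k: (wb v *: y.2 + (kend_fun (rho (dd v)) (y.2, 0)).2) +
          (wb w *: y.2 + (kend_fun (rho (dd w)) (y.2, 0)).2))).
      rewrite ddl -[kin T c * dd v]/(c *k: (dd v : T^o)) rl a0_lin !scalerDl -!scalerA; congr pair.
      by rewrite kscaleDr addrACA.
    + change ((wb (lactS s w) *: y.1, wb (lactS s w) *: y.2 + (kend_fun (rho (dd (lactS s w))) (y.2, 0)).2) =
        (sA s *: (wb w *: y.1), sA s *: (wb w *: y.2 + (kend_fun (rho (dd w)) (y.2, 0)).2))).
      rewrite dds rM a0_lactS rmorphM -!scalerA scalerDr; congr (_, _ + _).
      by rewrite [kend_fun _ _]rS.
    change ((wb (ractS w s) *: y.1, wb (ractS w s) *: y.2 + (kend_fun (rho (dd (ractS w s))) (y.2, 0)).2) =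
        (wb w *: (sA s *: y.1), wb w *: (sA s *: y.2) + (kend_fun (rho (dd w)) (sA s *: y.2, 0)).2)).
    rewrite ddr rM a0_ractS rmorphM -!scalerA; congr (_, _ + _).
    rewrite -[kend_fun (rho (dd w) * _) _]/(kend_fun (rho (dd w)) (kend_fun (rho (taS T s)) (y.2, 0))) rS.
    by congr ((kend_fun _ (_, _)).2); exact: scaler0.
  by exists (exist _ r' (And3 h1 h2 h4)).
have [nx nxE] := choice step.
have [rho0 [h1 h2 _ h4]] := T_hom_ex (wb_bimod Y) b1.
pose R n := sval (iter n nx (exist _ rho0 (And3 h1 h2 h4))).
have RP n : good (R n) by exact: svalP.
have RS n w y : kend_fun (R n.+1 (ta0 T w)) y =
  (wb w *: y.1, wb w *: y.2 + (kend_fun (R n (dd w)) (y.2, 0)).2) by exact: nxE.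
have [[r [Fl [F0 Fr _ FS]]] _] := iwd_layer D.
(* Consecutive iterates that agree on the n-th layer agree on A_n W1 A_n, which contains d of the
   next layer; the following iterates then agree on that layer. *)
have agree n w : (n <= r)%N -> w \in Fl n -> R n (ta0 T w) = R n.+1 (ta0 T w).
  elim: n w => [|n IH] w nr wF.
    move: wF; rewrite F0 memv0 => /eqP->.
    have z0 : ta0 T 0 = 0 by have := t0l (-1) 0 0; rewrite scaleN1r addNr rmorphN1 mulN1r addNr.
    have [[l0 _ _] _ _] := RP 0%N; have [[l1 _ _] _ _] := RP 1%N.
    by rewrite z0 (klin0 l0) (klin0 l1).
  have [_ /(_ w wF) dw] := FS n nr.
  have [[l0 u0 m0] s0 v0] := RP n; have [[l1 u1 m1] s1 v1] := RP n.+1.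
  pose E t := R n t = R n.+1 t.
  have Ess : subspace (M := T^o) E.
    split=> [|c x y ex ey]; rewrite /E; first by rewrite (klin0 l0) (klin0 l1).
    by rewrite l0 l1 ex ey.
  have EM x y : E x -> E y -> E (x * y) by rewrite /E m0 m1 => -> ->.
  have Esub : subalgebra (B := T) E by split=> //; rewrite /E u0 u1.
  have EA x : subalg_of_W0 T (Fl n) x -> E x.
    move=> hx; apply: (hx E Esub) => _ [[s _ <-]|[u uF <-]].
      by apply: kend_ext => y; rewrite s0 s1.
    by apply: IH => //; exact: ltnW.
  have EW x : W1_set T fullv x -> E x.
    by case=> u _ <-; apply: kend_ext => y; rewrite v0 v1.
  have Edw : E (dd w).
    apply: (val_mulset Ess _ dw) => x y hx /EA ey; apply: (EM _ _ _ ey).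
    by apply: (val_mulset Ess _ hx) => x' y' /EA ex' /EW ey'; exact: EM.
  by apply: kend_ext => y; rewrite !RS Edw.
have [Rh RS0 R1] := RP r; exists (R r); split=> // w y.
by rewrite agree ?RS // Fr memvf.
Qed.

(** The lower diagonal block of the fixed point is the new action on the space [M], and its
    off-diagonal block is h^1, with h^0 the identity of that space. What remains is that the new
    action kills I. *)
Lemma deformation M (phi : W1 -> M -> M) : bimod_map phi ->
  exists N (h : mor M N), bijective (mor0 h) /\
    forall w m, mor1 h (v1 w) m = mor0 h (phi w m).
Proof.
move=> phib; have [rho [[rl r_1 rM] rS r1 r0]] := deformation_hom phib.
have rD x y z : kend_fun (rho (x + y)) z = kend_fun (rho x) z + kend_fun (rho y) z.
  by rewrite (klinD rl).
have rZ c x z : kend_fun (rho (kin T c * x)) z = c *k: kend_fun (rho x) z.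
  by rewrite -[kin T c * x]/(c *k: (x : T^o)) (klinZ rl).
have rc t := klinD (kend_lin (rho t)).
have rk t := klinZ (kend_lin (rho t)).
have p0 (x : M) : kend_fun (rho 0) (x, 0) = 0 by rewrite (klin0 rl).
have r00 t : kend_fun (rho t) (0, 0) = 0 by exact: (klin0 (kend_lin (rho t))).
pose diag (a : A) := (forall y, (kend_fun (rho (val a)) y).1 = piA a *: y.1) /\
  (forall x, (kend_fun (rho (val a)) (x, 0)).2 = 0).
have dM (a b : A) : diag a -> diag b -> diag (a * b).
  move=> [a1 a2] [b1 b2]; split=> [y|x]; rewrite rM /=; first by rewrite a1 b1 rmorphM scalerA.
  by rewrite [kend_fun (rho (val b)) _]surjective_pairing b2 a2.
have A_alg (Q : A -> Prop) : (forall s, Q (aS D s)) -> (forall w, Q (a0 w)) ->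
    (forall c a b, Q a -> Q b -> Q (kin A c * a + b)) -> (forall a b, Q a -> Q b -> Q (a * b)) ->
    forall a, Q a.
  move=> QS QW QL QM a; pose U (t : T) := exists a' : A, val a' = t /\ Q a'.
  have [a' [/val_inj <-]] // : U (val a).
  have Q1 : Q 1 by rewrite (_ : 1 = aS D 1) //; apply: val_inj => /=; case: (taS_hom T).
  apply: (@A_homog a U).
    split; first split.
    - by exists 0; split=> //; have := QL (-1) 1 1 Q1 Q1; rewrite rmorphN1 mulN1r addNr.
    - by move=> c _ _ [b [<- Qb]] [b' [<- Qb']]; exists (kin A c * b + b'); split=> //; exact: QL.
    - by exists 1.
    - by move=> _ _ [b [<- Qb]] [b' [<- Qb']]; exists (b * b'); split=> //; exact: QM.
  by move=> _ [[s _ <-]|[w _ <-]]; [exists (aS D s)|exists (a0 w)].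
have dA a : diag a.
  move: a; apply: A_alg => [s|w|c a b [a1 a2] [b1 b2]|]; last exact: dM.
  - by split=> [y|x]; rewrite rS //= scaler0.
  - by split=> [y|x]; rewrite r0 //= scaler0 add0r r00.
  split=> [y|x]; rewrite rD rZ ?fst_klin ?snd_klin; last by rewrite a2 b2 kscaler0 addr0.
  by rewrite a1 b1 rmorphD rmorphM scalerDl -scalerA.
pose act (a : A) (y : M) := (kend_fun (rho (val a)) (0, y)).2.
have rA a y : kend_fun (rho (val a)) y = (piA a *: y.1, act a y.2).
  rewrite [LHS]surjective_pairing (dA a).1; congr pair.
  transitivity (kend_fun (rho (val a)) ((y.1, 0) + (0, y.2))).2; last by rewrite rc /= (dA a).2 add0r.
  congr (kend_fun _ _).2.
  by rewrite [LHS]surjective_pairing; congr pair; rewrite /= ?addr0 ?add0r.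
have rV (v : V) : (forall y, (kend_fun (rho (sval v)) y).1 = 0) /\
    forall y, kend_fun (rho (sval v)) (0, y) = 0.
  move: v; apply: V_ind => [c u v w -> [u1 u2] [v1 v2]|a b w v -> ].
    split=> y; rewrite rD rZ; first by rewrite fst_klin u1 v1 kscaler0 addr0.
    by rewrite u2 v2 addr0 kscaler0.
  have ph0 : phi w 0 = 0 by case: phib => /(_ w) h _ _ _; exact: klin0 h.
  have e y : kend_fun (rho (val a * ta1 T w * val b)) y = (0, act a (phi w (piA b *: y.1))).
    by rewrite !rM /= !rA /= !r1 /= scaler0.
  split=> y; rewrite e //=; congr pair; by rewrite scaler0 ph0 /act r00.
(* The fixed point equation, known on W0, spreads to all of A by the Leibniz rule. *)
have actE a y : act a y = piA a *: y + (kend_fun (rho (wd_d (w := D) (val a))) (y, 0)).2.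
  move: a y; apply: A_alg => [s|w|c a b ea eb|a b ea eb] y.
  - by rewrite /act rS /= wd_d_S p0 addr0.
  - by rewrite /act r0.
  - rewrite {1}/act rD rZ snd_klin -/(act a y) -/(act b y) ea eb.
    have -> : wd_d (w := D) (val (kin A c * a + b)) =
        kin T c * wd_d (w := D) (val a) + wd_d (w := D) (val b) by exact: (@wd_d_linear _ _ D).
    by rewrite rD rZ snd_klin rmorphD rmorphM scalerDl -scalerA kscaleDr addrACA.
  rewrite {1}/act rM /= rA /= -/(act b y) (wd_d_leibniz _ (A_homog a)) expr0 mul1r rD !rM /= !rA /=.
  have [_ rd0] := rV (Defs.dA a); have [rd1 _] := rV (Defs.dA b).
  set z := kend_fun (rho (wd_d (w := D) (val b))) (y, 0).
  rewrite eb -/z; have -> : act b 0 = 0 by rewrite /act r00.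
  rewrite ea scalerDr rmorphM scalerA -!addrA; congr (_ + _).
  by rewrite pairD0 rc ea [RHS]addrC -addrA; congr (_ + _); exact: addrC.
(* Induction along the triangular filtration of I. On the next layer the old action is zero, so only
   the block of d(a), in A H V + V H A, is left. In A H V the factor from H meets the new action,
   zero by induction; in V H A it meets the old one, zero because H lies in I. *)
have actI a y : wd_I (w := D) (val a) -> act a y = 0.
  have [t [H [H0 Ht _ HS]]] := iwd_I_triangular D.
  have HI i x : (i <= t)%N -> H i x -> wd_I (w := D) x.
    move=> it; rewrite -Ht; move: it => /subnKC; move: (t - i)%N => n.
    elim: n i => [|n IH] i it Hx; first by rewrite -it addn0.
    have ilt : (i < t)%N by rewrite -it -addSnnS leq_addr.
    by apply: (IH i.+1); [rewrite addSnnS|apply: (HS i ilt).1].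
  suff: forall i, (i <= t)%N -> forall a, H i (val a) -> forall y, act a y = 0.
    by move=> h; rewrite -Ht => ha; exact: (h t (leqnn t)).
  elim=> [_ b Hb|i IH it b Hb] {}y.
    by move: Hb; rewrite H0 /act => ->; rewrite (klin0 rl).
  have piA0 (x : A) : wd_I (w := D) (val x) -> piA x = 0.
    by move=> Ix; rewrite -(rmorph0 piA); apply/quo_eq; rewrite subr0.
  rewrite actE piA0; last exact: HI Hb.
  rewrite scale0r add0r; have [_ /(_ _ Hb)] := HS i it; move: (wd_d _) => x.
  have Z1 (a' h : A) (v : V) y' : H i (val h) -> kend_fun (rho (val a' * val h * sval v)) (y', 0) = 0.
    move=> hh; have [v1 _] := rV v.
    rewrite !rM /= !rA /= v1 (IH (ltnW it) _ hh).
    by congr pair; rewrite ?scaler0 // /act r00.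
  pose Q (x : T) := forall y, kend_fun (rho x) (y, 0) = 0.
  have Qs : subspace (M := T^o) Q.
    split=> [|c u v Qu Qv] y'; first by rewrite p0.
    by rewrite rl /= Qu Qv kscaler0 addr0.
  case=> [x1 [x2 [h1 h2 ->]]]; rewrite rD.
  have -> : kend_fun (rho x1) (y, 0) = 0.
    move: y; change (Q x1); move: h1; apply: (val_mulset Qs) => u v hu hv.
    pose Qv (u : T) := Q (u * v).
    apply: (@val_mulset _ _ _ _ _ Qv _ _ u hu).
      split=> [|c u1 u2 q1 q2]; rewrite /Qv; first by rewrite mul0r; exact: Qs.1.
      by rewrite mulrDl; have := Qs.2 c _ _ q1 q2; rewrite /kscale /GRing.scale /= mulrA.
    move=> a' h ha' hh y'.
    have hh0 : homog T 0 h by apply: wd_I_sub; apply: (HI i) => //; exact: ltnW.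
    exact: (Z1 (mkA ha') (mkA hh0) (exist _ v hv)).
  have -> : kend_fun (rho x2) (y, 0) = 0; last by rewrite addr0.
  move: y; change (Q x2); move: h2; apply: (val_mulset Qs) => u v hu hv.
  pose Qv (u : T) := Q (u * v).
  apply: (@val_mulset _ _ _ _ _ Qv _ _ u hu).
    split=> [|c u1 u2 q1 q2]; rewrite /Qv; first by rewrite mul0r; exact: Qs.1.
    by rewrite mulrDl; have := Qs.2 c _ _ q1 q2; rewrite /kscale /GRing.scale /= mulrA.
  move=> v' h hv' hh y'.
  have hI : wd_I (w := D) h by apply: (HI i) => //; exact: ltnW.
  have hh0 : homog T 0 h := wd_I_sub hI.
  rewrite !rM /= (rA (mkA hv)) /= (rA (mkA hh0)) /= (piA0 (mkA hh0)) // scale0r.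
  have -> : act (mkA hv) 0 = 0 by rewrite /act r00.
  by rewrite /act r00 /= ((rV (exist _ v' hv')).2 0).
have actDl a b y : act (a + b) y = act a y + act b y by rewrite /act rD.
have actN a y : act (- a) y = - act a y.
  by apply: (@addIr _ (act a y)); rewrite -actDl !addNr /act (_ : val (0 : A) = 0) // (klin0 rl).
have actM a b y : act (a * b) y = act a (act b y) by rewrite /act rM /= !rA.
have actDr a x y : act a (x + y) = act a x + act a y.
  rewrite /act (_ : (0, x + y) = (0, x) + (0, y) :> (M * M)%type) ?rc //.
  by congr pair; rewrite /= addr0.
have act1 y : act 1 y = y by rewrite /act (_ : val (1 : A) = 1) // r_1.
have actc c y : act (kin A c) y = c *k: y.
  by rewrite /act -[val (kin A c)]/(kin T c) -[kin T c]mulr1 rZ r_1.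
pose bact (b : Abar) y := act (quo_repr b) y.
have bactE a y : bact (piA a) y = act a y.
  apply/subr0_eq; rewrite /bact -actN -actDl; apply: actI.
  by apply/(quo_eq (I_ideal D)); rewrite quo_piK.
have [||||N [j [bj jD jZ]]] := @mod_of_action Abar M bact.
- by move=> a b y; have [a' ->] := piA_surj a; have [b' ->] := piA_surj b; rewrite -rmorphM !bactE actM.
- by move=> y; rewrite -(rmorph1 piA) bactE act1.
- by move=> a x y; have [a' ->] := piA_surj a; rewrite !bactE actDr.
- by move=> y a b; have [a' ->] := piA_surj a; have [b' ->] := piA_surj b; rewrite -rmorphD !bactE actDl.
have jA a y : j (act a y) = piA a *: j y by rewrite -jZ bactE.
have jl : klinear j by move=> c x y; rewrite jD -actc jA.
pose h1 (v : V) m : N := j (kend_fun (rho (sval v)) (m, 0)).2.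
have h1l v : klinear (h1 v).
  move=> c x y; rewrite /h1 -jl; congr j.
  by rewrite kpairD0 rc rk snd_klin.
have h1L c (u v w : V) m : sval w = kin T c * sval u + sval v -> h1 w m = c *k: h1 u m + h1 v m.
  by move=> e; rewrite /h1 e rD rZ snd_klin jl.
have h1B (a b : A) (v w : V) m : sval w = val a * sval v * val b -> h1 w m = piA a *: h1 v (piA b *: m).
  move=> e; rewrite /h1 e !rM /= !rA /= -jA; congr (j (act a (kend_fun _ (_, _)).2)).
  by rewrite /act r00.
have hc (a : A) (v : V) m : sval v = wd_d (w := D) (val a) -> piA a *: j m = j (piA a *: m) + h1 v m.
  by move=> e; rewrite /h1 e -jD -actE jA.
exists N, (Mor jl h1l h1L h1B hc); split=> //= w m.
by rewrite /h1 /= r1.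
Qed.

(** Every term of d(w) splits as u v with v in A U A; there f^1 vanishes, so the quadratic part of
    the composition formula drops out. *)
Lemma comp1_layer (U : {vspace W1}) w M N L (g : mor N L) (f : mor M N) :
  (homog T 0 * W1_set T U * homog T 0 * W1_set T U * homog T 0)%mset (wd_d (w := D) (ta1 T w)) ->
  (forall u m, u \in U -> mor1 f (v1 u) m = 0) ->
  forall m, mor1 (g ** f) (v1 w) m = mor0 g (mor1 f (v1 w) m) + mor1 g (v1 w) (mor0 f m).
Proof.
move=> dw f0 m; have [b [[bD bZ _] _ bV _ _] bE] := comp1_beta g f.
rewrite [LHS]bE -[RHS]addr0; congr (_ + _).
have b0 m' : b 0 m' = 0 by have := bZ 0 0 m'; rewrite mulr0 kscale0.
pose Q (t : T) := forall y m, homog T 0 y -> b (t * y) m = 0.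
have Qs (z : T) : subspace (M := T^o) (fun t => Q (t * z)).
  split=> [|c x y hx hy] y' m' h; first by rewrite mul0r mul0r.
  by rewrite kT !mulrDl -!mulrA bD bZ !mulrA hx // hy // kscaler0 addr0.
have Q1 : subspace (M := T^o) Q.
  split=> [|c x y hx hy] y' m' h; first by rewrite mul0r.
  by rewrite kT mulrDl -mulrA bD bZ hx // hy // kscaler0 addr0.
have Qs0 : subspace (M := T^o) (fun t => b t m = 0).
  by split=> [|c x y hx hy] //; rewrite kT bD bZ hx hy kscaler0 addr0.
move: dw; apply: (val_mulset Qs0) => x y hx hy; suff: Q x by apply.
move: hx; apply: (val_mulset Q1) => {}x _ hx [w' w'U <-].
move: hx; apply: (val_mulset (Qs _)) => {}x a hx ha; rewrite -mulrA.
move: hx; apply: (val_mulset (Qs _)) => a' _ ha' [w'' _ <-] y' m' hy'.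
have h1 : homog T 1 (a' * ta1 T w'') by exact: homogS_gen.
have h2 : homog T 1 (a * ta1 T w' * y') by apply: homogS_mulr => //; exact: homogS_gen.
rewrite -!mulrA [a * _]mulrA mulrA (bV (exist _ _ h1) (exist _ _ h2)).
rewrite (@mor1_bimod _ _ _ _ _ f (mkA ha) (mkA hy') (v1 w') (exist _ _ h2)) //.
by rewrite f0 // scaler0 mor10.
Qed.

Lemma strict_iso M N : mod_iso M N -> isoA M N.
Proof.
case=> f /bij_inv_linear[g [fK gK]]; exists (strict_mor f), (strict_mor g).
by split; apply: mor_ext => [m|v m]; rewrite ?comp_strictl //= ?linear0 // mor0_comp /= ?fK ?gK.
Qed.

Lemma isoA_trans M N L : isoA M N -> isoA N L -> isoA M L.
Proof.
move=> [f [g [gf fg]]] [f' [g' [gf' fg']]]; exists (f' ** f), (g ** g'); split.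
  by rewrite comp_assoc -(comp_assoc g') gf' comp_idl.
by rewrite comp_assoc -(comp_assoc f) fg comp_idl.
Qed.

(* Compose h with deformations of its target that kill h^1 one layer of W1 at *)
(* a time, until it becomes strict.                                           *)
Lemma mor0_left_inverse M N (h : mor M N) : bijective (mor0 h) ->
  exists l : mor N M, l ** h = id_mor M.
Proof.
have [_ [s [Fl [F0 Fs _ FS]]]] := iwd_layer D.
(* [n] counts the layers of W1 on which h^1 may still be nonzero. *)
suff: forall n, (n <= s)%N -> forall M N (h : mor M N), bijective (mor0 h) ->
    (forall u m, u \in Fl (s - n)%N -> mor1 h (v1 u) m = 0) ->
    exists l : mor N M, l ** h = id_mor M.
  move=> H bh; apply: (H s) => // u m; rewrite subnn F0 memv0 => /eqP->.
  exact: bimod_map0 (mor1_bimod_map h).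
clear M N h; elim=> [_|n IH ns] M N h bh h0.
  have h1 v m : mor1 h v m = 0.
    by move: v m; apply: mor1_eq0 => w m; apply: h0; rewrite subn0 Fs memvf.
  have [g [hK gK]] := bij_inv_linear (f := linear_mor0 h1) bh.
  exists (strict_mor g); apply: mor_ext => [m|v m]; first exact: hK.
  by rewrite comp_strictl h1 linear0.
have [q qK hqK] := bh.
have ql : klinear q.
  by move=> c x y; apply: (can_inj qK); rewrite hqK mor0_lin !hqK.
have qS a x : q (sA a *: x) = sA a *: q x.
  by apply: (can_inj qK); rewrite hqK mor0_S hqK.
(* Chosen so that, on the next layer, the two remaining terms of (h' h)^1 cancel. *)
have phib : bimod_map (fun w (x : N) => - mor1 h (v1 w) (q x)).
  have [hl hc hs hr] := mor1_bimod_map h.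
  split=> [w c x y|c v w x|a w x|a w x].
  - by rewrite ql hl opprD /kscale scalerN.
  - by rewrite hc opprD /kscale scalerN.
  - by rewrite hs scalerN.
  - by rewrite hr qS.
have [N' [h' [bh' h'E]]] := deformation phib.
have sn : (s - n.+1 < s)%N by rewrite ltn_subrL (leq_trans _ ns).
have sn1 : (s - n.+1).+1 = (s - n)%N by rewrite -subSn // subSS.
have [|u m uF|l lE] := IH (ltnW ns) M N' (h' ** h).
- exact: bij_comp bh' bh.
- have [_ /(_ u)] := FS _ sn; rewrite sn1 => /(_ uF) du.
  by rewrite (comp1_layer _ du h0) h'E qK -mor0D subrr mor00.
by exists (l ** h'); rewrite comp_assoc.
Qed.

(** A left inverse l of [h] again has bijective l^0, so it has a left inverse too, which must be
    [h]. *)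
Lemma mor0_bij_iso M N (h : mor M N) : bijective (mor0 h) ->
  exists g : mor N M, g ** h = id_mor M /\ h ** g = id_mor N.
Proof.
move=> bh; have [l lh] := mor0_left_inverse bh.
have l0K : cancel (mor0 h) (mor0 l).
  by move=> m; rewrite -[LHS]/(mor0 (l ** h) m) lh.
have [q qK hqK] := bh.
have bl : bijective (mor0 l).
  by exists (mor0 h) => // x; rewrite -[x]hqK l0K.
have [l' l'l] := mor0_left_inverse bl; exists l; split=> //.
suff -> : h = l' by [].
by rewrite -[h]comp_idl -l'l comp_assoc lh comp_idr.
Qed.

(* Deforming M along p e^1 - e^1 p, where p = e^0, makes e^1 vanish on one     *)
(* more layer of W1.                                                          *)
Lemma idempotent_strict M (e : mor M M) : e ** e = e ->
  exists N (h : mor M N) (g : mor N M), [/\ g ** h = id_mor M, h ** g = id_mor N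
    & forall v m, mor1 (h ** e ** g) v m = 0].
Proof.
have [_ [s [Fl [F0 Fs _ FS]]]] := iwd_layer D.
move=> ee; suff: forall n, (n <= s)%N -> exists N (h : mor M N) (g : mor N M),
    [/\ g ** h = id_mor M, h ** g = id_mor N
      & forall u m, u \in Fl n -> mor1 (h ** e ** g) (v1 u) m = 0].
  move=> /(_ s (leqnn s))[N [h [g [gh hg e0]]]]; exists N, h, g; split=> //.
  by apply: mor1_eq0 => w m; apply: e0; rewrite Fs memvf.
elim=> [_|n IH ns].
  exists M, (id_mor M), (id_mor M); rewrite !comp_idl; split=> // u m.
  rewrite F0 memv0 => /eqP->; exact: bimod_map0 (mor1_bimod_map _).
have [N [h [g [gh hg]]]] := IH (ltnW ns); set f := h ** e ** g => f0.
have ff : f ** f = f.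
  rewrite /f !comp_assoc -(comp_assoc g) gh comp_idl -(comp_assoc e) ee.
  by [].
have fE : f = h ** e ** g by []; clearbody f.
pose p := mor0 f; have pp x : p (p x) = p x by rewrite -[p (p x)]/(mor0 (f ** f) x) ff.
have [fl fc fs fr] := mor1_bimod_map f.
have phib : bimod_map (fun w (x : N) => p (mor1 f (v1 w) x) - mor1 f (v1 w) (p x)).
  split=> [w c x y|c v w x|a w x|a w x].
  - by rewrite /p !(mor0_lin, mor1_lin) opprD addrACA kscaleDr /kscale scalerN.
  - by rewrite !fc /p mor0_lin opprD addrACA kscaleDr /kscale scalerN.
  - by rewrite !fs /p mor0_S scalerBr.
  - by rewrite !fr /p mor0_S.
have [N' [h' [bh' h'E]]] := deformation phib.
have {}h'E w x : mor1 h' (v1 w) x = mor0 h' (p (mor1 f (v1 w) x) - mor1 f (v1 w) (p x)) := h'E w x.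
have [g' [g'h' h'g']] := mor0_bij_iso bh'.
exists N', (h' ** h), (g ** g'); split.
- by rewrite comp_assoc -(comp_assoc g') g'h' comp_idl.
- by rewrite comp_assoc -(comp_assoc h) hg comp_idl.
have -> : h' ** h ** e ** (g ** g') = h' ** f ** g' by rewrite fE !comp_assoc.
set f' := h' ** f ** g' => u y uF.
have f'h' : f' ** h' = h' ** f by rewrite /f' !comp_assoc g'h' comp_idr.
have [sub /(_ u uF) du] := FS n ns.
have [q qK hqK] := bh'; rewrite -[y]hqK; set x := q y.
have h'0 w m : w \in Fl n -> mor1 h' (v1 w) m = 0.
  by move=> wF; rewrite h'E !f0 // /p mor00 subr0 mor00.
have := congr1 (fun k : mor N N' => mor1 k (v1 u) x) f'h'.
rewrite (comp1_layer _ du h'0) (comp1_layer _ du f0) !h'E.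
have -> z : mor0 f' (mor0 h' z) = mor0 h' (p z).
  by rewrite -[LHS]/(mor0 (f' ** h') z) f'h'.
(* Idempotency on this layer: f^1 = p f^1 + f^1 p, whence p f^1 p = 0. These two relations make the
   conjugated f^1 cancel. *)
have X z : mor1 f (v1 u) z = p (mor1 f (v1 u) z) + mor1 f (v1 u) (p z).
  by rewrite -(comp1_layer _ du f0) ff.
have pXp z : p (mor1 f (v1 u) (p z)) = 0.
  apply: (@addrI _ (p (mor1 f (v1 u) z))); rewrite addr0 {2}[mor1 f (v1 u) z]X.
  by rewrite [RHS]mor0D -/p pp.
have pB a c : p (a - c) = p a - p c.
  by rewrite /p mor0D (klinN (mor0_lin f)).
rewrite -/(p x) !pB !pp !pXp subr0 sub0r -mor0D {2}(X x) addrK addrC.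
by move/(canRL (addrK _)); rewrite subrr.
Qed.

Lemma mor0_fdim M N (h : mor M N) : bijective (mor0 h) -> fdim M -> fdim N.
Proof. by move=> [q _ qK]; apply: (@fdim_surj _ _ _ _ (mor0 h)) => [|y]; [exact: mor0_lin|exists (q y)]. Qed.

Lemma isoA_mor0_bij M N (h : mor M N) (g : mor N M) :
  g ** h = id_mor M -> h ** g = id_mor N -> bijective (mor0 h).
Proof.
move=> gh hg; exists (mor0 g) => m.
  by rewrite -[LHS]/(mor0 (g ** h) m) gh.
by rewrite -[LHS]/(mor0 (h ** g) m) hg.
Qed.

Lemma FG_nonzero M : nonzero_mod M -> nonzero_mod (FG M).
Proof.
move=> [m m0]; exists (orbit_mor m); apply: contraNneq m0.
by move/(congr1 (fun h : FG M => mor0 (h : mor _ _) 1)); rewrite /= scale1r => ->.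
Qed.

(** * Full faithfulness *)

Section FullyFaithful.
Hypothesis Abar_fd : fdim (B := Abar) Abar^o.

(* 1 and the g j belong to a finite dual basis of Gamma as a right module     *)
(* over A/I; hence Gamma (x) N is Hom(A/I, N), and N |-> Gamma (x) N is exact *)
(* on strict sequences.                                                       *)
Lemma dual_basis : exists (J : finType) (g : J -> Gam) (u : J -> V) (b : J -> Abar^o),
  forall N (f : mor Abar^o N),
    f = orbit_mor (mor0 f 1) + \sum_j orbit_mor (mor1 f (u j) (b j)) ** (g j : mor _ _).
Proof.
have [n [b [c [cl cE]]]] := fdim_coord Abar_fd.
pose q := \dim {:W1}; pose e (t : 'I_q) := (vbasis {:W1})`_t.
pose J := (P * P * 'I_q * 'I_n)%type.
pose cc (p : J) (w : W1) (x : Abar^o) : k :=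
  coord (vbasis {:W1}) p.1.2 (corner p.1.1.1 p.1.1.2 w) * c (eb p.1.1.2 *: x) p.2.
have c0 i : c 0 i = 0 by have := cl (-1) 0 0 i; rewrite kscaleN1 addr0 oppr0 mulN1r addNr.
have cZ t x i : c (t *k: x) i = t * c x i by have := cl t x 0 i; rewrite addr0 c0 addr0.
(* The elementary bimodule maps: for p = (j, i, t, l), multiply e_j by the t-th coordinate of e_j w
   e_i and the l-th coordinate of e_i x. Every bimodule map on W1 is a combination of these. *)
have gex (p : J) : exists f : Gam, mor0 (f : mor _ _) 1 = 0 /\
    forall w x, mor1 (f : mor _ _) (v1 w) x = cc p w x *k: (eb p.1.1.1 : Abar^o).
  apply: mor_regular_ex; split=> [w t x y|t v w x|s w x|s w x]; rewrite /cc.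
  - by rewrite scalerDr -kscale_scale cl mulrDr kscaleDl kscaleA mulrCA.
  - by rewrite linearP linearP mulrDl kscaleDl kscaleA mulrA.
  - rewrite corner_lactS linearZ -kscale_scale.
    have -> : sA s *: (eb p.1.1.1 : Abar^o) = s p.1.1.1 *k: (eb p.1.1.1 : Abar^o) by exact: sA_eb.
    by rewrite kscaleA; congr (_ *k: _); exact: etrans (esym (mulrA _ _ _)) (mulrC _ _).
  - rewrite corner_ractS linearZ scalerA eb_sA -scalerA [kin _ _ *: _]/(_ *k: (_ : Abar^o)) cZ.
    by congr (_ *k: _); exact: etrans (esym (mulrA _ _ _)) (mulrCA _ _ _).
have /choice[g gE] := gex.
exists J, g, (fun p => v1 (e p.1.2)), (fun p => b p.2) => N f.
have fb := mor1_bimod_map f.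
apply: mor_regular_eq => [|w x].
  rewrite mor0_add mor0_sumf big1 ?addr0 => [|p _]; first by rewrite /= scale1r.
  by rewrite mor0_comp (gE p).1 /= scale0r.
rewrite mor1_add add0r mor1_sumf.
transitivity (\sum_j \sum_i mor1 f (v1 (corner j i w)) x).
  have fD u v : mor1 f (v1 (u + v)) x = mor1 f (v1 u) x + mor1 f (v1 v) x.
    by case: fb => _ h _ _; have := h 1 u v x; rewrite scale1r kscale1.
  have f0 := bimod_map0 x fb.
  rewrite {1}[w]corner_sum (big_morph (fun u => mor1 f (v1 u) x) fD f0).
  by apply: eq_bigr => j _; rewrite (big_morph (fun u => mor1 f (v1 u) x) fD f0).
rewrite pair_big /=.
transitivity (\sum_(p : P * P) \sum_(t < q) \sum_(l < n)
    cc (p, t, l) w x *k: (eb p.1 *: mor1 f (v1 (e t)) (b l))); last first.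
  rewrite pair_big pair_big /=; apply: eq_bigr => -[[[j i] t] l] _ /=.
  by apply/esym; apply: etrans (comp_orbitl _ _ _ _) _; rewrite (gE _).2 /kscale -scalerA.
apply: eq_bigr => -[j i] _ /=.
have -> : mor1 f (v1 (corner j i w)) x = eb j *: mor1 f (v1 (corner j i w)) (eb i *: x).
  rewrite -(bimod_map_corner _ _ _ _ fb) /corner -lractS -ractSM -lactSM.
  by congr (mor1 f (v1 (lactS _ (ractS _ _))) x); apply/ffunP => l;
    rewrite !ffunE; case: eqP; rewrite ?mulr1 ?mulr0.
rewrite [corner j i w in LHS](coord_vbasis (memvf _)) (bimod_map_sum _ _ _ _ fb) scaler_sumr.
apply: eq_bigr => t _; rewrite -kscale_scale [eb i *: x in LHS]cE mor1_sum scaler_sumr kscaler_sumr.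
apply: eq_bigr => l _; rewrite (klinZ (mor1_lin f _)) -kscale_scale kscaleA.
by [].
Qed.

(** Evaluation sends x (x) m to the morphism [orbit_mor m ** x]; the dual basis supplies the
    inverse, f going to 1 (x) f^0(1) plus the sum of the g_j (x) f^1(u_j)(b_j). *)
Lemma tensor_FG N : mod_iso (Gamma_tensor N) (FG N).
Proof.
have [J [g [u [b gE]]]] := dual_basis.
pose h (x : Gring D) (m : N) : FG N := orbit_mor m ** x.
have [||||G GT] := @tensor_lift _ _ (@iotaG k P D : {rmorphism Abar -> Gring D}) N (FG N) h.
- by move=> x y m; exact: compDr.
- by move=> x m n; rewrite /h orbit_morD; exact: compDl.
- by move=> x a m; rewrite /h orbit_morZ comp_assoc.
- by move=> c x m; exact/esym/comp_assoc.
pose tn := tens (@iotaG k P D : {rmorphism Abar -> Gring D}) (M := N).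
pose th (f : FG N) : Gamma_tensor N :=
  tn 1 (mor0 (f : mor _ _) 1) + \sum_j tn (g j) (mor1 (f : mor _ _) (u j) (b j)).
have tn0 x : tn x 0 = 0 by apply: (@addIr _ (tn x 0)); rewrite -tensDr !add0r.
have thB : zmod_morphism th.
  move=> x y; apply: (@addIr _ (th y)); rewrite subrK.
  have hD p q : th (p + q) = th p + th q.
    rewrite /th mor0_add /tn tensDr -/tn addrACA; congr (_ + _).
    by rewrite -big_split; apply: eq_bigr => j _; rewrite mor1_add /tn tensDr.
  by rewrite -hD subrK.
pose thA : {additive FG N -> Gamma_tensor N} := HB.pack th (GRing.isZmodMorphism.Build _ _ th thB).
exists G; exists th.
  apply: (tensor_ind (f := thA \o G) (g := idfun)) => x m /=.
  rewrite GT /th /h mor0_comp.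
  rewrite (eq_bigr (fun j => tn (g j * iotaG (mor1 (x : mor _ _) (u j) (b j)) : Gring D) m)); last first.
    by move=> j _; rewrite comp_orbitl /tn tens_balanced.
  rewrite /= [tn 1 _](_ : _ = tn (1 * iotaG (mor0 (x : mor _ _) 1) : Gring D) m); last first.
    by rewrite /tn tens_balanced.
  have tnD p q : tn (p + q) m = tn p m + tn q m by exact: tensDl.
  have tn00 : tn 0 m = 0 by apply: (@addIr _ (tn 0 m)); rewrite -tnD !add0r.
  rewrite -(big_morph (fun p => tn p m) tnD tn00) -tnD; congr tn.
  have eo a : iotaG a = orbit_mor (a : Abar^o) by exact: mor_ext.
  rewrite [RHS](gE _ x) mul1r eo; congr (_ + _).
  by apply: eq_bigr => j _; rewrite -eo.
move=> f; rewrite linearD linear_sum [RHS](gE _ f) !GT; congr (_ + _).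
  by rewrite /h; exact: comp_idr.
by apply: eq_bigr => j _; rewrite GT.
Qed.

(** Evaluate the images of the strict morphisms [orbit_mor m] at 1 to obtain f^0 and f^1. The two
    maps then agree on these morphisms, which generate [FG M] over Gamma by the dual basis. *)
Lemma Fmap_full M N (Phi : {linear FG M -> FG N}) : exists f : mor M N, forall x, Phi x = Fmap f x.
Proof.
have [J [g [u [b gE]]]] := dual_basis.
pose R m : mor Abar^o N := Phi (orbit_mor m).
have RL c m n : R (c *k: m + n) = R m ** iotaG (kin Abar c) + R n.
  rewrite /R orbit_morD orbit_morZ.
  by rewrite -[orbit_mor m ** _]/((iotaG (kin Abar c) : Gam) *: (orbit_mor m : FG M)) linearP.
have RZ a m : R (a *: m) = R m ** iotaG a.
  by rewrite /R orbit_morZ -[_ ** _]/((iotaG a : Gam) *: (orbit_mor m : FG M)) linearZ.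
have RZ0 a m x : mor0 (R (a *: m)) x = mor0 (R m) ((x : Abar) * a) by rewrite RZ.
have RZ1 a m v x : mor1 (R (a *: m)) v x = mor1 (R m) v ((x : Abar) * a).
  by rewrite RZ comp_strictr.
pose f0 m := mor0 (R m) 1; pose f1 v m := mor1 (R m) v 1.
have rm c : ((1 : Abar) * kin Abar c : Abar^o) = c *k: (1 : Abar^o) by rewrite -kin_central.
have f0l : klinear f0.
  move=> c m n; rewrite /f0 RL mor0_add mor0_comp /= /rmul rm.
  by rewrite (klinZ (mor0_lin (R m))).
have f1l v : klinear (f1 v).
  move=> c m n; rewrite /f1 RL mor1_add comp_strictr /= /rmul rm.
  by rewrite (klinZ (mor1_lin (R m) v)).
have f1L c (v v' w : V) m : sval w = kin T c * sval v + sval v' -> f1 w m = c *k: f1 v m + f1 v' m.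
  exact: mor1_linV.
have f1B (a a' : A) (v w : V) m : sval w = val a * sval v * val a' ->
    f1 w m = piA a *: f1 v (piA a' *: m).
  move=> e; rewrite /f1 RZ1 mul1r (mor1_bimod _ _ e); congr (_ *: mor1 _ _ _); exact: mulr1.
have f01 (a : A) (v : V) m : sval v = wd_d (w := D) (val a) ->
    piA a *: f0 m = f0 (piA a *: m) + f1 v m.
  move=> e; rewrite /f0 RZ0 mul1r (mor_compat _ _ e); congr (mor0 _ _ + _); exact: mulr1.
pose f := Mor f0l f1l f1L f1B f01.
have fR m : Phi (orbit_mor m) = Fmap f (orbit_mor m).
  apply: mor_ext => [x|v x]; first by rewrite mor0_comp /= /f0 RZ0 mul1r.
  by rewrite comp_strictr /= /f1 RZ1 mul1r.
exists f => x; rewrite (gE _ x) !linearD !linear_sum fR; congr (_ + _).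
apply: eq_bigr => j _.
by rewrite -[_ ** (g j : mor _ _)]/(g j *: (orbit_mor (mor1 x (u j) (b j)) : FG M)) !linearZ fR.
Qed.

Lemma Fmap_faithful M N (f g : mor M N) : (forall x, Fmap f x = Fmap g x) -> f = g.
Proof.
move=> fg; apply: mor_ext => [m|v m].
  have e := congr1 (fun h : FG N => mor0 (h : mor Abar^o N) 1) (fg (orbit_mor m)).
  by rewrite -[m]scale1r; exact: e.
have e := congr1 (fun h : FG N => mor1 (h : mor Abar^o N) v 1) (fg (orbit_mor m)).
pose p := linear_of (orbit_linear m).
have := etrans (esym (comp_strictr f p v 1)) (etrans e (comp_strictr g p v 1)).
by rewrite /= scale1r.
Qed.

Lemma Fmap_comp M N L (g : mor N L) (f : mor M N) x : Fmap g (Fmap f x) = Fmap (g ** f) x.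
Proof. by rewrite /= comp_assoc. Qed.
Lemma Fmap_id M x : Fmap (id_mor M) x = x.
Proof. exact: comp_idl. Qed.

Lemma isoA_FG M N : isoA M N <-> mod_iso (FG M) (FG N).
Proof.
split=> [[f [g [fK gK]]]|[f /bij_inv_linear[g [fK gK]]]].
  by exists (Fmap f); exists (Fmap g) => x; rewrite Fmap_comp ?fK ?gK Fmap_id.
have [f' fE] := Fmap_full f; have [g' gE] := Fmap_full g.
exists f', g'; split; apply: Fmap_faithful => x;
  by rewrite -Fmap_comp Fmap_id -?fE -?gE -?fE ?fK ?gK.
Qed.

Lemma Fmap_surj M N (p : {linear M -> N}) : (forall y, exists x, p x = y) ->
  forall y, exists x, Fmap (strict_mor p) x = y.
Proof.
have [J [g [u [b gE]]]] := dual_basis => sp y.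
have [m mE] := sp (mor0 (y : mor _ _) 1).
have /choice[n nE] j := sp (mor1 (y : mor _ _) (u j) (b j)).
exists (orbit_mor m + \sum_j orbit_mor (n j) ** (g j : mor _ _)).
rewrite linearD linear_sum [RHS](gE _ y) /= comp_orbit mE; congr (_ + _).
by apply: eq_bigr => j _; rewrite -comp_assoc comp_orbit nE.
Qed.

Lemma FG_fdim N : fdim N -> fdim (FG N).
Proof.
have [J [g [u [b gE]]]] := dual_basis => -[n [d dE]].
pose s : seq N := flatten [seq [:: d i] | i <- index_enum 'I_n].
have sE x : lspan s x.
  have [c ->] := dE x; apply: (@lspan_flatten _ _ _ _ _ (fun i => [:: d i])) => i; exact: lspan_head.
pose R (m : N) : FG N := orbit_mor m; pose S j (m : N) : FG N := orbit_mor m ** (g j : mor _ _).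
have Rl : klinear R.
  by move=> c x y; rewrite /R orbit_morD orbit_morZ.
have Sl j : klinear (S j).
  move=> c x y; rewrite /S -[orbit_mor (_ + _)]/(R _) Rl compDl; congr (_ + _).
  by rewrite -[LHS]/(g j *: (c *k: R x)) -kscale_scale.
apply: (@fdim_lspan _ _ _ (map R s ++ flatten [seq map (S j) s | j <- index_enum J])) => f.
rewrite (gE _ f); apply: lspan_cat; first exact: (lspan_map Rl).
by apply: (@lspan_flatten _ _ _ _ _ (fun j => map (S j) s)) => j; exact: (lspan_map (Sl j)).
Qed.

(** By fullness and faithfulness a decomposition of [FG M] comes from an idempotent of A-mod. Up to
    isomorphism it is strict, hence splits its module as kernel plus image; indecomposability makes
    it 0 or 1. *)
Lemma FG_indecomposable M : fdim M -> indecomposableA M -> indecomposable (FG M).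
Proof.
move=> fM [M0 Mi]; split=> [|X Y]; first exact: FG_nonzero.
case=> f /bij_inv_linear[g [fK gK]].
pose pi : {linear FG M -> FG M} := g \o (lin_inl X Y \o (lin_fst X Y \o f)).
have pipi x : pi (pi x) = pi x by rewrite /= gK.
have [e eE] := Fmap_full pi.
have ee : e ** e = e.
  by apply: Fmap_faithful => x; rewrite -Fmap_comp -!eE pipi.
have [N [h [h' [h'h hh' e0]]]] := idempotent_strict ee.
set e' := h ** e ** h' in e0.
have [p e'E] : exists p : {linear N -> N}, e' = strict_mor p.
  by exists (linear_mor0 e0); exact: strict_linear_mor0.
have e'e' : e' ** e' = e'.
  by rewrite /e' !comp_assoc -(comp_assoc h') h'h comp_idl -(comp_assoc e) ee.
have pp x : p (p x) = p x.
  by have := congr1 (fun q : mor N N => mor0 q x) e'e'; rewrite e'E.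
have eE' : e = h' ** e' ** h.
  by rewrite /e' !comp_assoc h'h comp_idr -!comp_assoc h'h comp_idl.
have fN : fdim N by apply: (mor0_fdim _ fM); exact: isoA_mor0_bij h'h hh'.
have MN : isoA M N by exists h, h'.
have XY := isoA_trans MN (strict_iso (idempotent_decomp pp)).
have [K0|I0] := Mi _ _ (sub_fdim _ fN) (sub_fdim _ fN) XY; [right|left].
  have pid x : p x = x.
    apply/esym/subr0_eq; apply: contrapT => n0; apply: K0.
    have kx : p (x - p x) = 0 by rewrite linearB pp subrr.
    by exists (in_submod (U := submod_ker p) kx); apply/eqP => /(congr1 val).
  have eid : e = id_mor M.
    rewrite eE' e'E (_ : strict_mor p = id_mor N) ?comp_idr ?h'h //.
    by apply: mor_ext => // x; exact: pid.
  case=> y /eqP; apply; have := eE (g (0, y)); rewrite eid Fmap_id /= gK /=.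
  by move/(can_inj gK) => -[].
have p0 x : p x = 0.
  apply: contrapT => n0; apply: I0.
  have kx : (idfun \- p) (p x) = 0 by apply/eqP; rewrite /= subr_eq0 pp.
  by exists (in_submod (U := submod_ker (idfun \- p)) kx); apply/eqP => /(congr1 val).
case=> x /eqP; apply; have := eE (g (x, 0)); rewrite /= gK /=.
have -> : e = 0.
  rewrite eE' e'E; apply: mor_ext => [m|v m]; first by rewrite !mor0_comp /= p0 mor00.
  rewrite comp_assoc.
  have -> : strict_mor p ** h = 0.
    by apply: mor_ext => [m'|v' m']; rewrite ?mor0_comp ?comp_strictl /= p0.
  rewrite /= /comp1 /= mor00 mor10 !add0r big1 // => q _; exact: mor10.
by rewrite comp0f -[RHS](linear0 g) => /(can_inj gK) -[].
Qed.

Lemma mor_factor_sub X N (U : submod N) (f : mor X N) :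
  (forall x, U (mor0 f x)) -> (forall v x, U (mor1 f v x)) ->
  exists g : mor X (sub_of U), f = strict_mor (submod_incl U) ** g.
Proof.
move=> U0 U1; pose g0 x := in_submod (U0 x); pose g1 v x := in_submod (U1 v x).
have l0 : klinear g0 by move=> c x y; apply: val_inj; exact: mor0_lin.
have l1 v : klinear (g1 v) by move=> c x y; apply: val_inj; exact: mor1_lin.
have L c (u v w : V) m : sval w = kin T c * sval u + sval v -> g1 w m = c *k: g1 u m + g1 v m.
  by move=> e; apply: val_inj; exact: mor1_linV.
have B (a b : A) (v w : V) m : sval w = val a * sval v * val b ->
    g1 w m = piA a *: g1 v (piA b *: m).
  by move=> e; apply: val_inj; exact: mor1_bimod.
have C (a : A) (v : V) m : sval v = wd_d (w := D) (val a) ->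
    piA a *: g0 m = g0 (piA a *: m) + g1 v m.
  by move=> e; apply: val_inj; exact: mor_compat.
exists (Mor l0 l1 L B C); apply: mor_ext => // v m.
by rewrite comp_strictl.
Qed.

Lemma Fmap_incl_inj N (U : submod N) : injective (Fmap (strict_mor (submod_incl U))).
Proof.
apply: linear_injP => f f0; apply: mor_ext => [x|v x]; apply: val_inj.
  exact: (congr1 (fun g : FG N => mor0 (g : mor _ _) x) f0).
rewrite -[LHS](comp_strictl (submod_incl U) f).
exact: (congr1 (fun g : FG N => mor1 (g : mor _ _) v x) f0).
Qed.

Lemma FG_trivial X : (forall x : X, x = 0) -> projective (FG X).
Proof.
move=> X0 M N g f _; exists \0 => x.
have X1 (p q : X) : p = q by rewrite [p]X0 [q]X0.
have -> : x = 0 by apply: mor_ext => *; exact: X1.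
by rewrite !linear0.
Qed.

Lemma FG_prod_projective X N : projective (FG X) -> projective (FG N) -> projective (FG (X * N)%type).
Proof.
move=> pX pN; pose f := lin_pair (Fmap (strict_mor (lin_fst X N))) (Fmap (strict_mor (lin_snd X N))).
pose g := lin_copair (Fmap (strict_mor (lin_inl X N))) (Fmap (strict_mor (lin_inr X N))).
apply: (projective_retract (f := f) (g := g)); last exact: projective_prod.
move=> x; apply: mor_ext => [m|v m].
  rewrite [LHS]mor0_add /= [RHS]surjective_pairing.
  by congr pair; rewrite /= ?addr0 ?add0r.
rewrite [LHS]mor1_add !comp_strictl [RHS]surjective_pairing.
by congr pair; rewrite /= ?addr0 ?add0r.
Qed.

Definition reg_FG : {linear Gam^o -> FG Abar^o} :=
  linear_of (f := fun x : Gam^o => (x : FG Abar^o)) (fun _ _ _ => erefl).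

Lemma FG_regular_iso : mod_iso Gam^o (FG Abar^o).
Proof. by exists reg_FG; exists id. Qed.

(** * The modules P_i and presentations of their quotients *)

Definition Pgen i : Pbar D i :=
  in_submod (U := Submod (Pbar_subproof D i)) (ex_intro _ 1 (esym (mul1r (eb i)))).

Definition pval i (x : Pbar D i) : Abar := val x.
Lemma pvalD i (x y : Pbar D i) : pval (x + y) = pval x + pval y. Proof. by []. Qed.
Lemma pvalZ i (a : Abar) (x : Pbar D i) : pval (a *: x) = a * pval x. Proof. by []. Qed.
Lemma pval_gen i : pval (Pgen i) = eb i. Proof. by []. Qed.
Lemma pval_inj i : injective (@pval i). Proof. exact: val_inj. Qed.

Lemma pval0 i : pval (0 : Pbar D i) = 0.
Proof. by []. Qed.

Lemma pval_eb i (x : Pbar D i) : pval x * eb i = pval x.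
Proof.
have [a e] := submod_val x; rewrite /pval.
by move: (val x) e => y ->; rewrite -mulrA ebM eqxx.
Qed.

Lemma Pbar_gen i (x : Pbar D i) : x = pval x *: Pgen i.
Proof. by apply: pval_inj; rewrite pvalZ pval_gen pval_eb. Qed.

Fact Pmap_linear i M (m : M) : linear (fun x : Pbar D i => pval x *: m).
Proof. by move=> a x y; rewrite pvalD pvalZ scalerDl scalerA. Qed.
Definition Pmap i M (m : M) : {linear Pbar D i -> M} := linear_of (Pmap_linear (i := i) m).

Lemma FG_Pbar_projective i : projective (FG (Pbar D i)).
Proof.
pose inc : {linear Pbar D i -> Abar^o} := submod_incl _.
pose prj : {linear Abar^o -> Pbar D i} := linear_of (orbit_linear (Pgen i)).
apply: (projective_retract (f := Fmap (strict_mor inc)) (g := Fmap (strict_mor prj))).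
  move=> x; have -> : Fmap (strict_mor prj) (Fmap (strict_mor inc) x) = Fmap (id_mor _) x.
    rewrite Fmap_comp; congr (Fmap _ x); apply: mor_ext => [m|v m].
      exact/esym/Pbar_gen.
    by rewrite comp_strictl /= scale0r.
  exact: Fmap_id.
exact: (projective_iso FG_regular_iso (@projective_regular _)).
Qed.

Lemma eb_decomp M (m : M) : m = \sum_i eb i *: m.
Proof. by rewrite -scaler_suml eb_sum scale1r. Qed.

Lemma FG_presents X K (p : {linear X -> K}) : (forall y, exists x, p x = y) ->
  projective (FG X) -> presents (FG K) (FG X) (FG (sub_of (submod_ker p))).
Proof.
move=> sp pX; split=> //.
exists (Fmap (strict_mor p)), (Fmap (strict_mor (submod_incl (submod_ker p)))); split.
- exact: Fmap_surj.
- exact: Fmap_incl_inj.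
move=> f; split=> [f0|[g ->]].
  apply: mor_factor_sub => [x|v x].
    exact: (congr1 (fun g : FG K => mor0 (g : mor _ _) x) f0).
  have := congr1 (fun g : FG K => mor1 (g : mor _ _) v x) f0.
  by rewrite comp_strictl.
apply: mor_ext => [x|v x]; first exact: (submod_val (mor0 (g : mor _ _) x)).
by rewrite comp_strictl [mor1 _ v x]comp_strictl; exact: (submod_val (mor1 (g : mor _ _) v x)).
Qed.

(** * Indecomposable projectives *)

Variable Q : P -> lmodType Abar.
Hypothesis Q_fam : Q_family Q.

Lemma FQ_projective i : projective (FG (Q i)).
Proof.
have [_ _ _ [m /(_ i)/isoA_FG PQ]] := Q_fam.
set Z := dsum _ in PQ.
apply: (projective_retract (f := Fmap (strict_mor (lin_inl (Q i) Z)))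
  (g := Fmap (strict_mor (lin_fst (Q i) Z)))).
  by move=> x; apply: mor_ext => [//|v y]; rewrite !mor1_Fmap_strict.
exact: projective_iso PQ (@FG_Pbar_projective i).
Qed.

Lemma FQ_indecomposable i : indecomposable (FG (Q i)).
Proof. by have [/(_ i)[? ? _] _ _ _] := Q_fam; exact: FG_indecomposable. Qed.

Lemma FQ_fdim i : fdim (FG (Q i)).
Proof. by have [/(_ i)[? _ _] _ _ _] := Q_fam; exact: FG_fdim. Qed.

(** Generation of [FG X] by the [FG (Q j)], tested on maps out of it. In this form it passes to
    products without writing down a decomposition. *)
Definition Q_generated X : Prop := forall (S : lmodType Gam) (f : {linear FG X -> S}) x,
  f x <> 0 -> exists j (g : {linear FG (Q j) -> S}) y, g y <> 0.

Lemma Q_generated_prod X Y : Q_generated X -> Q_generated Y -> Q_generated (X * Y)%type.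
Proof.
move=> gX gY S f x fx.
have xE : x = Fmap (strict_mor (lin_inl X Y)) (Fmap (strict_mor (lin_fst X Y)) x) +
              Fmap (strict_mor (lin_inr X Y)) (Fmap (strict_mor (lin_snd X Y)) x).
  apply: mor_ext => [m|v m].
    rewrite [RHS]mor0_add /= [LHS]surjective_pairing.
    by congr pair; rewrite /= ?addr0 ?add0r.
  rewrite [RHS]mor1_add !mor1_Fmap_strict [LHS]surjective_pairing.
  by congr pair; rewrite /= ?addr0 ?add0r.
have [e|/gX//] := pselect ((f \o Fmap (strict_mor (lin_inl X Y))) (Fmap (strict_mor (lin_fst X Y)) x) = 0).
have [e'|/gY//] := pselect ((f \o Fmap (strict_mor (lin_inr X Y))) (Fmap (strict_mor (lin_snd X Y)) x) = 0).
by case: fx; rewrite xE linearD [f _]e [f _]e' addr0.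
Qed.

Lemma Q_generated_Q j : Q_generated (Q j).
Proof. by move=> S f x fx; exists j, f, x. Qed.

Lemma Pbar_Q_generated i : Q_generated (Pbar D i).
Proof.
have [_ _ _ [m /(_ i)/isoA_FG/mod_iso_sym[f /bij_inv_linear[g [fK gK]]]]] := Q_fam.
move=> S h x hx.
suff gen : Q_generated (Q i * dsum (flatten [seq nseq (m i j) (Q j) | j <- enum P & prec D i j]))%type.
  by apply: (gen S (h \o f) (g x)); rewrite /= gK.
apply: Q_generated_prod; first exact: Q_generated_Q.
elim: [seq j <- enum P | prec D i j] => [|j r IH] /=.
  move=> S' f' y f'y; case: f'y; rewrite (_ : y = 0) ?linear0 //.
  by apply: mor_ext => *; apply/ffunP; case.
elim: (m i j) => [|n IHn] //=.
by apply: Q_generated_prod; first exact: Q_generated_Q.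
Qed.

(** The map from Gamma sending 1 to [s] is nonzero on some [FG (Pbar D l)], since the identity of
    A/I is the sum of the projections to the P_l. *)
Lemma FQ_generates (S : lmodType Gam) (s : S) : s != 0 ->
  exists j (g : {linear FG (Q j) -> S}) y, g y <> 0.
Proof.
move=> s0; have sl : linear (fun a : FG Abar^o => (a : Gam) *: s).
  by move=> a x y; rewrite scalerA -scalerDl.
pose f : {linear FG Abar^o -> S} := linear_of sl.
have f1 : f (id_mor Abar^o) = s by exact: (scale1r (s : S)).
pose inc l : {linear Pbar D l -> Abar^o} := submod_incl _.
pose prj l : {linear Abar^o -> Pbar D l} := linear_of (orbit_linear (Pgen l)).
have idE : id_mor Abar^o = \sum_l Fmap (strict_mor (inc l)) (Fmap (strict_mor (prj l)) (id_mor Abar^o)).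
  apply: mor_ext => [x|v x].
    rewrite mor0_sumf -[LHS](mulr1 (x : Abar)) -eb_sum mulr_sumr; apply: eq_bigr => l _.
    by [].
  by rewrite mor1_sumf big1 // => l _; rewrite !mor1_Fmap_strict !linear0.
apply: contrapT => no; case/eqP: s0; rewrite -f1 idE linear_sum big1 // => l _.
apply: contrapT => h; apply: no.
exact: (Pbar_Q_generated (f := f \o Fmap (strict_mor (inc l))) h).
Qed.

Lemma Gamma_fdim : fdim (B := Gam) Gam^o.
Proof. exact: fdim_iso (mod_iso_sym (FG_regular_iso)) (FG_fdim Abar_fd). Qed.

(** A nonzero functional gives [M] a nonzero finite-dimensional image in Gamma, hence a simple
    quotient S, also a quotient of some [FG (Q j)]. Lift the two maps onto S through each other to h
    and g. Composing the map q onto S with powers of h g gives q back, so h g is not nilpotent; by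
    Fitting it is bijective, and [FG (Q j)] is a summand of [M]. *)
Lemma FQ_complete (M : lmodType Gam) : indecomposable M -> projective M ->
  exists j, mod_iso M (FG (Q j)).
Proof.
move=> [M0 Mi] pM; have [f [m fm]] := projective_functional pM M0.
have fI : fdim (sub_of (submod_im f)) by exact: sub_fdim Gamma_fdim.
have imf x : submod_im f (f x) by exists x.
have I0 : nonzero_mod (sub_of (submod_im f)).
  by exists (corestrict imf m); apply/eqP => /(congr1 val).
have [S [p [[s s0] sp simp]]] := simple_quotient fI I0.
have [j [q [y qy]]] := FQ_generates s0.
have sq := simp _ q y qy.
pose tau : {linear M -> S} := p \o corestrict imf.
have stau z : exists x, tau x = z.
  have [u <-] := sp z; have [x xE] := submod_val u; exists x.
  by rewrite /tau /=; congr (p _); apply: val_inj.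
have [h hE] := pM _ _ q tau sq; have pQ : projective (FG (Q j)) by exact: FQ_projective.
have [g gE] := pQ _ _ tau q stau.
exists j; have [[n nil]|bij] := fitting (h \o g) (FQ_fdim j) (FQ_indecomposable j).
  case: qy; have qi l x : q (lin_iter (h \o g) l x) = q x.
    by elim: l => //= l IH; rewrite hE gE.
  by rewrite -(qi n) nil linear0.
have [u [uK Ku]] := bij_inv_linear bij.
pose g' : {linear _ -> _} := g \o u; have hg' x : h (g' x) = x by exact: Ku.
pose e : {linear M -> M} := g' \o h; have ee x : e (e x) = e x by exact: (congr1 g' (hg' (h x))).
have [K0|I1] := Mi _ _ (idempotent_decomp ee).
  exists h; exists g' => // x; apply/esym/subr0_eq; apply: contrapT => n0; apply: K0.
  have kx : e (x - g' (h x)) = 0 by rewrite linearB -[g' (h x)]/(e x) ee subrr.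
  by exists (in_submod (U := submod_ker e) kx); apply/eqP => /(congr1 val).
have [[z z0] _] := FQ_indecomposable j; case/eqP: z0; rewrite -[z]hg'.
apply: contrapT => n0; apply: I1.
have kx : (idfun \- e) (g' z) = 0 by apply/eqP; rewrite subr_eq0; apply/eqP/esym; exact: (congr1 g' (hg' z)).
exists (in_submod (U := submod_ker (idfun \- e)) kx); apply/eqP => /(congr1 val) /= gz.
by apply: n0; rewrite [g' z]gz linear0.
Qed.

Lemma Gamma_Q_complete : complete_indec_projectives (fun i => Gamma_tensor (Q i)).
Proof.
have iso i := tensor_FG (Q i); have iso' i := mod_iso_sym (iso i); split.
- move=> i; split; first exact: indecomposable_iso (iso' i) (FQ_indecomposable i).
  exact: (projective_iso (iso' i) (@FQ_projective i)).
- move=> i j ij; have [_ Qinj _ _] := Q_fam; apply: Qinj; apply/isoA_FG.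
  exact: mod_iso_trans (iso' i) (mod_iso_trans ij (iso j)).
by move=> M Mi pM; have [j Mj] := FQ_complete Mi pM; exists j; exact: mod_iso_trans Mj (iso' j).
Qed.

End FullyFaithful.

(** * Strictness and the standard modules *)

Section Strict.
Variable le : rel P.
Hypotheses (le_refl : reflexive le) (le_trans : transitive le) (D_strict : P_strict D le).
Local Notation lt i j := (le i j && ~~ le j i).

Lemma lt_trans : transitive (fun i j => lt i j).
Proof.
move=> j i l /andP[ij ji] /andP[jl lj]; rewrite (le_trans ij jl).
by apply: contra ji => li; exact: le_trans li.
Qed.

Lemma W0_corner j i (w : W0) : corner j i w != 0 -> lt i j.
Proof.
case: D_strict => _ h _ c0; apply: h; apply: contraNneq c0 => p0.
by apply/eqP/corner_peirce.
Qed.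

Lemma W1_corner j i (w : W1) : corner j i w != 0 -> le i j.
Proof.
case: D_strict => h _ _ c0; apply: h; apply: contraNneq c0 => p0.
by apply/eqP/corner_peirce.
Qed.

(* The character of A with kernel sum_(j != i) k e_j + A W0 A is killed by    *)
(* rad A, hence kills I.                                                      *)
Lemma augmentation i : exists e : Abar -> k,
  [/\ (forall x y, e (x + y) = e x + e y) /\ (forall x y, e (x * y) = e x * e y), e 1 = 1,
      forall s, e (sA s) = s i & forall w, e (wb w) = 0].
Proof.
have kC (c : k) (x : k) : (idfun : {rmorphism k -> k}) c * x = x * idfun c by exact: mulrC.
pose kk : kalgType k := KAlg kC.
have hs : salg_map (R := kk) (fun s : {ffun P -> k} => s i).
  by split=> [c||a b|a b]; rewrite ?ffunE.
have hz (W : sbimod k P) : sbimod_map (R := kk) (fun s : {ffun P -> k} => s i) (fun _ : W => 0 : kk).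
  by split=> [c v w|a w|a w]; rewrite ?mulr0 ?mul0r ?addr0.
have [h [[[hl h1 hM] hS h0 _] _]] := ta_univ T hs (hz W0) (hz W1).
have hc c x : h (kin T c * x) = c * h x by rewrite hM -[kin T c]mulr1 (klinZ hl) h1 [_ *k: _]mulr1.
have hD x y : h (x + y) = h x + h y by exact: (klinD hl).
pose Kp (a : A) := h (val a) = 0.
have KP : Kp 0 /\ forall a x y : A, Kp x -> Kp y -> Kp (a * x + y).
  rewrite /Kp; split=> [|a x y xK yK]; first exact: (klin0 hl).
  by rewrite /= hD hM xK yK mulr0 addr0.
pose K : submod A^o := @Submod A A^o Kp KP.
have Kmax : maximal_submod K.
  split=> [KT|U KU].
    have : K 1 by rewrite KT.
    by rewrite -[K 1]/(h 1 = 0) h1 => /eqP; rewrite oner_eq0.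
  have [[x [Ux hx]]|no] := pselect (exists x, U x /\ h (val x) <> 0).
    right; apply/seteqP; split=> // y _.
    have hc0 c (z : A) : h (val (kin A c * z)) = c * h (val z) by exact: hc.
    pose z : A := y - kin A (h (val y) * (h (val x))^-1) * x.
    have Kz : K z.
      rewrite -[K z]/(h (val z) = 0) [val z](_ : _ = val y - val (kin A (h (val y) * (h (val x))^-1) * x)) //.
      by rewrite hD (klinN hl) hc0 divfK ?subrr //; exact/eqP.
    have := submodD (KU z Kz) (submodZ (kin A (h (val y) * (h (val x))^-1)) Ux).
    by rewrite [X in U X](subrK (_ : A) y).
  left; apply/seteqP; split=> // y Uy; apply: contrapT => hy; apply: no; by exists y.
have IK (a : A) : wd_I (w := D) (val a) -> h (val a) = 0.
  case: D_strict => _ _ hI Ia.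
  have Kss : subspace (M := A^o) (fun a : A => h (val a) = 0).
    split=> [|c x y xK yK]; first exact: (klin0 hl).
    by rewrite -[val _]/(kin T c * val x + val y) hD hc xK yK mulr0 addr0.
  refine (hI a Ia (fun a : A^o => h (val (a : A)) = 0) Kss _) => _ [x [y [rx _ ->]]].
  have hx : h (val x) = 0 := rx K Kmax.
  by rewrite -[val _]/(val x * val y) hM hx mul0r.
pose e (x : Abar) := h (val (quo_repr x)).
have eE (a : A) : e (piA a) = h (val a).
  have : wd_I (w := D) (val (quo_repr (piA a) - a)).
    by apply/(quo_eq (I_ideal D)); rewrite quo_piK.
  by move/IK; rewrite -[val _]/(val (quo_repr (piA a)) - val a) hD (klinN hl) => /subr0_eq.
exists e; split; first split.
- move=> x y; have [a ->] := piA_surj x; have [b ->] := piA_surj y.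
  by rewrite -rmorphD !eE -hD.
- move=> x y; have [a ->] := piA_surj x; have [b ->] := piA_surj y.
  by rewrite -rmorphM !eE -hM.
- by rewrite -(rmorph1 piA) eE h1.
- by move=> s; rewrite eE -[val _]/(taS T s) hS.
- by move=> w; rewrite eE -[val _]/(ta0 T w) h0.
Qed.

Definition eps i : Abar -> k := sval (cid (augmentation i)).
Lemma epsD i x y : eps i (x + y) = eps i x + eps i y.
Proof. by rewrite /eps; case: cid => e [[]]. Qed.
Lemma epsM i x y : eps i (x * y) = eps i x * eps i y.
Proof. by rewrite /eps; case: cid => e [[]]. Qed.
Lemma eps1 i : eps i 1 = 1.
Proof. by rewrite /eps; case: cid => e [[]]. Qed.
Lemma epsS i s : eps i (sA s) = s i.
Proof. by rewrite /eps; case: cid => e [[]]. Qed.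
Lemma epsW i w : eps i (wb w) = 0.
Proof. by rewrite /eps; case: cid => e [[]]. Qed.
Lemma eps_kin i c : eps i (kin Abar c) = c.
Proof. by rewrite -sAc epsS ffunE. Qed.
Lemma eps_eb i j : eps i (eb j) = (i == j)%:R.
Proof. by rewrite epsS ffunE. Qed.
Lemma eps0 i : eps i 0 = 0.
Proof. by rewrite -(rmorph0 (kin Abar)) eps_kin. Qed.

Lemma wb_split l (w : W0) : eb l * wb w = \sum_j wb (corner l j w).
Proof. by rewrite -[LHS]mulr1 -eb_sum mulr_sumr; apply: eq_bigr => j _; rewrite wb_corner. Qed.

(** Each factor from W0 in a product moves strictly upwards, so no product containing one returns to
    its starting vertex; only scalars survive in the diagonal corners. *)
Lemma Abar_corner x :
  (forall l i, eb l * x * eb i != 0 -> (l == i) || lt i l) /\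
  (forall i, eb i * x * eb i = kin Abar (eps i x) * eb i).
Proof.
pose Q x := (forall l i, eb l * x * eb i != 0 -> (l == i) || lt i l) /\
  (forall i, eb i * x * eb i = kin Abar (eps i x) * eb i).
apply: (@Abar_ind Q); rewrite {x}/Q.
- split=> [l i|i]; rewrite mulr1 ebM; first by case: (l == i); rewrite ?eqxx.
  by rewrite eqxx eps1 rmorph1 mul1r.
- move=> x y [Qx ex] [Qy ey]; split=> [l i|i]; rewrite mulrDr mulrDl.
    have [->|x0 _] := eqVneq (eb l * x * eb i) 0; last exact: Qx.
    by rewrite add0r; exact: Qy.
  by rewrite ex ey epsD rmorphD mulrDl.
- move=> s x [Qx ex]; split=> [l i|i]; rewrite mulrA eb_sA -!mulrA.
    by move=> h; apply: Qx; apply: contraNneq h; rewrite -mulrA => ->; rewrite mulr0.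
  by rewrite [eb i * _]mulrA ex epsM epsS rmorphM mulrA.
move=> w x [Qx ex].
have E l i : eb l * (wb w * x) * eb i = \sum_j wb (corner l j w) * (eb j * x * eb i).
  rewrite mulrA wb_split !mulr_suml; apply: eq_bigr => j _.
  by rewrite !wb_corner -!mulrA [eb j * (eb j * _)]mulrA ebM eqxx.
have Z l i j : wb (corner l j w) * (eb j * x * eb i) != 0 -> lt i l.
  move=> h; have jl : lt j l.
    by apply: (@W0_corner l j w); apply: contraNneq h => ->; rewrite a00 mul0r.
  have /orP[/eqP <- //|ij] : (j == i) || lt i j.
    by apply: Qx; apply: contraNneq h => ->; rewrite mulr0.
  exact: lt_trans ij jl.
split=> [l i|i]; rewrite E.
  move=> h; apply/orP; right; apply: contraNT h => nlt; rewrite big1 // => j _.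
  by apply/eqP; apply: contraNT nlt; exact: Z.
rewrite epsM epsW mul0r rmorph0 mul0r big1 // => j _.
by apply/eqP; apply/negPn/negP => /Z; rewrite le_refl.
Qed.

Lemma eb_x_eb i x : eb i * x * eb i = kin Abar (eps i x) * eb i.
Proof. exact: (Abar_corner x).2. Qed.

Lemma left_ideal_decomp i x : exists (c : k) (y : P -> 'I_(\dim {:W0}) -> Abar),
  x * eb i = kin Abar c * eb i + \sum_j \sum_t y j t * eb j * wb (corner j i (vbasis {:W0})`_t).
Proof.
pose b (t : 'I_(\dim {:W0})) := (vbasis {:W0})`_t.
pose S (y : P -> 'I_(\dim {:W0}) -> Abar) := \sum_j \sum_t y j t * eb j * wb (corner j i (b t)).
have SM a y : a * S y = S (fun j t => a * y j t).
  rewrite mulr_sumr; apply: eq_bigr => j _; rewrite mulr_sumr; apply: eq_bigr => t _.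
  by rewrite !mulrA.
have SD y z : S y + S z = S (fun j t => y j t + z j t).
  rewrite -big_split; apply: eq_bigr => j _; rewrite -big_split; apply: eq_bigr => t _.
  by rewrite !mulrDl.
move: x; apply: (@Abar_ind (fun x => exists c y, x * eb i = kin Abar c * eb i + S y)).
- exists 1, (fun _ _ => 0); rewrite rmorph1 mul1r [S _]big1 ?addr0 // => j _.
  by rewrite big1 // => t _; rewrite !mul0r.
- move=> x x' [c [y e]] [c' [y' e']]; exists (c + c'), (fun j t => y j t + y' j t).
  by rewrite mulrDl e e' -SD rmorphD mulrDl addrACA.
- move=> s x [c [y e]]; exists (c * s i), (fun j t => sA s * y j t).
  by rewrite -mulrA e mulrDr SM; congr (_ + _); rewrite mulrA -kin_central -mulrA sA_eb mulrA rmorphM.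
move=> w x [c [y e]].
exists 0, (fun j t => kin Abar (c * coord (vbasis {:W0}) t w) + wb w * y j t).
rewrite -mulrA e mulrDr rmorph0 mul0r add0r SM -SD; congr (_ + _).
rewrite mulrA -kin_central -mulrA -[wb w * eb i]mul1r -eb_sum !mulr_suml mulr_sumr.
apply: eq_bigr => j _; rewrite [eb j * _]mulrA -[eb j * wb w * eb i]wb_corner.
rewrite {1}(coord_vbasis (memvf w)) linear_sum.
rewrite (eq_bigr (fun t => coord (vbasis {:W0}) t w *: corner j i (b t))); last first.
  by move=> t _; rewrite linearZ.
rewrite a0_sum mulr_sumr; apply: eq_bigr => t _.
rewrite mulrA -(rmorphM (kin Abar)) wb_corner -!mulrA; congr (_ * _).
by rewrite !mulrA ebM eqxx.
Qed.

(** Induction on the number of vertices strictly above i: modulo k e_i, the left ideal of e_i is a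
    finite sum of images of left ideals of e_j with j strictly above i. *)
Lemma left_ideal_fdim i : exists s : seq (Abar^o), forall x : Abar, lspan (M := Abar^o) s (x * eb i).
Proof.
have [n ni] := ubnP #|[set l | lt i l]|; elim: n => // n IH in i ni *.
have /choice[s sE] j : exists s : seq (Abar^o), lt i j -> forall x : Abar, lspan (M := Abar^o) s (x * eb j).
  have [ij|ij] := boolP (lt i j); last by exists [::].
  have [|s sP] := IH j; last by exists s.
  rewrite ltnS in ni; apply: leq_trans ni; apply/proper_card/properP; split.
    by apply/fintype.subsetP => l; rewrite !inE; exact: lt_trans.
  by exists j; rewrite !inE // le_refl.
pose b (t : 'I_(\dim {:W0})) := (vbasis {:W0})`_t.
pose f j t (x : Abar^o) : Abar^o := (x : Abar) * wb (corner j i (b t)).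
have fl j t : klinear (f j t).
  move=> c x y; rewrite /f [LHS]mulrDl; congr (_ + _); exact/esym/mulrA.
exists ((eb i : Abar^o) :: flatten [seq flatten [seq map (f j t) (if lt i j then s j else [::])
  | t <- index_enum 'I_(\dim {:W0})] | j <- index_enum P]) => x /=.
have [c [y ->]] := left_ideal_decomp i x; exists c.
rewrite [c *k: _]/(kin Abar c * eb i) addrC addKr.
apply: lspan_flatten => j; apply: lspan_flatten => t.
have [ij|ij] := boolP (lt i j); first by apply: (lspan_map (fl j t)); exact: sE.
have -> : corner j i (b t) = 0 by apply/eqP; apply: contraNT ij; exact: W0_corner.
by rewrite a00 mulr0.
Qed.

Lemma Abar_fdim : fdim (B := Abar) Abar^o.
Proof.
have [s sE] := choice left_ideal_fdim.
apply: (@fdim_lspan _ _ _ (flatten [seq s i | i <- index_enum P])) => x.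
rewrite -[x]mulr1 -eb_sum mulr_sumr; exact: lspan_flatten.
Qed.

Let Abar_fd := Abar_fdim.

(** * The standard modules, their Hom and Ext, and the filtration of Gamma *)

Local Notation Del i := (Gamma_tensor (Sbar D i)).

(** The one-dimensional module on which A/I acts through the character [eps i]. *)
Definition is_simple i M : Prop := exists y : M,
  [/\ y != 0, forall a : Abar, a *: y = eps i a *k: y & forall x, exists c, x = c *k: y].

Lemma kscale_eq0 M c (y : M) : y != 0 -> c *k: y = 0 -> c = 0.
Proof.
move=> y0 e; apply: contraNeq y0 => c0.
by rewrite -[y]kscale1 -(mulVf c0) -kscaleA e kscaler0.
Qed.

Lemma kscale_inj M c d (y : M) : y != 0 -> c *k: y = d *k: y -> c = d.
Proof.
move=> y0 e; apply/subr0_eq/(kscale_eq0 y0).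
by rewrite kscaleDl e -kscaleDl subrr kscale0.
Qed.

Lemma simple_iso i M N : is_simple i M -> is_simple i N -> mod_iso M N.
Proof.
move=> [y [y0 yZ yE]] [z [z0 zZ zE]]; have /choice[c cE] := yE.
have cu x d : x = d *k: y -> c x = d by move=> e; apply: (kscale_inj y0); rewrite -cE.
have fl : linear (fun x => c x *k: z).
  move=> a x x'; have -> : c (a *: x + x') = c x * eps i a + c x'.
    by apply: cu; rewrite {1}[x]cE {1}[x']cE -kscale_scale yZ kscaleA kscaleDl.
  by rewrite kscaleDl -kscaleA -zZ kscale_scale.
exists (linear_of fl); apply: inj_surj_bij.
  by apply: linear_injP => x /(kscale_eq0 z0) e; rewrite [x]cE e kscale0.
by move=> w; have [d ->] := zE w; exists (d *k: y) => /=; rewrite (@cu _ d).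
Qed.

Lemma eps_Pgen_submod i (U : submod (Pbar D i)) x : U x -> eps i (pval x) != 0 -> U (Pgen i).
Proof.
move=> Ux e0; have := submodZ (kin Abar (eps i (pval x))^-1 * eb i) Ux.
suff -> : (kin Abar (eps i (pval x))^-1 * eb i) *: x = Pgen i by [].
apply: pval_inj; rewrite pvalZ pval_gen -[X in _ * X]pval_eb.
rewrite -mulrA [eb i * _]mulrA eb_x_eb.
by rewrite mulrA -rmorphM mulVf // rmorph1 mul1r.
Qed.

Fact Pbar_aug_proof i (U := fun x : Pbar D i => eps i (pval x) = 0) :
  U 0 /\ forall a x y, U x -> U y -> U (a *: x + y).
Proof.
split=> [|a x y Ux Uy]; first by rewrite /U pval0 eps0.
by rewrite /U pvalD pvalZ epsD epsM Ux Uy mulr0 addr0.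
Qed.

(** P_i is local: an element with nonzero [eps i] generates it after multiplication by e_i, so every
    proper submodule lies in the kernel of [eps i]. *)
Lemma rad_Pbar i (x : Pbar D i) : Defs.rad (Pbar D i) x <-> eps i (pval x) = 0.
Proof.
pose U0 := Submod (Pbar_aug_proof i).
have U0E y : U0 y = (eps i (pval y) = 0) by [].
have gen : eps i (pval (Pgen i)) = 1 by rewrite pval_gen eps_eb eqxx.
have genU (U : submod (Pbar D i)) : U (Pgen i) -> smset U = setT.
  by move=> Ug; apply/seteqP; split=> // y _; rewrite [y]Pbar_gen; exact: submodZ.
have U0n : smset U0 <> setT.
  move=> U0T; have : smset U0 (Pgen i) by rewrite U0T.
  by rewrite U0E gen => /eqP; rewrite oner_eq0.
have propU (U : submod (Pbar D i)) : smset U <> setT -> forall y, U y -> U0 y.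
  move=> Un y Uy; rewrite U0E; apply/eqP/negPn/negP => e; apply: Un; apply: genU.
  exact: eps_Pgen_submod Uy e.
rewrite -U0E; split=> [rx|ex].
  apply: (rx U0); split=> // U' U0U'; have [U'T|U'n] := pselect (smset U' = setT); first by right.
  by left; apply/seteqP; split=> // y; exact: propU.
move=> U [Un Umax]; have [e|//] := Umax U0 (propU U Un).
by move: ex; rewrite -[U0 x]/(smset U0 x) e.
Qed.

Lemma Sbar_simple i : is_simple i (Sbar D i).
Proof.
pose pr := quo_linear (Defs.rad (Pbar D i)).
have prE x : pr x = eps i (pval x) *k: pr (Pgen i).
  apply/subr0_eq; rewrite /kscale -linearZ -linearB; apply/quo_linear_eq0/rad_Pbar.
  rewrite -scaleN1r -(rmorphN1 (kin Abar)) pvalD !pvalZ pval_gen.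
  by rewrite epsD !epsM !eps_kin eps_eb eqxx mulr1 mulN1r subrr.
exists (pr (Pgen i)); split.
- apply/eqP => /quo_linear_eq0/rad_Pbar/eqP.
  by rewrite pval_gen eps_eb eqxx oner_eq0.
- by move=> a; have := prE (a *: Pgen i); rewrite linearZ pvalZ pval_gen epsM eps_eb eqxx mulr1.
by move=> x; exists (eps i (pval (quo_repr x))); rewrite -prE [RHS]quo_piK.
Qed.

Lemma simple_eb i M l (x : M) : is_simple i M -> l != i -> eb l *: x = 0.
Proof.
move=> [y [y0 yZ yE]] li; have [c ->] := yE x.
by rewrite -kscale_scale yZ eps_eb eq_sym (negPf li) kscale0 kscaler0.
Qed.

Lemma simple_fdim i M : is_simple i M -> fdim M.
Proof.
move=> [y [_ _ yE]]; exists 1%N, (fun=> y) => x; have [c ->] := yE x.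
by exists (fun=> c); rewrite big_ord_recl big_ord0 addr0.
Qed.

(** For finite-dimensional M: no composition factor S_l with l <= j. *)
Definition avoids j M : Prop := forall l, le l j -> forall m : M, eb l *: m = 0.

(** Only e_j acts nontrivially on [N]. So f^0 sees only e_j M, which is zero, and f^1(w) sees only
    the parts e_i M with e_j W1 e_i nonzero; strictness then gives i <= j, so these vanish too. *)
Lemma avoids_mor0 j M N (f : mor M N) : avoids j M -> is_simple j N -> f = 0.
Proof.
move=> aM sN.
have ev0 (x : N) : eb j *: x = 0 -> x = 0.
  by move=> e; rewrite [x]eb_decomp big1 // => l _; case: (eqVneq l j) => [->//|]; exact: simple_eb.
apply: mor_eq => [m|w m]; apply: ev0; first by rewrite -mor0_S aM // mor00.
rewrite [m]eb_decomp mor1_sum scaler_sumr big1 // => i _.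
rewrite -(bimod_map_corner _ _ _ _ (mor1_bimod_map f)).
have [lij|lij] := boolP (le i j).
  by rewrite (bimod_map_corner _ _ _ _ (mor1_bimod_map f)) aM // mor10 scaler0.
have -> : corner j i w = 0 by apply/eqP; apply: contraNT lij; exact: W1_corner.
exact: bimod_map0 (mor1_bimod_map f).
Qed.

Lemma Pbar_eb i l (x : Pbar D i) : eb l *: x != 0 -> (l == i) || lt i l.
Proof.
move=> h; apply: ((Abar_corner (pval x)).1 l i).
by rewrite -mulrA pval_eb; apply: contraNneq h => e; apply/eqP/pval_inj; rewrite pvalZ e.
Qed.

Lemma Pbar_avoids i j : ~~ le i j -> avoids j (Pbar D i).
Proof.
move=> nij l lj x; apply/eqP; apply: contraNT nij => /Pbar_eb/orP[/eqP <- //|/andP[il _]].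
exact: le_trans il lj.
Qed.

Lemma sub_avoids j M (U : submod M) : avoids j M -> avoids j (sub_of U).
Proof. by move=> aM l lj x; apply: val_inj; exact: aM. Qed.

(** If e_l acts nontrivially on the radical of P_i then l is strictly above i, and l <= j would put
    i strictly below j. *)
Lemma rad_Pbar_avoids i j : ~~ lt i j ->
  avoids j (sub_of (submod_ker (quo_linear (Defs.rad (Pbar D i))))).
Proof.
move=> nij l lj x; apply: val_inj; apply/eqP; change (eb l *: (val x : Pbar D i) == 0).
apply: contraNT nij => /[dup] h /Pbar_eb/orP[/eqP li|/andP[il nli]].
  case/eqP: h; have rx : eps i (pval (val x)) = 0.
    by apply/rad_Pbar/quo_linear_eq0; exact: (submod_val x).
  apply: pval_inj; rewrite pvalZ li -pval_eb mulrA.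
  by rewrite eb_x_eb rx rmorph0 mul0r.
rewrite (le_trans il lj) /=; apply: contra nli => ji; exact: le_trans lj ji.
Qed.

(** Only vectors e_l b with l <= j false need covering, and the corresponding P_l avoid j themselves
    because e_m P_l is nonzero only for m >= l. Hence the kernel of the cover avoids j as well. *)
Lemma avoiding_cover j K : fdim K -> avoids j K -> exists X (p : {linear X -> K}),
  [/\ fdim X, avoids j X, projective (FG X) & forall y, exists x, p x = y].
Proof.
move=> [n [b bE]] aK.
have H (s : seq ('I_n * P)) : exists X (p : {linear X -> K}),
    [/\ fdim X, avoids j X, projective (FG X) & forall q, q \in s -> exists x, p x = eb q.2 *: b q.1].
  elim: s => [|[i l] s [X [p [fX aX pX pE]]]].
    pose Z := submod_ker (idfun : {linear K -> K}).
    have Z0 (x : sub_of Z) : x = 0 by apply: val_inj; exact: submod_val x.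
    exists (sub_of Z), (submod_incl Z); split=> //; last exact: FG_trivial.
    by apply: sub_fdim; exists n, b.
  have [lj|nlj] := boolP (le l j).
    exists X, p; split=> // q; rewrite inE => /orP[/eqP->|/pE//].
    by exists 0; rewrite linear0 aK.
  exists (X * Pbar D l)%type, (lin_copair p (Pmap l (b i))); split.
  - by apply: fdim_prod => //; exact: sub_fdim Abar_fd.
  - move=> l' l'j [x y]; congr pair; first exact: aX.
    exact: Pbar_avoids nlj _ l'j _.
  - by apply: FG_prod_projective => //; exact: FG_Pbar_projective.
  move=> q; rewrite inE => /orP[/eqP->|/pE[x xE]].
    by exists (0, Pgen l); rewrite /= linear0 add0r.
  by exists (x, 0); rewrite -[LHS]/(p x + Pmap l (b i) 0) linear0 addr0.
have [X [p [fX aX pX pE]]] := H (enum {: 'I_n * P}).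
exists X, p; split=> // y; have [c ->] := bE y.
pose I := submod_im p; suff: I (\sum_i c i *k: b i) by case=> x ->; exists x.
apply: submod_sum => i; apply: submodZ; rewrite [b i]eb_decomp; apply: submod_sum => l.
by have [x xE] := pE (i, l) (mem_enum _ _); exists x; rewrite xE.
Qed.

Lemma FG_hom0 j K (X N : lmodType Gam) (f : {linear X -> N}) : avoids j K ->
  mod_iso X (FG K) -> mod_iso N (FG (Sbar D j)) -> forall x, f x = 0.
Proof.
move=> aK /mod_iso_sym[g gb] [h hb] x.
have [u uE] := Fmap_full Abar_fd (h \o f \o g).
have [g' gK g'K] := gb; apply: (bij_inj hb); rewrite linear0 -[x]g'K.
rewrite -[LHS]/((h \o f \o g) (g' x)) uE (avoids_mor0 u aK (Sbar_simple j)).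
exact: comp0f.
Qed.

(** Apply [ext_vanish] to the images under [FG] of the modules avoiding j; the first syzygy is the
    image of rad P_i. *)
Lemma Ext_Delta n i j : Ext_neq0 n.+1 (Del i) (Del j) -> lt i j.
Proof.
apply: contraPT => nij.
apply: (@ext_vanish _ (Del i) (Del j)
  (fun X : lmodType Gam => exists K, [/\ fdim K, avoids j K & mod_iso X (FG K)])).
- move=> X [K [fK aK XK]]; have [Y [p [fY aY pY sp]]] := avoiding_cover fK aK.
  exists (FG Y), (FG (sub_of (submod_ker p))); split.
    exists (sub_of (submod_ker p)); split; last exact: mod_iso_refl.
      exact: sub_fdim.
    exact: sub_avoids.
  exact: presents_iso (mod_iso_sym XK) (FG_presents Abar_fd sp pY).
- pose p := quo_linear (Defs.rad (Pbar D i)).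
  have sp y : exists x, p x = y by exists (quo_repr y); exact: quo_piK.
  exists (FG (Pbar D i)), (FG (sub_of (submod_ker p))); split.
    exists (sub_of (submod_ker p)); split; last exact: mod_iso_refl.
      exact/sub_fdim/sub_fdim/Abar_fd.
    exact: rad_Pbar_avoids.
  apply: presents_iso (mod_iso_sym (tensor_FG Abar_fd _)) _.
  exact: (@FG_presents Abar_fd (Pbar D i) (Sbar D i) p sp (@FG_Pbar_projective i)).
move=> X f [K [_ aK XK]]; exact: FG_hom0 aK XK (tensor_FG Abar_fd _).
Qed.

Lemma Hom_Delta i j : Hom_neq0 (Del i) (Del j) -> le i j.
Proof.
apply: contraPT => nij [f [x fx]]; apply: fx.
apply: (@FG_hom0 j (Sbar D i)); try exact: tensor_FG.
move=> l lj y; apply: (simple_eb _ (Sbar_simple i)).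
by apply: contraNneq nij => <-.
Qed.

Lemma Delta_inj i j : mod_iso (Del i) (Del j) -> i = j.
Proof.
move=> ij; have /(isoA_FG Abar_fd) : mod_iso (FG (Sbar D i)) (FG (Sbar D j)).
  apply: mod_iso_trans (tensor_FG Abar_fd _).
  by apply: mod_iso_trans ij; exact/mod_iso_sym/tensor_FG.
case=> f [g [gf fg]]; have [y [y0 yZ _]] := Sbar_simple i.
apply/eqP/negPn/negP => nij; case/eqP: y0.
apply: (bij_inj (isoA_mor0_bij gf fg)); rewrite mor00.
have -> : y = eb i *: y by rewrite yZ eps_eb eqxx kscale1.
by rewrite mor0_S (simple_eb _ (Sbar_simple j)).
Qed.

(** An isomorphism in A-mod is bijective and k-linear on underlying spaces, so a one-dimensional
    object cannot be a sum of two nonzero ones. *)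
Lemma Sbar_indecomposable i : indecomposableA (Sbar D i).
Proof.
have [y [y0 _ yE]] := Sbar_simple i; split=> [|X Y _ _ [f [g [gf fg]]]]; first by exists y.
have fE (z : (X * Y)%type) : exists c, z = c *k: mor0 f y.
  have [c cE] := yE (mor0 g z); exists c.
  by rewrite -(klinZ (mor0_lin f)) -cE -[RHS]/(mor0 (f ** g) z) fg.
apply/not_andP => -[[a a0] [b b0]].
have [c cE] := fE (a, 0); have [d dE] := fE (0, b).
have ca : a = c *k: (mor0 f y).1 by exact: (congr1 fst cE).
have cb : 0 = c *k: (mor0 f y).2 by exact: (congr1 snd cE).
have db : b = d *k: (mor0 f y).2 by exact: (congr1 snd dE).
have [c0|c0] := eqVneq c 0; first by move: a0; rewrite ca c0 kscale0 eqxx.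
have y2 : (mor0 f y).2 = 0 by rewrite -[LHS]kscale1 -(mulVf c0) -kscaleA -cb kscaler0.
by move: b0; rewrite db y2 kscaler0 eqxx.
Qed.

Lemma Delta_indecomposable i : indecomposable (Del i).
Proof.
apply: indecomposable_iso (mod_iso_sym (tensor_FG Abar_fd _)) _.
by apply: FG_indecomposable => //; [exact: simple_fdim (Sbar_simple i)|exact: Sbar_indecomposable].
Qed.

Lemma Delta_fdim i : fdim (Del i).
Proof.
apply: fdim_iso (mod_iso_sym (tensor_FG Abar_fd _)) _.
by apply: FG_fdim => //; exact: simple_fdim (Sbar_simple i).
Qed.

(* U' is obtained by adjoining e_i m to U, for i maximal with e_i M not in U. *)
Lemma next_submod M (U : submod M) : smset U <> setT ->
  exists (i : P) (U' : submod M), [/\ forall x, U x -> U' x, exists x, U' x /\ ~ U x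
    & is_simple i (subquo U' U)].
Proof.
move=> UT; pose Q i := `[< exists m : M, ~ U (eb i *: m) >].
have [i0 Qi0] : exists i, Q i.
  apply: contrapT => no; apply: UT; apply/seteqP; split=> // m _.
  rewrite [m]eb_decomp; apply: submod_sum => i; apply: contrapT => h.
  by apply: no; exists i; apply/asboolP; exists m.
(* Having the fewest vertices strictly above makes i maximal: a vertex strictly above i has fewer
   still, so its part of [M] already lies in [U]. *)
case: (arg_minnP (fun i => #|[set l | lt i l]|) Qi0) => i /asboolP[m1 nU] imin.
have up l m : lt i l -> U (eb l *: m).
  move=> il; apply: contrapT => h; have Ql : Q l by apply/asboolP; exists m.
  have := imin l Ql; rewrite leqNgt => /negP; apply.
  apply/proper_card/properP; split; last by exists l; rewrite !inE // le_refl.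
  by apply/fintype.subsetP => l'; rewrite !inE; exact: lt_trans.
pose m := eb i *: m1.
have ebm : eb i *: m = m by rewrite /m scalerA ebM eqxx.
have sm s : sA s *: m = s i *k: m by rewrite /m scalerA sA_eb -scalerA.
have {}nU : ~ U m by []; clearbody m.
have wm w : U (wb w *: m).
  rewrite -[wb w *: m]scale1r -eb_sum scaler_suml; apply: submod_sum => l.
  rewrite -ebm !scalerA -wb_corner.
  have [il|il] := boolP (lt i l).
    by rewrite wb_corner -mulrA -scalerA; exact: up.
  have -> : corner l i w = 0 by apply/eqP; apply: contraNT il; exact: W0_corner.
  by rewrite a00 scale0r; exact: submod0.
have am a : U (a *: m - eps i a *k: m).
  move: a; apply: Abar_ind => [|a b Ua Ub|s a Ua|w a Ua].
  - by rewrite eps1 kscale1 scale1r subrr; exact: submod0.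
  - by rewrite epsD kscaleDl scalerDl opprD addrACA; exact: submodD.
  - have := submodZ (sA s) Ua; rewrite scalerBr scalerA -kscale_scale sm kscaleA.
    by rewrite epsM epsS mulrC.
  - have := submodD (submodZ (wb w) Ua) (submod_kscale (eps i a) (wm w)).
    by rewrite scalerBr -kscale_scale subrK scalerA epsM epsW mul0r kscale0 subr0.
have U'P (U' := fun x => exists c, U (x - c *k: m)) :
    U' 0 /\ forall a x y, U' x -> U' y -> U' (a *: x + y).
  split=> [|a x y [c Ux] [d Uy]]; first by exists 0; rewrite kscale0 subr0; exact: submod0.
  exists (c * eps i a + d); have := submodD (submodD (submodZ a Ux) (submod_kscale c (am a))) Uy.
  rewrite scalerBr -kscale_scale kscaleBr [X in X + _]addrA subrK kscaleA.
  by rewrite kscaleDl opprD addrACA.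
pose U' := Submod U'P; have U'E x : U' x = exists c, U (x - c *k: m) by [].
have U'm : U' m by rewrite U'E; exists 1; rewrite kscale1 subrr; exact: submod0.
exists i, U'; split.
- by move=> x Ux; rewrite U'E; exists 0; rewrite kscale0 subr0.
- by exists m; split=> //.
exists (subquo_linear U' U (in_submod U'm)); split.
- by apply/eqP => /subquo_linear_eq0.
- move=> a; apply/subr0_eq; rewrite /kscale -!linearZ -linearB; apply/subquo_linear_eq0.
  exact: am.
move=> y; have [x <-] := subquo_linear_surj y.
have [c Ux] : U' (val x) := submod_val x; exists c.
apply/subr0_eq; rewrite /kscale -linearZ -linearB; exact/subquo_linear_eq0.
Qed.

Lemma simple_filtration M : fdim M -> exists (t : nat) (F : nat -> submod M),
  [/\ smset (F 0%N) = [set 0]%classic, smset (F t) = setT & forall u, (u < t)%N ->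
    (forall x, F u x -> F u.+1 x) /\ exists i, is_simple i (subquo (F u.+1) (F u))].
Proof.
move=> fM; have [n [r rP]] := submod_rank fM.
have /choice[nx nxP] (U : submod M) : exists U' : submod M, smset U <> setT ->
    [/\ forall x, U x -> U' x, exists x, U' x /\ ~ U x & exists i, is_simple i (subquo U' U)].
  have [UT|UT] := pselect (smset U = setT); first by exists U.
  by have [i [U' [h1 h2 h3]]] := next_submod UT; exists U' => _; split=> //; exists i.
pose F u := iter u nx (submod_ker (idfun : {linear M -> M})).
have Ft : exists t, `[< smset (F t) = setT >].
  apply: contrapT => no; have FnT u : smset (F u) <> setT.
    by move=> h; apply: no; exists u; apply/asboolP.
  have ru u : (u <= r (F u))%N.
    elim: u => // u IH; apply: leq_ltn_trans IH _.
    have [inc [x [Fx nFx]] _] := nxP _ (FnT u).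
    have [le1 eq1] := (rP (F u)).2 (F u.+1) inc.
    by rewrite ltn_neqAle le1 andbT; apply/eqP => e; apply/nFx/(eq1 e).
  by have := leq_trans (ru n.+1) (rP (F n.+1)).1; rewrite ltnn.
case: (ex_minnP Ft) => t /asboolP tT tmin; exists t, F; split=> //.
move=> u ut; have FnT : smset (F u) <> setT.
  by move=> h; have := tmin u (introT (asboolP _) h); rewrite leqNgt ut.
by have [inc _ sim] := nxP _ FnT.
Qed.

Fact Fsub_proof (U : submod Abar^o) (G := fun f : Gam^o =>
    (forall x, U (mor0 (f : mor _ _) x)) /\ forall v x, U (mor1 (f : mor _ _) v x)) :
  G 0 /\ forall (a : Gam) f g, G f -> G g -> G (a *: f + g).
Proof.
split=> [|a f g [f0 f1] [g0 g1]]; first by split=> *; exact: submod0.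
have E : a *: f + g = (f : mor _ _) ** (a : mor _ _) + (g : mor _ _) :> mor _ _ by [].
split=> [x|v x]; rewrite E ?mor0_add ?mor1_add; apply: submodD => //=.
  exact: f0.
apply: submodD; last by apply: submod_sum => q.
exact: submodD.
Qed.
(** Hom(A/I, U) realised as a left ideal of Gamma, which is what a filtration of Gamma by submodules
    requires. *)
Definition Fsub (U : submod Abar^o) : submod Gam^o := Submod (Fsub_proof U).

(** Exactness of [FG] on the strict sequence from U through U' to U'/U: composing with the
    projection is onto, and its kernel consists of the morphisms with values in [U]. *)
Lemma Fsub_subquo (U U' : submod Abar^o) : (forall x, U x -> U' x) ->
  mod_iso (subquo (Fsub U') (Fsub U)) (FG (subquo U' U)).
Proof.
move=> UU'; pose inc := reg_FG \o submod_incl (Fsub U').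
have incF x : exists g, inc x = Fmap (strict_mor (submod_incl U')) g.
  by have [f0 f1] := submod_val x; exact: mor_factor_sub f0 f1.
have [L LE] := factor_inj (@Fmap_incl_inj _ U') incF.
pose pi := subquo_linear U' U.
apply: (mod_iso_factor (p := subquo_linear (Fsub U') (Fsub U)) (f := Fmap (strict_mor pi) \o L)).
- exact: subquo_linear_surj.
- move=> y; have [g gE] := Fmap_surj Abar_fd (@subquo_linear_surj _ _ U' U) y.
  have gU : Fsub U' (Fmap (strict_mor (submod_incl U')) g : mor _ _).
    split=> [x|v x]; first exact: (submod_val (mor0 (g : mor _ _) x)).
    by rewrite [mor1 _ v x]comp_strictl; exact: (submod_val (mor1 (g : mor _ _) v x)).
  exists (in_submod gU); rewrite /= -gE; congr (strict_mor pi ** _).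
  by apply: (@Fmap_incl_inj _ U'); rewrite -LE.
move=> x; have x0 m : mor0 (val x : mor _ _) m = val (mor0 (L x : mor _ _) m).
  exact: (congr1 (fun h : FG Abar^o => mor0 (h : mor _ _) m) (LE x)).
have x1 v m : mor1 (val x : mor _ _) v m = val (mor1 (L x : mor _ _) v m).
  rewrite -[RHS](comp_strictl (submod_incl U') (L x)).
  exact: (congr1 (fun h : FG Abar^o => mor1 (h : mor _ _) v m) (LE x)).
split=> [/subquo_linear_eq0[U0 U1]|e].
  apply: mor_ext => [m|v m].
    by apply/subquo_linear_eq0; rewrite -x0.
  by rewrite [LHS]comp_strictl; apply/subquo_linear_eq0; rewrite -x1.
apply/subquo_linear_eq0; split=> [m|v m].
  rewrite x0; apply/subquo_linear_eq0.
  exact: (congr1 (fun h : FG (subquo U' U) => mor0 (h : mor _ _) m) e).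
rewrite x1; apply/subquo_linear_eq0; rewrite -[LHS](comp_strictl pi (L x)).
exact: (congr1 (fun h : FG (subquo U' U) => mor1 (h : mor _ _) v m) e).
Qed.

Lemma Gamma_filtered : filtered_by (fun i => Del i) Gam^o.
Proof.
have [t [F [F0 Ft FS]]] := simple_filtration Abar_fd; exists t, (fun u => Fsub (F u)); split.
- apply/seteqP; split=> f /=.
    move=> [f0 f1]; apply: mor_ext => [x|v x].
      by have : smset (F 0%N) (mor0 (f : mor _ _) x) by []; rewrite F0.
    by have : smset (F 0%N) (mor1 (f : mor _ _) v x) by []; rewrite F0.
  by move=> ->; split=> *; exact: submod0.
- by apply/seteqP; split=> // f _; split=> *; rewrite -[F t _]/(smset (F t) _) Ft.
move=> u /FS[inc [i si]]; split=> [f [f0 f1]|]; first by split=> *; exact: inc.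
exists i; apply: mod_iso_trans (Fsub_subquo inc) _.
apply: mod_iso_trans (mod_iso_sym (tensor_FG Abar_fd _)).
by apply/(isoA_FG Abar_fd)/strict_iso/(simple_iso si)/Sbar_simple.
Qed.

End Strict.
End RightAlgebra.

Theorem proposition12p6 (k : closedFieldType) (P : finType) (le : rel P)
    (le_refl : reflexive le) (le_trans : transitive le)
    (D : interlaced_weak_ditalgebra k P) (D_strict : P_strict D le)
    (Q : P -> lmodType (Abar D)) (Q_fam : Q_family Q) :
  complete_indec_projectives (fun i => Gamma_tensor (Q i)) /\
  strict_system le (fun i => Gamma_tensor (Sbar D i)).
Proof.
have Abar_fd := Abar_fdim le_refl le_trans D_strict.
have CQ := Gamma_Q_complete Abar_fd Q_fam; split=> //.
have ext n i j := @Ext_Delta _ _ _ _ le_refl le_trans D_strict n i j.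
split; last by case=> // n i j _; exact: ext.
split; first split=> //.
- exact: Gamma_fdim.
- by move=> i; exact: (Delta_fdim le_refl le_trans D_strict).
- by move=> i; exact: (Delta_indecomposable le_refl le_trans D_strict).
- by move=> i j; exact: (Delta_inj le_refl le_trans D_strict).
- by move=> i j; exact: (Hom_Delta le_refl le_trans D_strict).
- by move=> i j; exact: ext.
- exact: (Gamma_filtered le_refl le_trans D_strict).
have [ip inj comp] := CQ; exists (fun n => Gamma_tensor (Q (enum_val n))); split=> //.
- by move=> i j /inj/enum_val_inj.
- move=> M Mi pM; have [i Mj] := comp M Mi pM; exists (enum_rank i).
  by rewrite enum_rankK.
Qed.
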